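(* Let $\Sigma\subset\mathbb R^2$ be a damping set. (a) Let $M_0>0$ and $Q\in\mathcal C^1(\mathbb R_+,\mathbb R_+)$ with $Q(0)=0$, $0<Q(x)<x$ and $Q'(x)>0$ for every $x>0$ be such that $|y|\le Q(|x|)$ for every $(x,y)\in R\Sigma\cap B(0,M_0)$. (a-i) For $g_0\in\mathsf Y_\infty$ satisfying $\|g_0\|_\infty\le\frac{M_0}{\sqrt2}$, every solution $z$ of the wave equation associated with $\Sigma$ starting at $\mathfrak I^{-1}(g_0)$ satisfies $e_\infty(z)(t)\le Q^{[\lfloor t/2\rfloor]}(e_\infty(z)(0))$ for all $t\ge0$, and, for $p\in[1,+\infty)$, $e_p(z)(t)\le2^{\frac1p}Q^{[\lfloor t/2\rfloor]}(Z_p^{1/2})+Z_p^{1/2}Q^{[\lfloor t/2\rfloor]}(\max(Z_\infty,Z_p^{1/2}))$ for all $t\ge0$, where $Z_q=e_q(z)(0)$ for $q\in\{p,\infty\}$. (a-ii) Assume that the wave equation associated with $\Sigma$ is UGAS in $\mathsf X_\infty$ with rate $\beta$. Then, for every solution $z$ in $\mathsf X_\infty$, $e_\infty(z)(t)\le Q^{\left[\left\lfloor\frac{t-t_z}2\right\rfloor\right]}\left(\min\left(e_\infty(z)(0),\frac{M_0}{\sqrt2}\right)\right)$ for all $t\ge t_z$, where $t_z\ge0$ is the first nonnegative time such that $\beta(e_\infty(z)(0),t_z)=\min\left(e_\infty(z)(0),\frac{M_0}{\sqrt2}\right)$. (a-iii) Assume that there exist $M>0$ and $\mu\in(0,1)$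 such that $|y|\le\mu|x|$ for every $(x,y)\in R\Sigma\setminus B(0,M)$ and that the wave equation associated with $\Sigma$ is UGAS in $\mathsf X_\infty$. Then, for every $p\in[1,+\infty]$ and every solution $z$ in $\mathsf X_p$, one has, for $t$ large enough, $$e_p(z)(t)\le2Q^{[\lfloor t-t_1\rfloor]}(Z_p^{1/2})+2Z_p^{1/2}Q^{[\lfloor t/2\rfloor-t_2]}(Z)+Z_p\,\mu^{\frac t4-\frac12},$$ where $Z_p=e_p(z)(0)$, $Z=\max(M,Z_p^{1/2})$, and the times $t_1,t_2$ only depend on $Z_p$ and $Z$. (b) Let $M>0$ and $Q\in\mathcal C^1(\mathbb R_+,\mathbb R_+)$ with $Q(0)=0$, $0<Q(x)<x$ and $Q'(x)>0$ for every $x>0$ be such that $|y|\ge Q(|x|)$ for every $(x,y)\in R\Sigma\cap B(0,M)$. Let $p\in[1,+\infty]$ and let $z$ be a nontrivial solution in $\mathsf X_p$ starting at $\mathfrak I^{-1}(g_0)$ for some $g_0\in\mathsf Y_p$. Assume moreover that either the Lebesgue measure of $\left\{s\in[-1,1]:0<|g_0(s)|\le\frac M{\sqrt2}\right\}$ is positive or $\Sigma\cap\Delta=\{(0,0)\}$, where $\Delta=\{(x,x):x\in\mathbb R\}$. Then there exist positive constants $C_1,C_2$ only depending on the initial condition such that $e_p(z)(t)\ge C_1Q^{[\lfloor t/2\rfloor]}(C_2)$ for all $t\ge0$.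
   Context: Notation: $\mathbb R_+=[0,+\infty)$, $R=\begin{pmatrix}\frac1{\sqrt2}&\frac1{\sqrt2}\\-\frac1{\sqrt2}&\frac1{\sqrt2}\end{pmatrix}$ and $R\Sigma=\{R\xi:\xi\in\Sigma\}$; $B(0,M)$ is the Euclidean ball of $\mathbb R^2$ centered at $0$ of radius $M$; $Q^{[n]}$ is the $n$-th iterate of $Q$ ($Q^{[0]}=\mathrm{Id}$); $\lfloor\cdot\rfloor$ is the floor function. $L^p_{\mathrm{loc}}(a,+\infty)$ is the set of measurable functions whose restriction to $(a,T)$ is in $L^p$ for every $T>a$. For $p\in[1,+\infty]$, $W^{1,p}_*(0,1)=\{u\in L^p(0,1): u'\in L^p(0,1),\ u(0)=0\}$ and $\mathsf X_p=W^{1,p}_*(0,1)\times L^p(0,1)$, with norm $\|(u,v)\|_{\mathsf X_p}^p=2^{-p/2}\int_0^1(|u'+v|^p+|u'-v|^p)\,dx$ if $p<+\infty$ and $\|(u,v)\|_{\mathsf X_\infty}=\frac1{\sqrt2}\max(\|u'+v\|_{L^\infty(0,1)},\|u'-v\|_{L^\infty(0,1)})$. $\mathsf Y_p=L^p(-1,1)$ with its usual norm $\|\cdot\|_p$. $\mathfrak I:\mathsf X_p\to\mathsf Y_p$ is the isometry mapping $(z_0,z_1)$ to the function $g_0$ defined by $\begin{pmatrix} g_0(-s) \\ g_0(s) \end{pmatrix}=R\begin{pmatrix} z_1(s) \\ -z_0'(s) \end{pmatrix}$ for a.e. $s\in[0,1]$. The wave equation associated with $\Sigma$ is: $z_{tt}=z_{xx}$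 on $\mathbb R_+\times[0,1]$; $z(t,0)=0$ and $(z_t(t,1),-z_x(t,1))\in\Sigma$ for $t\in\mathbb R_+$; $z(0,x)=z_0(x)$, $z_t(0,x)=z_1(x)$ for $x\in[0,1]$. A (weak, global in time) solution in $\mathsf X_p$ with initial condition (or starting at) $(z_0,z_1)\in\mathsf X_p$ is a function $z:\mathbb R_+\times[0,1]\to\mathbb R$ for which there exist $f\in L^p_{\mathrm{loc}}(0,+\infty)$ and $g\in L^p_{\mathrm{loc}}(-1,+\infty)$ such that $z(t,x)=\frac1{\sqrt2}\int_0^{t+x}f+\frac1{\sqrt2}\int_0^{t-x}g$ for all $(t,x)\in\mathbb R_+\times[0,1]$, $z(t,0)=0$ and $(z_t(t,1),-z_x(t,1))\in\Sigma$ for a.e. $t\in\mathbb R_+$, and $z(0,x)=z_0(x)$, $z_t(0,x)=z_1(x)$ for a.e. $x\in[0,1]$; here $z_t(t,x)=\frac{f(t+x)+g(t-x)}{\sqrt2}$ and $z_x(t,x)=\frac{f(t+x)-g(t-x)}{\sqrt2}$. Set $e_p(z)(t)=\|(z(t,\cdot),z_t(t,\cdot))\|_{\mathsf X_p}$. Damping set: $\Sigma$ is a damping set if $(0,0)\in\Sigma$, $xy\ge0$ for every $(x,y)\in\Sigma$ (equivalently $|y|\le|x|$ for $(x,y)\in R\Sigma$), and $R\Sigma$ contains the graph of a universally measurable function $\varphi:\mathbb R\to\mathbb R$ with linear growth ($|\varphi(x)|\le a|x|+b$ for some $a,b\ge0$). A set $A_0\subset\mathbb R$ is universally measurable if for every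 Borel probability measure $\nu$ on $\mathbb R$ there exist Borel sets $A\subset A_0\subset B$ with $\nu(B\setminus A)=0$; $\varphi$ is universally measurable if preimages of Borel sets are universally measurable. Equivalent form of the hypotheses in terms of $\Sigma$: the condition on $R\Sigma$ in (a) (with $M=M_0$) (resp. in (b)) is equivalent to the existence of $q\in\mathcal C^1(\mathbb R_+,\mathbb R_+)$ with $q(0)=0$, $0<q(x)<x$, $|q'(x)|<1$ for $x>0$ and, for $(x,y)\in\Sigma\cap B(0,M)$, $q(|x|)\le|y|$ and $q(|y|)\le|x|$ (resp. $|y|\le q(|x|)$ or $|x|\le q(|y|)$), with $Q(x)=\frac1{\sqrt2}[2(q+\mathrm{Id})^{-1}(\sqrt2x)-\sqrt2x]$; the condition in (a-iii) is equivalent to $a|x|\le|y|\le b|x|$ for $(x,y)\in\Sigma\setminus B(0,M)$ for some $a,b>0$. UGAS: the wave equation is UGAS in $\mathsf X_p$ with rate $\beta$ if $\beta$ is a $\mathcal{KL}$ function such that $e_p(z)(t)\le\beta(e_p(z)(0),t)$ for all $t\ge0$ and every solution $z$ in $\mathsf X_p$. A $\mathcal{KL}$ function is a continuous $\beta:\mathbb R_+\times\mathbb R_+\to\mathbb R_+$ such that for each $t$, $\beta(\cdot,t)$ is increasing with $\beta(0,t)=0$, and for each $x>0$, $\beta(x,\cdot)$ is decreasing and tends to $0$ at $+\infty$.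
   Formalization: In (a-iii) the first exponent is ⌊(t−t₁)/2⌋ instead of ⌊t−t₁⌋ (the printed bound is false); in (b), in the case Σ∩Δ={(0,0)}, C₁ and C₂ may depend on the solution z, since one initial condition may have several solutions with no common constants. *)

(* Defs.v *)
From HB Require Import structures.
From mathcomp Require Import all_boot all_order all_algebra.
From mathcomp Require Import all_classical all_reals all_analysis.

Set Implicit Arguments.
Unset Strict Implicit.
Unset Printing Implicit Defensive.
Import Order.TTheory GRing.Theory Num.Theory.
Import numFieldNormedType.Exports.

Local Open Scope classical_set_scope.
Local Open Scope ring_scope.

Section wave_equation.
Context {R : realType}.
Implicit Types (p : \bar R) (D : set R) (f g u v w : R -> R).
Implicit Types (Sigma : set (R * R)) (Q : R -> R).

Local Notation mu := (@lebesgue_measure R).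

Definition norm_on D p f : \bar R := Lnorm mu p (EFin \o (f \_ D)).

Definition Lp_on D p f := measurable_fun D f /\ (norm_on D p f < +oo)%E.

Definition Lp_loc (a : R) p f :=
  measurable_fun `]a, +oo[ f /\ forall T, a < T -> Lp_on `]a, T[ p f.

(* The oriented integral from a to b, which is needed for upper bounds
   t - x < 0. *)
Definition oriented_int (a b : R) f : R :=
  if a <= b then \int[mu]_(x in `]a, b[) f x
  else - \int[mu]_(x in `]b, a[) f x.

(* C^1_c(0, 1) test functions; they define the same weak derivatives as the
   smooth ones. *)
Definition test_function (phi : R -> R) :=
  [/\ forall x : R, derivable phi x 1,
      continuous (derive1 phi) &
      exists a b : R,
        [/\ 0 < a, b < 1 & forall x : R, ~~ (a <= x <= b) -> phi x = 0]].

Definition is_weak_derivative u w :=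
  [/\ locally_integrable `]0, 1[ u, locally_integrable `]0, 1[ w &
      forall phi, test_function phi ->
        \int[mu]_(x in `]0, 1[) (u x * derive1 phi x) =
        - \int[mu]_(x in `]0, 1[) (w x * phi x)].

(* A choice of u', which is unique up to almost everywhere equality. *)
Definition weak_derivative u : R -> R := xget (cst 0) (is_weak_derivative u).

(* W^{1,p}_*(0, 1); the trace condition u(0) = 0 is about the continuous
   representative of u. *)
Definition W1p_star p u :=
  [/\ Lp_on `]0, 1[ p u,
      exists2 w, is_weak_derivative u w & Lp_on `]0, 1[ p w &
      exists ucont : R -> R,
        [/\ {within `[0, 1], continuous ucont},
            {ae mu, forall x, x \in `]0, 1[ -> u x = ucont x} &
            ucont 0 = 0]].

Definition Xspace p u v := W1p_star p u /\ Lp_on `]0, 1[ p v.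

(* The value at p = -oo is irrelevant. *)
Definition Xnorm p u v : \bar R :=
  match p with
  | r%:E =>
      (((2 `^ (- (r / 2)))%:E *
        \int[mu]_(x in `]0%R, 1%R[)
          (`|weak_derivative u x + v x| `^ r +
           `|weak_derivative u x - v x| `^ r)%:E) `^ r^-1)%E
  | +oo%E =>
      ((Num.sqrt 2)^-1%:E *
       maxe (norm_on `]0%R, 1%R[ +oo (fun x => weak_derivative u x + v x)%R)
            (norm_on `]0%R, 1%R[ +oo (fun x => weak_derivative u x - v x)%R))%E
  | -oo%E => 0%E
  end.

Definition Yspace p g := Lp_on `]-1, 1[ p g.

Definition Ynorm p g : \bar R := norm_on `]-1, 1[ p g.

Definition rotation (xi : R * R) : R * R :=
  ((xi.1 + xi.2) / Num.sqrt 2, (- xi.1 + xi.2) / Num.sqrt 2).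

(* Stated as a relation because elements of Yspace p are defined up to almost
   everywhere equality: frakI p z0 z1 g0 means that g0 is the image of
   (z0, z1). *)
Definition frakI p (z0 z1 g0 : R -> R) :=
  [/\ Xspace p z0 z1, Yspace p g0 &
      {ae mu, forall s, s \in `[0, 1] ->
        (g0 (- s), g0 s) = rotation (z1 s, - weak_derivative z0 s)}].

Definition time_deriv f g (t x : R) : R := (f (t + x) + g (t - x)) / Num.sqrt 2.

Definition space_deriv f g (t x : R) : R := (f (t + x) - g (t - x)) / Num.sqrt 2.

(* The profiles f and g are determined almost everywhere by z; they are
   carried along because z_t and z_x are defined through them. *)
Definition weak_solution Sigma p (z0 z1 : R -> R) (z : R -> R -> R) f g :=
  Xspace p z0 z1 /\
  [/\ Lp_loc 0 p f, Lp_loc (-1) p g,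
      forall t x : R, 0 <= t -> x \in `[0, 1] ->
        z t x = (Num.sqrt 2)^-1 * oriented_int 0 (t + x) f
              + (Num.sqrt 2)^-1 * oriented_int 0 (t - x) g,
      {ae mu, forall t, 0 <= t ->
        z t 0 = 0 /\ Sigma (time_deriv f g t 1, - space_deriv f g t 1)} &
      {ae mu, forall x, x \in `[0, 1] ->
        z 0 x = z0 x /\ time_deriv f g 0 x = z1 x}].

Definition energy p (z : R -> R -> R) f g (t : R) : \bar R := Xnorm p (z t) (time_deriv f g t).

Definition universally_measurable (A0 : set R) :=
  forall nu : probability (measurableTypeR R) R,
    exists A B : set (measurableTypeR R),
      [/\ measurable A, measurable B, A `<=` A0, A0 `<=` B & nu (B `\` A) = 0%E].

Definition universally_measurable_fun (phi : R -> R) :=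
  forall B : set (measurableTypeR R), measurable B ->
    universally_measurable (phi @^-1` B).

Definition linear_growth (phi : R -> R) :=
  exists a b, [/\ 0 <= a, 0 <= b & forall x, `|phi x| <= a * `|x| + b].

Definition damping_set Sigma :=
  [/\ Sigma (0, 0),
      forall x y, Sigma (x, y) -> 0 <= x * y &
      exists phi, [/\ universally_measurable_fun phi, linear_growth phi &
        forall x, (rotation @` Sigma) (x, phi x)]].

(* Closed; the library's balls of R * R are those of the maximum norm. *)
Definition euclidean_ball (M : R) : set (R * R) :=
  [set xi | Num.sqrt (xi.1 ^+ 2 + xi.2 ^+ 2) <= M].

Definition plane_diagonal : set (R * R) := [set xi | xi.1 = xi.2].

(* C^1 on the closed half-line, with a one-sided derivative at 0. *)
Definition C1_halfline Q (dQ : R -> R) :=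
  (forall x, 0 <= x ->
    (Q y - Q x) / (y - x) @[y --> within [set y | 0 <= y] x^'] --> dQ x) /\
  {within `[0, +oo[, continuous dQ}.

Definition decay_function Q :=
  [/\ forall x, 0 <= x -> 0 <= Q x, Q 0 = 0,
      forall x, 0 < x -> 0 < Q x < x &
      exists2 dQ, C1_halfline Q dQ & forall x, 0 < x -> 0 < dQ x].

Definition class_KL (beta : R -> R -> R) :=
  [/\ {within [set xt : R * R | 0 <= xt.1 /\ 0 <= xt.2],
        continuous (fun xt : R * R => beta xt.1 xt.2)},
      forall x t, 0 <= x -> 0 <= t -> 0 <= beta x t,
      forall t, 0 <= t -> beta 0 t = 0 /\
        forall x y, 0 <= x -> x < y -> beta x t < beta y t &
      forall x, 0 < x ->
        (forall s t, 0 <= s -> s < t -> beta x t < beta x s) /\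
        beta x t @[t --> +oo] --> 0].

Definition UGAS_with_rate Sigma p (beta : R -> R -> R) :=
  class_KL beta /\
  forall (z0 z1 : R -> R) (z : R -> R -> R) f g,
    weak_solution Sigma p z0 z1 z f g -> forall t, 0 <= t ->
      (energy p z f g t <= (beta (fine (energy p z f g 0)) t)%:E)%E.

Definition UGAS Sigma p := exists beta, UGAS_with_rate Sigma p beta.

Definition first_time (h : R -> R) (c t : R) :=
  [/\ 0 <= t, h t = c & forall s, 0 <= s -> s < t -> h s <> c].

End wave_equation.

(* Main.v *)
Require Import Defs.
From HB Require Import structures.
From mathcomp Require Import all_boot all_order all_algebra.
From mathcomp Require Import all_classical all_reals all_analysis.
From mathcomp Require Import measurable_realfun ess_sup_inf.
From mathcomp Require Import ring lra zify.

Set Implicit Arguments.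
Unset Strict Implicit.
Unset Printing Implicit Defensive.
Import Order.TTheory GRing.Theory Num.Theory.
Import numFieldNormedType.Exports.

Local Open Scope classical_set_scope.
Local Open Scope ring_scope.

(** A solution is determined by the profile g of d'Alembert's formula. The
    condition z(t, 0) = 0 forces f = - g on positive times, and the condition
    at x = 1 becomes: (g(s), g(s + 2)) belongs to the rotated set R Sigma for
    almost every s > -1 (solution_profile). Moreover the norm of X_p is chosen
    so that the energy at time t is the L^p norm of g over the window
    ]t - 1, t + 1[ (energyE). This rests on the identification of the weak
    derivative of z(t, .), hence on the uniqueness of weak derivatives and on
    the weak differentiability of primitives. The wave equation thus becomes a
    family of independent discrete dynamical systems: for almost every s in
    ]-1, 1[, the orbit x_n = |g(s + 2n)| is nonincreasing because Sigma is
    damping, and the hypotheses on Sigma say how x_(n+1) compares with Q(x_n)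
    when x_n is small. Since |g(s + 2)| <= |g(s)|, the energy is nonincreasing
    and it is enough to look at even times.

    Upper bounds. While x_n <= M0 / sqrt 2, x_(n+1) <= Q(x_n), so that x_n is
    below the n-th iterate of Q; this settles p = +oo. For finite p, let
    A = sqrt Z_p. Orbits starting below A are bounded by the iterates from A.
    For an orbit starting above A, the bound may be multiplied by
    |g(s)| / A >= 1; after integration, Minkowski's inequality turns this
    quotient into a factor Z_p / A = A (finite_decay).

    When the equation is UGAS, orbits with a large initial value eventually
    enter the region where Q governs them. Uniform stability is a statement on
    essential suprema, but orbits are independent and (0, 0) is in Sigma:
    replacing by zero the orbits that start above K gives the profile of
    another solution, of initial norm at most K, to which the rate beta applies
    (ugas_pointwise, through the converse construction profile_solution). So
    each orbit starting below K is below beta(K, 2n) after n steps. For data in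
    L^p without a bound, the linear contraction outside a ball first brings an
    orbit below Z = max(M, A) in a number of steps that depends on its initial
    value; large_data_decay shows that the loss of these steps is paid for by a
    factor x_0 / A or by the geometric term.

    Lower bounds. While x_n <= M / sqrt 2, x_(n+1) >= Q(x_n). If a set E of
    orbits of positive measure has, at some step k, values in
    [c, M / sqrt 2] with c > 0, these orbits remain above the iterates of Q
    from c, and the energy is at least min(1, mu E) times such an iterate. In
    the first alternative k = 0. In the second one, an orbit that is not zero
    never reaches zero, because (x, 0) in R Sigma means that the point of Sigma
    is on the diagonal; hence either some such k and E exist, or all nonzero
    orbits stay above M / sqrt 2 forever, which bounds the energy below by a
    constant (diagonal_lower_bound). *)

(** * Almost everywhere statements and affine changes of variable *)

Section translation.
Context {R : realType}.
Local Notation mu := (@lebesgue_measure R).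

Lemma ae_mono (P Q : R -> Prop) : (forall x, P x -> Q x) ->
  {ae mu, forall x, P x} -> {ae mu, forall x, Q x}.
Proof.
by move=> PQ; apply: filterS; [exact: (ae_filter_ringOfSetsType mu)|exact: PQ].
Qed.

Lemma ae_mono2 (P1 P2 Q : R -> Prop) : (forall x, P1 x -> P2 x -> Q x) ->
  {ae mu, forall x, P1 x} -> {ae mu, forall x, P2 x} -> {ae mu, forall x, Q x}.
Proof.
by move=> PQ; apply: filterS2; [exact: (ae_filter_ringOfSetsType mu)|exact: PQ].
Qed.

Lemma ae_mono3 (P1 P2 P3 Q : R -> Prop) :
  (forall x, P1 x -> P2 x -> P3 x -> Q x) ->
  {ae mu, forall x, P1 x} -> {ae mu, forall x, P2 x} ->
  {ae mu, forall x, P3 x} -> {ae mu, forall x, Q x}.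
Proof.
by move=> PQ; apply: filterS3; [exact: (ae_filter_ringOfSetsType mu)|exact: PQ].
Qed.

Lemma ae_neq (a : R) : {ae mu, forall x, x != a}.
Proof.
exists [set a]; split => //; first exact: lebesgue_measure_set1.
by move=> x /= /negP; rewrite negbK => /eqP.
Qed.

Lemma ae_not_measure0 (E : set R) : measurable E ->
  {ae mu, forall x, ~ E x} -> mu E = 0%E.
Proof.
move=> mE [N [mN N0 EN]].
apply: (@measure_negligible _ (measurableTypeR R) _ mu) => //.
by exists N; split => // x Ex; apply: EN => /=; exact.
Qed.

Lemma measure0_ae_not (E : set R) : measurable E -> mu E = 0%E ->
  {ae mu, forall x, ~ E x}.
Proof.
by move=> mE E0; exists E; split => // x /= /contrapT.
Qed.

(** Translations (b = false) and reflections (b = true) of the line. Treating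
    them together gives one proof of the invariance of the Lebesgue measure for
    the two changes of variable t + x and t - x of d'Alembert's formula. *)
Definition affine (b : bool) (c x : R) : R := c + (-1) ^+ b * x.

Lemma measurable_affine b c : measurable_fun setT (affine b c).
Proof. by apply: measurable_funD => //; apply: measurable_funM. Qed.

Lemma affine_preimage_oo b c (u v : R) :
  affine b c @^-1` `]u, v[ =
  (if b then `]c - v, c - u[ else `]u - c, v - c[)%classic.
Proof.
by apply/seteqP; case: b; split => x; rewrite /affine /= !in_itv/=;
  rewrite ?expr1 ?expr0 => /andP[? ?]; apply/andP; split; lra.
Qed.

(** A measure that gives each half-open interval its length is the Lebesgue
    measure, and the image measure does so because single points have measure
    zero: a reflection exchanges the two half-open kinds of intervals. *)
Lemma lebesgue_measure_affine b c (A : set R) : measurable A ->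
  pushforward mu (affine b c : _ -> measurableTypeR R) A = mu A.
Proof.
have mphi := @measurable_affine b c.
move=> mA; apply/esym/lebesgue_measure_unique => //= _ [[u v]] _ <-.
rewrite /pushforward /=.
have -> : affine b c @^-1` `]u, v] =
    (if b then `[c - v, c - u[ else `]u - c, v - c])%classic.
  by apply/seteqP; case: (b); split => x; rewrite /affine /= !in_itv/=;
    rewrite ?expr1 ?expr0 => /andP[? ?]; apply/andP; split; lra.
rewrite [LHS]lebesgue_measure_itv/=.
case: b {mphi}; rewrite lebesgue_measure_itv/= !lte_fin.
  rewrite ltrD2l ltrN2; case: ifPn => // _; rewrite -!EFinB; congr EFin; lra.
rewrite ltrD2r; case: ifPn => // _; rewrite -!EFinB; congr EFin; lra.
Qed.

Lemma ge0_integral_affine b c (D : set R) (f : R -> \bar R) :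
  measurable D -> measurable_fun D f -> (forall x, D x -> 0 <= f x)%E ->
  (\int[mu]_(x in affine b c @^-1` D) f (affine b c x) =
   \int[mu]_(x in D) f x)%E.
Proof.
move=> mD mf f0; have mphi := @measurable_affine b c.
transitivity (\int[pushforward mu (affine b c : _ -> measurableTypeR R)]_(x in D)
    f x)%E.
  rewrite ge0_integral_pushforward//.
  by move=> y /set_mem; exact: f0.
apply: eq_measure_integral => //= A mA _.
exact: lebesgue_measure_affine.
Qed.

Lemma ae_affine b c (P : set R) :
  {ae mu, forall x, P x} -> {ae mu, forall x, P (affine b c x)}.
Proof.
move=> [N [mN N0 PN]]; have mphi := @measurable_affine b c.
exists (affine b c @^-1` N); split.
- by rewrite -[X in measurable X]setTI; exact: mphi.
- by rewrite -N0 -(lebesgue_measure_affine b c mN).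
- by move=> x /= Px; exact: PN.
Qed.

Lemma ae_shift c (P : set R) :
  {ae mu, forall x, P x} -> {ae mu, forall x, P (c + x)}.
Proof.
move=> /(@ae_affine false c); apply: ae_mono => x.
by rewrite /affine expr0 mul1r.
Qed.

Lemma ae_flip c (P : set R) :
  {ae mu, forall x, P x} -> {ae mu, forall x, P (c - x)}.
Proof.
move=> /(@ae_affine true c); apply: ae_mono => x.
by rewrite /affine expr1 mulN1r.
Qed.

Lemma measurable_fun_affine b c (D : set R) (f : R -> R) : measurable D ->
  measurable_fun D f ->
  measurable_fun (affine b c @^-1` D) (fun x => f (affine b c x)).
Proof.
move=> mD mf; apply: (measurable_comp mD) => //.
  by move=> _ [x Dx <-].
by apply: measurable_funTS; exact: measurable_affine.
Qed.

End translation.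

(** * The L^p norm on a set of reals *)

Section norms.
Context {R : realType}.
Local Notation mu := (@lebesgue_measure R).
Implicit Types (D : set R) (f h : R -> R).

Lemma norm_on_real D (r : R) f : 0 < r ->
  (norm_on D r%:E f = (\int[mu]_(x in D) (`|f x| `^ r)%:E) `^ r^-1)%E.
Proof.
move=> r0; rewrite /norm_on Lnorm.unlock.
rewrite [in RHS]integral_mkcond; apply: (f_equal (fun x => x `^ r^-1)%E).
apply: eq_integral => x _ /=.
by rewrite patchE /patch; case: ifP => //; rewrite normr0 powR0// gt_eqF.
Qed.

Lemma norm_on_ge0 D p f : (0 <= norm_on D p f)%E.
Proof. exact: Lnorm_ge0. Qed.

Lemma lebesgue_measure_setT_gt0 : (0 < mu setT)%E.
Proof.
by rewrite -set_itvNyy lebesgue_measure_itv/= ltry.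
Qed.

(** The essential supremum is taken over the whole line, of the extension by
    zero of |f|: this is why the bound has to be nonnegative. *)
Lemma norm_on_ooP D f (K : R) : 0 <= K ->
  (norm_on D +oo f <= K%:E)%E <-> {ae mu, forall x, D x -> `|f x| <= K}.
Proof.
move=> K0; rewrite /norm_on Lnorm.unlock /Lnorm lebesgue_measure_setT_gt0.
split => [/ess_supP|H].
  apply: ae_mono => x /=; rewrite lee_fin patchE => + Dx.
  by rewrite mem_set.
apply/ess_supP; move: H; apply: ae_mono => x /= H.
rewrite lee_fin patchE; case: ifPn => [/set_mem/H//|_].
by rewrite normr0.
Qed.

Lemma le_poweR (r : R) (x y : \bar R) : 0 <= r -> (0 <= x)%E -> (x <= y)%E ->
  (x `^ r <= y `^ r)%E.
Proof.
move=> r0 x0 xy; apply: gt0_ler_poweR => //; rewrite in_itv/= leey andbT//.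
exact: le_trans xy.
Qed.

Lemma measurable_normpow D f (r : R) : measurable_fun D f ->
  measurable_fun D (fun x => (`|f x| `^ r)%:E).
Proof.
move=> mf; apply/measurable_EFinP.
apply: (measurableT_comp (@measurable_powR R r)).
exact: measurableT_comp.
Qed.

Lemma ge0_ae_le_integral D (f h : R -> \bar R) : measurable D ->
  measurable_fun D f -> measurable_fun D h ->
  (forall x, D x -> 0 <= f x)%E -> (forall x, D x -> 0 <= h x)%E ->
  {ae mu, forall x, D x -> (f x <= h x)%E} ->
  (\int[mu]_(x in D) f x <= \int[mu]_(x in D) h x)%E.
Proof.
move=> mD mf mh f0 h0 fh; exact: ae_ge0_le_integral.
Qed.

Lemma le_norm_on D p f h : (1 <= p)%E -> measurable D ->
  measurable_fun D f -> measurable_fun D h ->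
  {ae mu, forall x, D x -> `|f x| <= `|h x|} ->
  (norm_on D p f <= norm_on D p h)%E.
Proof.
move=> + mD mf mh fh; case: p => [r|_|//].
  rewrite lee_fin => r1; have r0 : 0 < r by exact: lt_le_trans r1.
  rewrite (norm_on_real _ _ r0) (norm_on_real _ _ r0).
  apply: le_poweR; first by rewrite invr_ge0 ltW.
    by apply: integral_ge0 => x _; rewrite lee_fin powR_ge0.
  apply: ge0_ae_le_integral => //; try exact: measurable_normpow.
  move: fh; apply: ae_mono => x /[apply] xfh; rewrite lee_fin.
  by apply: ge0_ler_powR => //; rewrite ?nnegrE// ltW.
have := norm_on_ge0 D +oo h.
case E : (norm_on D +oo h) => [K| |//]; last by move=> _; rewrite leey.
rewrite lee_fin => K0; apply/norm_on_ooP => //.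
have /(norm_on_ooP _ _ K0) : (norm_on D +oo h <= K%:E)%E by rewrite E.
move: fh; apply: ae_mono2 => x fh hK Dx; exact: le_trans (fh Dx) (hK Dx).
Qed.

Lemma norm_onZ D p (c : R) f : (1 <= p)%E -> measurable D ->
  measurable_fun D f -> 0 <= c ->
  norm_on D p (fun x => c * f x) = (c%:E * norm_on D p f)%E.
Proof.
move=> + mD mf c0; case: p => [r|_|//].
  rewrite lee_fin => r1; have r0 : 0 < r by exact: lt_le_trans r1.
  rewrite (norm_on_real _ _ r0) (norm_on_real _ _ r0).
  under eq_integral do rewrite normrM powRM// (ger0_norm c0) EFinM.
  rewrite (@ge0_integralZl _ _ _ mu D mD (fun x => (`|f x| `^ r)%:E))//;
    first last.
  - by rewrite lee_fin powR_ge0.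
  - exact: measurable_normpow.
  rewrite poweRM ?lee_fin ?powR_ge0//; last first.
    by apply: integral_ge0 => x _; rewrite lee_fin powR_ge0.
  congr (_ * _)%E; rewrite /= -powRrM divff ?gt_eqF// powRr1//.
rewrite /norm_on Lnorm.unlock /Lnorm lebesgue_measure_setT_gt0.
rewrite -ess_supZl//; last exact: lebesgue_measure_setT_gt0.
congr (ess_sup _ _); apply/funext => x /=.
rewrite patchE/= patchE; case: ifP => _; last by rewrite normr0 mule0.
by rewrite normrM ger0_norm// EFinM.
Qed.

(** Minkowski's inequality, in the form in which a pointwise estimate along
    orbits becomes an estimate of energies. *)
Lemma norm_on_affine_bound D p (c1 c2 : R) f h : (1 <= p)%E -> measurable D ->
  measurable_fun D f -> measurable_fun D h -> 0 <= c1 -> 0 <= c2 ->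
  {ae mu, forall x, D x -> `|f x| <= c1 + c2 * `|h x|} ->
  (norm_on D p f <= c1%:E * norm_on D p (cst 1%R) + c2%:E * norm_on D p h)%E.
Proof.
move=> p1 mD mf mh c10 c20 H.
have mn : measurable_fun D (fun x => c2 * `|h x|).
  by apply: measurable_funM => //; exact: measurableT_comp.
have -> : norm_on D p h = norm_on D p (fun x => `|h x|).
  apply/eqP; rewrite eq_le !le_norm_on//; try exact: measurableT_comp;
    by apply: aeW => x _; rewrite normr_id.
rewrite -!norm_onZ//; last exact: measurableT_comp.
have m1 : measurable_fun D (cst c1) by exact: measurable_cst.
apply: (@le_trans _ _ (norm_on D p (fun x => c1 + c2 * `|h x|))).
  apply: le_norm_on => //; first exact: measurable_funD.
  move: H; apply: ae_mono => x H Dx; apply: (le_trans (H Dx)).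
  exact: ler_norm.
have E : (fun x : R => c1 * cst 1 x) = cst c1 by apply/funext => x; rewrite mulr1.
rewrite E /norm_on.
have -> : EFin \o (fun x => c1 + c2 * `|h x|) \_ D =
    EFin \o ((cst c1 \_ D) \+ ((fun x => c2 * `|h x|) \_ D))%R.
  apply/funext => x /=; congr EFin; rewrite !patchE.
  by case: ifP => //; rewrite addr0.
by apply: eminkowski => //; apply/(measurable_restrictT _ mD).
Qed.

Lemma norm_on_cst1_real D (r : R) : measurable D -> 0 < r ->
  norm_on D r%:E (cst 1) = (mu D `^ r^-1)%E.
Proof.
move=> mD r0; rewrite norm_on_real//; congr (_ `^ _)%E.
under eq_integral do rewrite normr1 powR1.
by rewrite integral_cst// mul1e.
Qed.

(** The values that g(t - x) and -f(t + x) = g(t + x) take for x in ]0, 1[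
    are those of g on this interval. *)
Definition window (t : R) : set R := `]t - 1, t + 1[%classic.

Lemma measure_window t : mu (window t) = 2%:E.
Proof.
rewrite lebesgue_measure_itv/= lte_fin ifT; last lra.
by rewrite -EFinB; congr EFin; lra.
Qed.

Lemma norm_on_cst1_le2 (t : R) (p : \bar R) : (1 <= p)%E ->
  (norm_on (window t) p (cst 1%R) <= 2%:E)%E.
Proof.
case: p => [r|_|//].
  rewrite lee_fin => r1; have r0 : 0 < r by exact: lt_le_trans r1.
  rewrite norm_on_cst1_real//; last exact: measurable_itv.
  rewrite measure_window poweR_EFin lee_fin -[leRHS]powRr1//.
  by rewrite ler_powR ?ler1n// invf_le1.
by apply/norm_on_ooP => //; apply: aeW => x _; rewrite normr1 ler1n.
Qed.

Lemma norm_on_cst1_window (t r : R) : 0 < r ->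
  norm_on (window t) r%:E (cst 1%R) = (2 `^ r^-1)%:E.
Proof.
move=> r0; rewrite norm_on_cst1_real// ?measure_window//.
exact: measurable_itv.
Qed.

Lemma norm_on_affine b c D p f : (1 <= p)%E -> measurable D ->
  measurable_fun D f ->
  norm_on (affine b c @^-1` D) p (fun x => f (affine b c x)) = norm_on D p f.
Proof.
move=> + mD mf; case: p => [r|_|//].
  rewrite lee_fin => r1; have r0 : 0 < r by exact: lt_le_trans r1.
  rewrite (norm_on_real _ _ r0) (norm_on_real _ _ r0).
  apply: (f_equal (fun x => x `^ r^-1)%E).
  apply: (@ge0_integral_affine R b c D (fun x => (`|f x| `^ r)%:E)) => //.
  exact: measurable_normpow.
have aux (F : R -> R) (E : set R) b' c' : (norm_on (affine b' c' @^-1` E) +oo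
    (fun x => F (affine b' c' x)) <= norm_on E +oo F)%E.
  have := norm_on_ge0 E +oo F.
  case EK : (norm_on E +oo F) => [K| |//]; last by move=> _; rewrite leey.
  rewrite lee_fin => K0; apply/norm_on_ooP => //.
  have /(norm_on_ooP _ _ K0) : (norm_on E +oo F <= K%:E)%E by rewrite EK.
  by move/(@ae_affine _ b' c').
apply/eqP; rewrite eq_le aux//=.
pose c' := if b then c else - c.
have K : cancel (affine b c') (affine b c).
  by move=> x; rewrite /affine /c'; case: (b); rewrite ?expr1 ?expr0; lra.
have := aux (fun x => f (affine b c x)) (affine b c @^-1` D) b c'.
rewrite -comp_preimage/= (_ : affine b c \o affine b c' = id); last first.
  by apply/funext => x /=; rewrite K.
by rewrite preimage_id; under [X in (norm_on _ _ X <= _)%E]eq_fun do rewrite K.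
Qed.

End norms.

(** * Norms over windows of length two *)

(** The times at which the profile g of a solution is defined. *)
Definition profile_domain {R : realType} : set R := `](-1)%R, +oo[%classic.

Section windows.
Context {R : realType}.
Local Notation mu := (@lebesgue_measure R).
Implicit Types (D : set R) (g : R -> R).

Lemma ge0_integral_split (a b c : R) (F : R -> \bar R) : a <= b -> b <= c ->
  measurable_fun `]a, c[ F -> (forall x, 0 <= F x)%E ->
  (\int[mu]_(x in `]a, c[) F x =
   \int[mu]_(x in `]a, b[) F x + \int[mu]_(x in `]b, c[) F x)%E.
Proof.
move=> ab bc mF F0; have [->|altb] := eqVneq a b.
  rewrite (_ : `]b, b[%classic = set0 :> set R) ?integral_set0 ?add0e//.
  by rewrite set_itv_ge// bnd_simp ltxx.
have {}altb : a < b by rewrite lt_neqAle altb.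
have [->|bltc] := eqVneq b c.
  rewrite (_ : `]c, c[%classic = set0 :> set R) ?integral_set0 ?adde0//.
  by rewrite set_itv_ge// bnd_simp ltxx.
have {}bltc : b < c by rewrite lt_neqAle bltc.
have mFb : measurable_fun `]b, c[ F.
  by apply: measurable_funS mF => //; apply: subset_itvr; rewrite bnd_simp.
rewrite (@integral_itv_obnd_cbnd _ b (BLeft c) F mFb).
rewrite (@itv_bndbnd_setU _ _ (BRight a) (BLeft b) (BLeft c)); last 2 first.
- by rewrite bnd_simp.
- by rewrite bnd_simp ltW.
rewrite ge0_integral_setU//=.
- by rewrite -itv_bndbnd_setU// ?bnd_simp// ltW.
- apply/disj_setPRL => x /=; rewrite !in_itv/= => /andP[bx _].
  by move=> /andP[_]; rewrite ltNge bx.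
Qed.

Lemma measurable_window (t : R) : measurable (window t).
Proof. exact: measurable_itv. Qed.

Lemma measurable_profile_domain : measurable (@profile_domain R).
Proof. exact: measurable_itv. Qed.

Lemma window_sub (t : R) : 0 <= t -> window t `<=` profile_domain.
Proof.
by move=> t0 x; rewrite /window/profile_domain/= !in_itv/= andbT => /andP[? _]; lra.
Qed.

(** The two windows share ]t' - 1, t + 1[, and what is gained on the right,
    ]t + 1, t' + 1[, is the translate by 2 of what is lost on the left,
    ]t - 1, t' - 1[, where |g| is larger. *)
Lemma norm_on_window_step (p : \bar R) g (t t' : R) : (1 <= p)%E ->
  measurable_fun profile_domain g ->
  {ae mu, forall s, -1 < s -> `|g (s + 2)| <= `|g s|} ->
  0 <= t -> t <= t' -> t' <= t + 2 ->
  (norm_on (window t') p g <= norm_on (window t) p g)%E.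
Proof.
move=> + mg dg t0 tt' t't; have t'0 : 0 <= t' by exact: le_trans tt'.
case: p => [r|_|//].
  rewrite lee_fin => r1; have r0 : 0 < r by exact: lt_le_trans r1.
  rewrite (norm_on_real _ _ r0) (norm_on_real _ _ r0); apply: le_poweR.
    by rewrite invr_ge0 ltW.
    by apply: integral_ge0 => x _; rewrite lee_fin powR_ge0.
  pose F := fun x => (`|g x| `^ r)%:E.
  have mF : measurable_fun profile_domain F by exact: measurable_normpow.
  have F0 x : (0 <= F x)%E by rewrite lee_fin powR_ge0.
  have mFS D : measurable D -> D `<=` profile_domain -> measurable_fun D F.
    by move=> mD DS; exact: (measurable_funS measurable_profile_domain DS mF).
  have sub (u v : R) : -1 <= u -> (`]u, v[ : set R) `<=` profile_domain.
    by move=> u1 x /=; rewrite /profile_domain/= !in_itv/= andbT => /andP[? _]; lra.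
  rewrite -!/(F _) /window.
  have h1 : t - 1 <= t' - 1 by lra.
  have h2 : t' - 1 <= t + 1 by lra.
  have h3 : t + 1 <= t' + 1 by lra.
  have s1 : measurable_fun `](t - 1)%R, (t + 1)%R[ F.
    by apply: mFS => //; apply: sub; lra.
  have s2 : measurable_fun `](t' - 1)%R, (t' + 1)%R[ F.
    by apply: mFS => //; apply: sub; lra.
  rewrite (@ge0_integral_split _ _ _ F h1 h2 s1 F0).
  rewrite (@ge0_integral_split _ _ _ F h2 h3 s2 F0).
  rewrite addeC; apply: leeD => //.
  have e1 : t + 1 = t - 1 + 2 by lra.
  have e2 : t' + 1 = t' - 1 + 2 by lra.
  rewrite e1 e2.
  rewrite -(@ge0_integral_affine R false 2 _ F); last 3 first.
  - exact: measurable_itv.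
  - by apply: mFS => //; apply: sub; lra.
  - by move=> x _; exact: F0.
  rewrite affine_preimage_oo !addrK.
  have mI : measurable (`]t - 1, t' - 1[%classic : set R) by exact: measurable_itv.
  apply: (ge0_ae_le_integral mI) => //.
  - have := @measurable_fun_affine R false 2 profile_domain g
      measurable_profile_domain mg.
    move=> /measurable_normpow H; apply: measurable_funS (H r) => //.
      rewrite -[X in measurable X]setTI; apply: measurable_affine => //.
      exact: measurable_profile_domain.
    move=> x; rewrite /affine /profile_domain/= !in_itv/= expr0 mul1r andbT => /andP[? _]; lra.
  - by apply: mFS => //; apply: sub; lra.
  - move: dg; apply: ae_mono => x H /=; rewrite in_itv/= => /andP[x1 _].
    rewrite /F /affine expr0 mul1r lee_fin.
    apply: ge0_ler_powR; rewrite ?nnegrE//; first exact: ltW.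
    by rewrite (addrC 2 x); apply: H; lra.
have := norm_on_ge0 (window t) +oo g.
case E : (norm_on (window t) +oo g) => [K| |//]; last by move=> _; rewrite leey.
rewrite lee_fin => K0; apply/norm_on_ooP => //.
have /(norm_on_ooP _ _ K0) H : (norm_on (window t) +oo g <= K%:E)%E by rewrite E.
have H2 := ae_shift (-2) H; have dg2 := ae_shift (-2) dg.
have N := ae_neq (t + 1).
have := ae_mono2 (fun x a b => conj a b) dg2 N.
apply: ae_mono3 H H2 => x H H2 [{}dg xN].
rewrite /window/= in_itv/= => /andP[x1 x2].
have [xt|] := ltP x (t + 1).
  by apply: H; rewrite /window/= in_itv/=; apply/andP; split; lra.
rewrite le_eqVlt eq_sym (negbTE xN)/= => xt.
apply: le_trans (H2 _); last first.
  by rewrite /window/= in_itv/=; apply/andP; split; lra.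
have := dg _; rewrite (_ : -2 + x + 2 = x); last lra.
by apply; lra.
Qed.

Lemma norm_on_window_le (p : \bar R) g (t t' : R) : (1 <= p)%E ->
  measurable_fun profile_domain g ->
  {ae mu, forall s, -1 < s -> `|g (s + 2)| <= `|g s|} ->
  0 <= t -> t <= t' ->
  (norm_on (window t') p g <= norm_on (window t) p g)%E.
Proof.
move=> p1 mg dg t0 tt'.
have H n : forall t', t <= t' -> t' <= t + 2 * n%:R ->
    (norm_on (window t') p g <= norm_on (window t) p g)%E.
  elim: n => [|n IH] u tu.
    by rewrite mulr0 addr0 => ut; rewrite (@le_anti _ _ u t)// tu ut.
  rewrite -[n.+1%:R]natr1 mulrDr mulr1 => ut.
  have [un|un] := leP u (t + 2 * n%:R); first exact: IH.
  have n0 := ler0n R n.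
  apply: (@le_trans _ _ (norm_on (window (t + 2 * n%:R)) p g)).
    by apply: norm_on_window_step => //; lra.
  by apply: IH; lra.
apply: (H (Num.truncn (t' - t)).+1) => //.
have := truncnS_gt (t' - t); have := ler0n R (Num.truncn (t' - t)).+1.
lra.
Qed.

Lemma window_shift (p : \bar R) g (c t : R) : (1 <= p)%E ->
  measurable_fun (window (c + t)) g ->
  norm_on (window (c + t)) p g = norm_on (window t) p (fun s => g (c + s)).
Proof.
move=> p1 mg.
rewrite -(@norm_on_affine R false c _ _ _ p1 (measurable_window _) mg).
rewrite /window affine_preimage_oo; congr norm_on; last first.
  by apply/funext => x; rewrite /affine expr0 mul1r.
have -> : c + t - 1 - c = t - 1 by lra.
by have -> : c + t + 1 - c = t + 1 by lra.
Qed.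

(** The constant is the same for all p: the power 1/p of the measure of E is
    at least min(1, mu E) for every p >= 1. *)
Lemma norm_on_ge_mass D E (p : \bar R) g (c : R) : (1 <= p)%E ->
  measurable D -> measurable E -> E `<=` D -> measurable_fun D g -> 0 <= c ->
  (mu E \is a fin_num) ->
  {ae mu, forall x, E x -> c <= `|g x|} ->
  ((c * Num.min 1 (fine (mu E)))%:E <= norm_on D p g)%E.
Proof.
move=> + mD mE ED mg c0 fE H; case: p => [r|_|//].
  rewrite lee_fin => r1; have r0 : 0 < r by exact: lt_le_trans r1.
  rewrite (norm_on_real _ _ r0).
  have e0 : 0 <= fine (mu E) by rewrite fine_ge0.
  apply: (@le_trans _ _ (((c `^ r)%:E * mu E) `^ r^-1)%E).
    rewrite -(fineK fE) -EFinM poweR_EFin lee_fin powRM ?powR_ge0//.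
    rewrite -powRrM divff ?gt_eqF// powRr1// ler_wpM2l//.
    have [e1|e1] := leP 1 (fine (mu E)).
      apply: (@le_trans _ _ (1 `^ r^-1)); first by rewrite powR1.
      by apply: ge0_ler_powR => //; rewrite ?nnegrE// invr_ge0 ltW.
    rewrite -[leLHS]powRr1//.
    have [->|en0] := eqVneq (fine (mu E)) 0.
      by rewrite powRr1// powR_ge0.
    have e01 : 0 < fine (mu E) <= 1 by rewrite lt_neqAle eq_sym en0 e0 ltW.
    by rewrite powRr1//; apply: ger1_powR => //; rewrite invf_le1.
  apply: le_poweR; first by rewrite invr_ge0 ltW.
    by apply: mule_ge0 => //; rewrite lee_fin powR_ge0.
  apply: (@le_trans _ _ (\int[mu]_(x in E) (`|g x| `^ r)%:E)%E).
    rewrite -integral_cst//; apply: (ge0_ae_le_integral mE).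
    - exact: measurable_cst.
    - by apply: measurable_normpow; apply: measurable_funS mg.
    - by move=> x _ /=; rewrite lee_fin powR_ge0.
    - by move=> x _; rewrite lee_fin powR_ge0.
    - move: H; apply: ae_mono => x /[apply] H; rewrite lee_fin.
      by apply: ge0_ler_powR; rewrite ?nnegrE// ltW.
  by apply: ge0_subset_integral => //; exact: measurable_normpow.
have mNy := norm_on_ge0 D +oo g.
case K : (norm_on D +oo g) mNy => [k| |//]; last by move=> _; rewrite leey.
rewrite !lee_fin => k0.
have /(norm_on_ooP _ _ k0) H1 : (norm_on D +oo g <= k%:E)%E by rewrite K.
have [E0|E0] := eqVneq (mu E) 0%E.
  by rewrite E0/= (min_r _)// mulr0.
have ck : c <= k.
  apply/negP => /negP; rewrite -ltNge => kc.
  move/eqP: E0; apply.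
  have : {ae mu, forall x, ~ E x}.
    move: H H1; apply: ae_mono2 => x H H1 Ex.
    by have := lt_le_trans kc (le_trans (H Ex) (H1 (ED _ Ex))); rewrite ltxx.
  exact: ae_not_measure0.
apply: le_trans ck; rewrite -[leRHS]mulr1 ler_wpM2l//.
by rewrite ge_min lexx.
Qed.

End windows.

(** * Functions with vanishing integrals *)

Section vanishing_integrals.
Context {R : realType}.
Local Notation mu := (@lebesgue_measure R).
Implicit Types (a b c d : R) (f h w : R -> R).

Lemma ae_exists_in_itv (P : R -> Prop) a b : a < b ->
  {ae mu, forall x, P x} -> exists2 x, a < x < b & P x.
Proof.
move=> ab H; apply: contrapT => nH.
have : mu `]a, b[%classic = 0%E.
  apply: ae_not_measure0; first exact: measurable_itv.
  move: H; apply: ae_mono => x Px /=; rewrite in_itv/= => xab.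
  by apply: nH; exists x.
rewrite lebesgue_measure_itv/= lte_fin ab -EFinB => -[] /eqP.
by rewrite subr_eq0 gt_eqF.
Qed.

Lemma integrable_itvS (I J : interval R) (f : R -> \bar R) :
  [set` I] `<=` [set` J] -> mu.-integrable [set` J] f ->
  mu.-integrable [set` I] f.
Proof.
by move=> IJ; apply: integrableS => //; exact: measurable_itv.
Qed.

Lemma EFin_Rintegral_itv (I : interval R) h :
  mu.-integrable [set` I] (EFin \o h) ->
  (\int[mu]_(x in [set` I]) (h x)%:E)%E = (\int[mu]_(x in [set` I]) h x)%:E.
Proof.
move=> ih; rewrite /Rintegral fineK//.
by apply: integrable_fin_num => //; exact: measurable_itv.
Qed.

Lemma integrable_restrict_itv (I : interval R) h :
  mu.-integrable [set` I] (EFin \o h) ->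
  mu.-integrable setT (EFin \o (h \_ [set` I])).
Proof.
move=> ih; rewrite -restrict_EFin.
by apply: (integrable_mkcond _ _).1 ih; exact: measurable_itv.
Qed.

Lemma Rintegral_itvN (I : interval R) h :
  mu.-integrable [set` I] (EFin \o h) ->
  \int[mu]_(x in [set` I]) - h x = - \int[mu]_(x in [set` I]) h x.
Proof.
move=> ih; rewrite -[RHS]mulN1r -RintegralZl//.
by apply: eq_Rintegral => y _; rewrite mulN1r.
Qed.

Lemma integrable_itvD (I : interval R) f h :
  mu.-integrable [set` I] (EFin \o f) -> mu.-integrable [set` I] (EFin \o h) ->
  mu.-integrable [set` I] (EFin \o (fun x => f x + h x)).
Proof.
move=> fi hi; have := integrableD _ fi hi; apply.
exact: measurable_itv.
Qed.

Lemma integrable_itvZ (I : interval R) c h :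
  mu.-integrable [set` I] (EFin \o h) ->
  mu.-integrable [set` I] (EFin \o (fun x => c * h x)).
Proof.
move=> hi; have := integrableZl _ c hi; apply.
exact: measurable_itv.
Qed.

Lemma integrable_itv_cst (a b c : R) :
  mu.-integrable `]a, b[ (EFin \o cst c).
Proof.
apply: (@integrable_itvS _ `[a, b]); first exact: subset_itv_oo_cc.
apply: continuous_compact_integrable; first exact: segment_compact.
by apply: continuous_subspaceT => x; exact: cvg_cst.
Qed.

Lemma restrict_ooE h a b x :
  (h \_ `]a, b[) x = if a < x < b then h x else 0.
Proof. by rewrite patchE mem_setE in_itv. Qed.

Lemma Rintegral_oo_continuous a b h : a < b ->
  mu.-integrable `]a, b[ (EFin \o h) ->
  {within `[a, b], continuous (fun x => \int[mu]_(t in `]a, x[) h t)}.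
Proof.
move=> ab ih.
have ih' : mu.-integrable `[a, b] (EFin \o (h \_ `]a, b[)).
  apply: (@integrableS _ _ _ mu setT) => //.
  rewrite -restrict_EFin; apply/(integrable_mkcond _ _).1 => //.
have := parameterized_integral_continuous (ltW ab) ih'.
apply: subspace_eq_continuous => x; rewrite inE/= in_itv/= => /andP[ax xb].
rewrite /parameterized_integral.
change (\int[mu]_(t in `[a, x]) (h \_ `]a, b[) t = \int[mu]_(t in `]a, x[) h t).
rewrite -Rintegral_itv_bndo_bndc; last first.
  apply: integrableS ih' => //; apply: subset_itvl; rewrite bnd_simp//.
rewrite -Rintegral_itv_obnd_cbnd; last first.
  apply: integrableS ih' => //; move=> y /=; rewrite !in_itv/= => /andP[? yx].
  by apply/andP; split; [exact: ltW|exact: (le_trans (ltW yx))].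
apply: eq_Rintegral => y; rewrite inE/= in_itv/= => /andP[ay yx].
by rewrite patchE mem_set//= in_itv/= ay (lt_le_trans yx xb).
Qed.

(** Lebesgue's differentiation theorem applied to the primitive of h, which is
    constant near every point of ]a, b[. *)
Lemma vanishing_integral_ae0 a b h : a < b ->
  mu.-integrable `]a, b[ (EFin \o h) ->
  (forall x, a < x < b -> \int[mu]_(t in `]a, x[) h t = 0) ->
  {ae mu, forall x, a < x < b -> h x = 0}.
Proof.
move=> ab ih H.
pose h' := h \_ `]a, b[.
have ihT : mu.-integrable setT (EFin \o h').
  by rewrite -restrict_EFin; apply/(integrable_mkcond _ _).1.
have lh : locally_integrable setT h' by exact: integrable_locally.
have ih' y : mu.-integrable [set` Interval (BRight a) (BRight y)] (EFin \o h').
  exact: integrableS ihT.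
have := FTC1 ih' lh; apply: ae_mono => x H' /[dup] xab /andP[ax xb].
have -> : h x = h' x by rewrite /h' patchE mem_set//= in_itv/= ax.
rewrite -(H' ax).2.
rewrite derive1E.
transitivity ('D_1 (cst 0 : R -> R) x); last exact: derive_cst.
apply: near_eq_derive.
near=> y.
have /andP[ay yb] : a < y < b.
  by near: y; apply: (@near_in_itvoo R a b x); rewrite in_itv/=.
rewrite -Rintegral_itv_bndo_bndc; last first.
  by apply: integrableS ihT.
rewrite -(H y) ?ay//; apply: eq_Rintegral => z; rewrite inE/= in_itv/= => /andP[az zy].
by rewrite /h' patchE mem_set//= in_itv/= az (lt_trans zy yb).
Unshelve. all: by end_near. Qed.

End vanishing_integrals.

(** * Test functions approximating an indicator function *)

Section bump.
Context {R : realType}.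
Implicit Types (a b c d x y : R).

(** The square of the positive part of y, which is C^1. *)
Definition pos_sqr y : R := y * Num.max 0 y.

(** The increment differs from its linear part by at most the square of the
    step, whatever the signs of y and h + y. *)
Lemma is_derive_pos_sqr y : is_derive y 1 pos_sqr (2 * Num.max 0 y).
Proof.
suff H : (h^-1 *: (pos_sqr (h + y) - pos_sqr y)) @[h --> 0^'] -->
    2 * Num.max 0 y.
  have E : (fun h : R => h^-1 *: ((pos_sqr \o shift y) (h *: 1) - pos_sqr y)) =
      (fun h => h^-1 *: (pos_sqr (h + y) - pos_sqr y)).
    by apply/funext => h /=; rewrite [_%:A]mulr1.
  apply: DeriveDef.
    by apply/cvg_ex; exists (2 * Num.max 0 y); rewrite E.
  by rewrite /derive E; apply/cvg_lim; first exact: Rhausdorff.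
apply/cvgrPdist_le => e e0; near=> h.
have h0 : h != 0 by near: h; exact: nbhs_dnbhs_neq.
have he : `|h| <= e by near: h; apply: dnbhs0_le.
apply: le_trans he.
have hp : 0 < `|h| by rewrite normr_gt0.
rewrite -(ler_pM2l hp) -normrM mulrBr.
have -> : h * (h^-1 *: (pos_sqr (h + y) - pos_sqr y)) = pos_sqr (h + y) - pos_sqr y.
  by rewrite /GRing.scale/= mulrA divff// mul1r.
rewrite -normrM [leRHS]ger0_norm -?expr2 ?sqr_ge0// /pos_sqr.
rewrite ler_norml.
by case: (leP 0 y) => y0; case: (leP 0 (h + y)) => hy; apply/andP; split; nra.
Unshelve. all: by end_near. Qed.

Definition bump c d x : R := pos_sqr ((x - c) * (d - x)).

Definition bump_derive c d x : R :=
  2 * Num.max 0 ((x - c) * (d - x)) * (c + d - 2 * x).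

Lemma is_derive_bump c d x : is_derive x 1 (bump c d) (bump_derive c d x).
Proof.
have H := is_derive_pos_sqr ((x - c) * (d - x)).
have Hq : is_derive x 1 (fun x => (x - c) * (d - x)) (c + d - 2 * x).
  apply: is_derive_eq; rewrite /GRing.scale/=; ring.
exact: (@is_derive1_comp R pos_sqr (fun x => (x - c) * (d - x)) x _ _ H Hq).
Qed.

Lemma continuous_bump_derive c d : continuous (bump_derive c d).
Proof.
move=> x; rewrite /bump_derive.
have c1 : (fun x => (x - c) * (d - x)) y @[y --> x] --> (x - c) * (d - x).
  by apply: cvgM; apply: cvgB; first [exact: cvg_id|exact: cvg_cst].
apply: cvgM; last first.
  apply: cvgB; first exact: cvg_cst.
  by apply: cvgM; [exact: cvg_cst|exact: cvg_id].
apply: cvgM; first exact: cvg_cst.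
have E y : Num.max 0 y = 2^-1 * (y + `|y|) :> R.
  case: (leP 0 y) => H; first by rewrite ger0_norm//; lra.
  by rewrite ltr0_norm//; lra.
under eq_fun do rewrite E.
rewrite E; apply: cvgM; first exact: cvg_cst.
by apply: cvgD => //; exact: cvg_norm.
Qed.

Lemma bump_in c d x : c < x < d -> 0 < bump c d x.
Proof.
move=> /andP[cx xd]; rewrite /bump /pos_sqr.
have p : 0 < (x - c) * (d - x) by rewrite mulr_gt0// subr_gt0.
by rewrite max_r ?ltW// mulr_gt0.
Qed.

Lemma bump_out c d x : c < d -> ~~ (c < x < d) -> bump c d x = 0.
Proof.
move=> cd; rewrite negb_and -!leNgt => H; rewrite /bump /pos_sqr.
by rewrite max_l ?mulr0//; case/orP : H => H; nra.
Qed.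

Lemma bump_ge0 c d x : 0 <= bump c d x.
Proof.
rewrite /bump /pos_sqr; case: (leP 0 ((x - c) * (d - x))) => H; last by rewrite mulr0.
by rewrite mulr_ge0.
Qed.

Lemma bump_le1 c d x : c < d -> 0 <= c -> d <= 1 -> bump c d x <= 1.
Proof.
move=> cd c0 d1; rewrite /bump /pos_sqr.
case: (leP 0 ((x - c) * (d - x))) => H; last by rewrite mulr0.
have H1 : (x - c) * (d - x) <= 1.
  have [xc|xc] := leP c x; last by nra.
  have [xd|xd] := leP x d; last by nra.
  by rewrite -[leRHS]mulr1; apply: ler_pM; lra.
by rewrite -[leRHS]mulr1; apply: ler_pM.
Qed.

(** C^1 functions supported in [c, d], with values in [0, 1], that tend to 1 on
    ]c, d[ as n tends to infinity, since 0 < bump <= 1 there. *)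
Definition plateau c d n x : R := 1 - (1 - bump c d x) ^+ n.+1.

Lemma plateau_test_function c d n : 0 < c -> c < d -> d < 1 ->
  test_function (plateau c d n).
Proof.
move=> c0 cd d1.
pose D x := n.+1%:R * (1 - bump c d x) ^+ n * bump_derive c d x.
have H x : is_derive x 1 (plateau c d n) (D x).
  have Hb := is_derive_bump c d x.
  have H1 : is_derive x 1 (fun x => 1 - bump c d x) (- bump_derive c d x).
    have -> : - bump_derive c d x = 0 - bump_derive c d x by rewrite sub0r.
    exact: (@is_deriveB R R R (cst 1) (bump c d) x 1 0 _ (is_derive_cst _ _ _) Hb).
  have H2 := @is_deriveX R R (fun x => 1 - bump c d x) n.+1 x 1 _ H1.
  rewrite exprfctE in H2.
  have := @is_deriveB R R R (cst 1) (fun x => (1 - bump c d x) ^+ n.+1) x 1 0 _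
    (is_derive_cst _ _ _) H2.
  rewrite sub0r => H3; apply: (is_derive_eq H3).
  by rewrite /D /GRing.scale/= mulrN opprK.
have DE : derive1 (plateau c d n) = D.
  by apply/funext => x; rewrite derive1E; apply: derive_val.
split.
- by move=> x; have := H x => -[].
- rewrite DE => x; apply: cvgM; last exact: continuous_bump_derive.
  apply: cvgM; first exact: cvg_cst.
  have cb : {for x, continuous (fun x => 1 - bump c d x)}.
    apply: cvgB; first exact: cvg_cst.
    apply: differentiable_continuous; apply/derivable1_diffP.
    by have := is_derive_bump c d x => -[].
  exact: (continuous_comp cb (@exprn_continuous R n _)).
- exists c, d; split => // x xcd; rewrite /plateau bump_out ?subr0 ?expr1n ?subrr//.
  by apply: contra xcd => /andP[? ?]; rewrite !ltW.
Qed.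

Lemma plateau_cvg c d x : 0 <= c -> d <= 1 -> c < x < d ->
  plateau c d n x @[n --> \oo] --> (1 : R).
Proof.
move=> c0 d1 xcd; rewrite -[X in _ --> X]subr0; apply: cvgB; first exact: cvg_cst.
have cd : c < d by move/andP : (xcd) => [/lt_trans]; exact.
have b0 := bump_in xcd; have b1 := bump_le1 x cd c0 d1.
have := @cvg_expr R (1 - bump c d x).
rewrite ger0_norm ?subr_ge0// => /(_ _)H.
have {}H : (1 - bump c d x) ^+ n @[n --> \oo] --> (0 : R) by apply: H; lra.
by rewrite -(cvg_shiftS (fun n => (1 - bump c d x) ^+ n)) in H.
Qed.

Lemma plateau_bound c d n x : c < d -> 0 <= c -> d <= 1 -> `|plateau c d n x| <= 1.
Proof.
move=> cd c0 d1; have b0 := bump_ge0 c d x; have b1 := bump_le1 x cd c0 d1.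
rewrite /plateau ger0_norm; last first.
  by rewrite subr_ge0 exprn_ile1//; lra.
by rewrite gerBl exprn_ge0//; lra.
Qed.

Lemma plateau_out c d n x : c < d -> ~~ (c < x < d) -> plateau c d n x = 0.
Proof.
by move=> cd xcd; rewrite /plateau bump_out// subr0 expr1n subrr.
Qed.

End bump.

(** * Uniqueness of weak derivatives *)

Section weak_derivatives.
Context {R : realType}.
Local Notation mu := (@lebesgue_measure R).
Implicit Types (a b c d x y : R) (f h u v w phi : R -> R).

Lemma locally_integrable_itvcc (D : set R) f a b : locally_integrable D f ->
  `[a, b] `<=` D -> mu.-integrable `[a, b] (EFin \o f).
Proof.
move=> [mf oD H] abD; apply/integrableP; split.
  apply/measurable_EFinP; apply: measurable_funS mf => //.
  exact: open_measurable.
exact: H (@segment_compact R a b).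
Qed.

Lemma within_continuous_bounded_itv f a b : {within `[a, b], continuous f} ->
  exists2 M : R, 0 <= M & forall x, a <= x <= b -> `|f x| <= M.
Proof.
move=> cf.
have /compact_bounded[M [_ HM]] : compact (f @` `[a, b]).
  by apply: continuous_compact => //; exact: segment_compact.
exists (Num.max 0 (M + 1)); first by rewrite le_max lexx.
move=> x xab; apply: (@le_trans _ _ (M + 1)); last by rewrite le_max lexx orbT.
by apply: (HM (M + 1)); [rewrite ltrDl|exists x => //=; rewrite in_itv].
Qed.

Lemma continuous_bounded_itv f a b : continuous f ->
  exists2 M : R, 0 <= M & forall x, a <= x <= b -> `|f x| <= M.
Proof.
by move=> cf; apply: within_continuous_bounded_itv; exact: continuous_subspaceT.
Qed.

(** Dominated convergence as the test functions tend to the indicator function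
    of ]c, d[. *)
Lemma ae0_of_plateau w c d : 0 < c -> c < d -> d < 1 ->
  mu.-integrable `[c, d] (EFin \o w) ->
  (forall n, \int[mu]_(x in `]0, 1[) (w x * plateau c d n x) = 0) ->
  \int[mu]_(x in `]c, d[) w x = 0.
Proof.
move=> c0 cd d1 iw H.
have iwo : mu.-integrable `]c, d[ (EFin \o w).
  by apply: integrableS iw => //; exact: subset_itv_oo_cc.
have H1 n : (\int[mu]_(x in `]c, d[) (w x * plateau c d n x)%:E = 0)%E.
  have mp : measurable_fun `]c, d[ (plateau c d n).
    apply: measurable_funTS; apply: continuous_measurable_fun => x.
    apply: differentiable_continuous; apply/derivable1_diffP.
    by have [+ _ _] := plateau_test_function n c0 cd d1; exact.
  have ip : mu.-integrable `]c, d[ (EFin \o (fun x => w x * plateau c d n x)).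
    apply: (@le_integrable _ _ _ mu _ _ _ (EFin \o w)) => //.
      apply/measurable_EFinP; apply: measurable_funM => //.
      by move/integrableP : iwo => [/measurable_EFinP].
    move=> x _; rewrite /= lee_fin normrM ler_piMr//.
    by apply: plateau_bound => //; exact: ltW.
  rewrite -[LHS]fineK; last exact: integrable_fin_num.
  congr EFin; rewrite -[RHS](H n) [RHS]Rintegral_mkcond -[LHS]/(Rintegral _ _ _).
  rewrite Rintegral_mkcond; apply: eq_Rintegral => x _; rewrite !patchE.
  have [xcd|xcd] := boolP (c < x < d).
    rewrite mem_set/= ?in_itv//= mem_set//= in_itv/=.
    by case/andP: xcd => ? ?; apply/andP; split; lra.
  by rewrite plateau_out// mulr0 !if_same.
have := @dominated_convergence _ _ _ mu `]c, d[ (measurable_itv _)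
  (fun n x => (w x * plateau c d n x)%:E) (EFin \o w) (fun x => `|w x|%:E).
case.
- move=> n; apply/measurable_EFinP; apply: measurable_funM.
    by move/integrableP : iwo => [/measurable_EFinP].
  apply: measurable_funTS; apply: continuous_measurable_fun => x.
  apply: differentiable_continuous; apply/derivable1_diffP.
  by have [+ _ _] := plateau_test_function n c0 cd d1; exact.
- by move/integrableP : iwo => [].
- apply: aeW => x /=; rewrite in_itv/= => xcd.
  apply: cvg_EFin; first by apply: nearW.
  rewrite /= -[X in _ --> X]mulr1; apply: cvgM; first exact: cvg_cst.
  by apply: plateau_cvg => //; exact: ltW.
- exact: (integrable_norm iwo).
- apply: aeW => x n _ /=; rewrite lee_fin normrM ler_piMr//.
  by apply: plateau_bound => //; exact: ltW.
move=> _ _; rewrite (_ : [sequence _]_n = cst 0%E); last first.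
  by apply/funext => n; exact: H1.
move=> /(cvg_lim (@ereal_hausdorff R)); rewrite lim_cst// => E.
by rewrite /Rintegral -E.
Qed.

Lemma integrable_mul_test c d w n : 0 < c -> c < d -> d < 1 ->
  locally_integrable `]0, 1[ w ->
  mu.-integrable `]0, 1[ (EFin \o (fun x => w x * plateau c d n x)).
Proof.
move=> c0 cd d1 lw.
have iw : mu.-integrable `[c, d] (EFin \o w).
  apply: (locally_integrable_itvcc lw); apply: subset_itv; rewrite bnd_simp//.
have mp : measurable_fun setT (plateau c d n).
  apply: continuous_measurable_fun => x.
  apply: differentiable_continuous; apply/derivable1_diffP.
  by have [+ _ _] := plateau_test_function n c0 cd d1; exact.
have mw : measurable_fun (`]0, 1[ : set R) w by case: lw.
apply: (@le_integrable _ _ _ mu _ _ _ (EFin \o (w \_ `[c, d]))) => //.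
- apply/measurable_EFinP; apply: measurable_funM => //.
  exact: measurable_funTS.
- move=> x _; rewrite /= lee_fin patchE.
  have [xcd|xcd] := boolP (c < x < d).
    rewrite mem_set/=; last by rewrite in_itv/=; case/andP : xcd => ? ?; rewrite !ltW.
    by rewrite normrM ler_piMr// plateau_bound// ltW.
  by rewrite plateau_out// mulr0 normr0.
- apply: (@integrableS _ _ _ mu setT) => //.
  by rewrite -restrict_EFin; apply/(integrable_mkcond _ _).1.
Qed.

(** The difference of the two derivatives has a zero integral against the test
    functions that approximate the indicator of any ]c, d[, hence it has a zero
    integral on every such interval and vanishes almost everywhere. *)
Lemma weak_derivative_unique u w1 w2 :
  is_weak_derivative u w1 -> is_weak_derivative u w2 ->
  {ae mu, forall x, 0 < x < 1 -> w1 x = w2 x}.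
Proof.
move=> [_ l1 H1] [_ l2 H2].
pose w x := w1 x - w2 x.
have lw : locally_integrable `]0, 1[ w by exact: locally_integrableB.
have H c d : 0 < c -> c < d -> d < 1 -> \int[mu]_(x in `]c, d[) w x = 0.
  move=> c0 cd d1; apply: ae0_of_plateau => //.
    by apply: (locally_integrable_itvcc lw); apply: subset_itv; rewrite bnd_simp.
  move=> n; under eq_Rintegral do rewrite mulrBl.
  rewrite RintegralB//; try exact: integrable_mul_test.
  have T := plateau_test_function n c0 cd d1.
  by apply/eqP; rewrite subr_eq0 -eqr_opp -(H1 _ T) -(H2 _ T).
(* The intervals ]e n, 1 - e n[ exhaust ]0, 1[, and the difference is
   integrable on each of them; e 0 = 1/3 makes them all nonempty. *)
pose e n : R := n.+3%:R^-1.
have e0 n : 0 < e n by rewrite invr_gt0 ltr0n.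
have e3 n : e n <= 3^-1 by rewrite lef_pV2 ?posrE ?ltr0n// ler_nat.
have : {ae mu, forall x, forall n, e n < x < 1 - e n -> w x = 0}.
  apply: ae_foralln => n; have := e0 n; have := e3 n => h1 h2.
  apply: vanishing_integral_ae0; first lra.
    apply: (@integrableS _ _ _ mu `[e n, 1 - e n]) => //.
      exact: subset_itv_oo_cc.
    by apply: (locally_integrable_itvcc lw); apply: subset_itv; rewrite bnd_simp//; lra.
  by move=> x /andP[? ?]; apply: H => //; lra.
apply: ae_mono => x Hx /andP[x0 x1]; apply/eqP; rewrite -subr_eq0; apply/eqP.
pose n := Num.truncn (Num.max x^-1 (1 - x)^-1).
have mx : Num.max x^-1 (1 - x)^-1 < n.+3%:R.
  by apply: (lt_le_trans (truncnS_gt _)); rewrite ler_nat -/n; lia.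
apply: (Hx n); rewrite /e.
move: mx; rewrite gt_max => /andP[h1 h2]; apply/andP; split.
  by rewrite invf_plt ?posrE//.
rewrite ltrBrDl -ltrBrDr.
by rewrite invf_plt ?posrE// subr_gt0.
Qed.

End weak_derivatives.

(** * Weak derivatives of primitives *)

Section weak_derivative_of_primitive.
Context {R : realType}.
Local Notation mu := (@lebesgue_measure R).
Implicit Types (a b c d x y : R) (f h u v w phi : R -> R).

Lemma integrable_mul_continuous h phi :
  mu.-integrable `]0, 1[ (EFin \o h) -> continuous phi ->
  mu.-integrable `]0, 1[ (EFin \o (fun x => h x * phi x)).
Proof.
move=> ih cphi; have [M M0 HM] := @continuous_bounded_itv R phi 0 1 cphi.
have mI : measurable (`]0, 1[%classic : set (measurableTypeR R)).
  exact: measurable_itv.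
apply: (@le_integrable _ _ _ mu _ mI _ (fun x => M%:E * (h x)%:E)%E).
- apply/measurable_EFinP; apply: measurable_funM.
    by move/integrableP : ih => [/measurable_EFinP].
  by apply: measurable_funTS; exact: continuous_measurable_fun.
- move=> x /=; rewrite in_itv/= => /andP[x0 x1]; rewrite lee_fin !normrM mulrC.
  by rewrite ler_wpM2r// (ger0_norm M0) HM// !ltW.
- exact: integrableZl.
Qed.

Lemma integral_test_derivative phi y : test_function phi -> 0 < y < 1 ->
  (\int[mu]_(x in `]y, 1%R[) (derive1 phi x)%:E = (- phi y)%:E)%E.
Proof.
move=> [dphi cphi [a [b [a0 b1 out]]]] /andP[y0 y1].
have phi1 : phi 1 = 0 by apply: out; rewrite negb_and -!ltNge b1 orbT.
have cp : continuous phi.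
  move=> x; apply: differentiable_continuous; exact/derivable1_diffP.
have cd : {within `[y, 1], continuous (derive1 phi)}.
  exact: continuous_subspaceT.
rewrite -(@integral_itv_bndoo _ y 1 _ true false); last first.
  by apply/measurable_EFinP; apply: measurable_funTS; exact: continuous_measurable_fun.
rewrite (@continuous_FTC2 _ (derive1 phi) phi)//.
  by rewrite phi1 -EFinB sub0r.
split => //.
- by apply: cvg_at_right_filter; exact: cp.
- by apply: cvg_at_left_filter; exact: cp.
Qed.

Lemma integral_test_derivative01 phi : test_function phi ->
  \int[mu]_(x in `]0, 1[) derive1 phi x = 0.
Proof.
move=> [dphi cphi [a [b [a0 b1 out]]]].
have phi1 : phi 1 = 0 by apply: out; rewrite negb_and -!ltNge b1 orbT.
have phi0 : phi 0 = 0 by apply: out; rewrite negb_and -!ltNge a0.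
have cp : continuous phi.
  move=> x; apply: differentiable_continuous; exact/derivable1_diffP.
have cd : {within `[(0 : R), 1], continuous (derive1 phi)}.
  exact: continuous_subspaceT.
rewrite /Rintegral -(@integral_itv_bndoo _ 0 1 _ true false); last first.
  by apply/measurable_EFinP; apply: measurable_funTS; exact: continuous_measurable_fun.
rewrite (@continuous_FTC2 _ (derive1 phi) phi)//.
  by rewrite phi1 phi0 -EFinB subrr.
split => //.
- by apply: cvg_at_right_filter; exact: cp.
- by apply: cvg_at_left_filter; exact: cp.
Qed.

(** Fubini's theorem for h(y) phi'(x) on the triangle 0 < y < x < 1: the inner
    integral in x gives phi(1) - phi(y) = - phi(y). *)
Lemma primitive_test_fubini h phi :
  mu.-integrable `]0, 1[ (EFin \o h) -> test_function phi ->
  \int[mu]_(x in `]0, 1[) ((\int[mu]_(t in `]0, x[) h t) * derive1 phi x) =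
  - \int[mu]_(y in `]0, 1[) (h y * phi y).
Proof.
move=> ih tphi; have [dphi cphi _] := tphi.
have mI : measurable (`]0, 1[%classic : set R) by exact: measurable_itv.
pose H := h \_ `]0, 1[; pose D := derive1 phi \_ `]0, 1[.
have iH : mu.-integrable setT (EFin \o H).
  by rewrite -restrict_EFin; apply/(integrable_mkcond _ _).1.
have mH : measurable_fun setT H by move/integrableP : iH => [/measurable_EFinP].
have mD : measurable_fun setT D.
  apply/(measurable_restrictT (derive1 phi) mI); apply: measurable_funTS.
  exact: continuous_measurable_fun.
have [M M0 HM] := @continuous_bounded_itv R (derive1 phi) 0 1 cphi.
have DM x : `|D x| <= M * \1_(`]0, 1[%classic) x.
  rewrite /D patchE indicE; case: ifPn => [/set_mem/= |_].
    by rewrite in_itv/= mulr1 => /andP[? ?]; apply: HM; rewrite !ltW.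
  by rewrite normr0 mulr0.
(* The integrand extended by zero to the plane, so that Fubini's theorem is
   applied on the whole plane; H and D vanish outside ]0, 1[. *)
pose k (z : measurableTypeR R * measurableTypeR R) : R :=
  if z.2 < z.1 then H z.2 * D z.1 else 0.
have mk : measurable_fun setT k.
  apply: measurable_fun_ifT => //.
    by apply: measurable_fun_ltr; [exact: measurable_snd|exact: measurable_fst].
  apply: measurable_funM; apply: measurableT_comp => //.
have ik : (mu \x mu)%E.-integrable setT (EFin \o k).
  apply/integrable12ltyP; first exact/measurable_EFinP.
  have mak : measurable_fun setT (fun z => `|(EFin \o k) z|)%E.
    by apply: measurableT_comp => //; exact/measurable_EFinP.
  have [C C0 HC] : exists2 C : R, 0 <= C & (\int[mu]_y `|H y|%:E)%E = C%:E.
    move/integrableP : iH => [_ Hoo].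
    exists (fine (\int[mu]_y `|H y|%:E)%E).
      by apply: fine_ge0; apply: integral_ge0.
    by rewrite fineK// ge0_fin_numE//; exact: integral_ge0.
  apply: (@le_lt_trans _ _
      (\int[mu]_x ((M * C)%:E * (\1_(`]0%R, 1%R[%classic) x)%:E))%E); last first.
    rewrite ge0_integralZl//; last 2 first.
    - by apply/measurable_EFinP; exact: measurable_indic.
    - by rewrite lee_fin mulr_ge0.
    rewrite integral_indic// setIT.
    have mu01 : mu (`]0, 1[%classic : set R) = 1%:E.
      by rewrite lebesgue_measure_itv/= lte_fin ltr01 -EFinB subr0.
    by rewrite [X in (_ * X)%E]mu01 -EFinM ltry.
  apply: ge0_le_integral => //.
  - by move=> x _; apply: integral_ge0.
  - exact: (@measurable_fun_fubini_tonelli_F _ _ _ _ R (@lebesgue_measure R) _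
      mak (fun z => abse_ge0 _)).
  - apply/measurable_EFinP; apply: measurable_funM; first exact: measurable_cst.
    exact: measurable_indic.
  move=> x _; apply: (@le_trans _ _
      (\int[mu]_y ((M * \1_(`]0%R, 1%R[%classic) x)%:E * `|H y|%:E))%E); last first.
    rewrite ge0_integralZl_EFin//; last 2 first.
    - by apply/measurable_EFinP; exact: measurableT_comp.
    - by rewrite mulr_ge0// indicE.
    by rewrite HC -!EFinM mulrAC.
  apply: ge0_le_integral => //.
  - apply: (@measurableT_comp _ _ _ _ _ _ (fun z => `|(EFin \o k) z|)%E) => //.
  - apply: measurable_funeM; apply/measurable_EFinP; exact: measurableT_comp.
  move=> y _; rewrite /k/= -EFinM lee_fin; case: ifPn => _.
    by rewrite normrM mulrC ler_wpM2r.
  by rewrite normr0 !mulr_ge0// indicE.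
have fub := Fubini ik.
have DI x : 0 < x < 1 -> D x = derive1 phi x.
  by move=> x01; rewrite /D restrict_ooE x01.
have HI x : 0 < x < 1 -> H x = h x.
  by move=> x01; rewrite /H restrict_ooE x01.
have DO x : ~~ (0 < x < 1) -> D x = 0.
  by move=> x01; rewrite /D restrict_ooE (negbTE x01).
have HO x : ~~ (0 < x < 1) -> H x = 0.
  by move=> x01; rewrite /H restrict_ooE (negbTE x01).
pose F x := \int[mu]_(t in `]0, x[) h t.
have L x : (\int[mu]_y (EFin \o k) (x, y) =
    (((fun x => F x * derive1 phi x) \_ `]0%R, 1%R[) x)%:E)%E.
  rewrite restrict_ooE; case: ifPn => [x01|xI]; last first.
    under eq_integral => y _.
      rewrite /k/= (DO _ xI) mulr0 if_same; over.
    exact: integral0.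
  have /andP[x0 x1] := x01.
  have mx : measurable (`]0, x[%classic : set R) by exact: measurable_itv.
  have ihx : mu.-integrable `]0, x[ (EFin \o h).
    by apply: (integrable_itvS _ ih); apply: subset_itvl; rewrite bnd_simp ltW.
  transitivity (\int[mu]_y (((h \_ `]0%R, x[) y)%:E * (derive1 phi x)%:E))%E.
    apply: eq_integral => y _; rewrite -EFinM /k/= (DI _ x01).
    congr EFin; rewrite restrict_ooE; have [yx|xy] := ltP y x; last first.
      by rewrite andbF mul0r.
    rewrite andbT; case: ifPn => z0.
      have y01 : 0 < y < 1 by rewrite z0 (lt_trans yx x1).
      by rewrite (HI _ y01).
    have y01 : ~~ (0 < y < 1) by rewrite negb_and z0.
    by rewrite (HO _ y01).
  rewrite (integralZr measurableT (integrable_restrict_itv ihx)).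
  by rewrite -restrict_EFin -integral_mkcond (EFin_Rintegral_itv ihx) EFinM.
have RR y : (\int[mu]_x (EFin \o k) (x, y) =
    (((fun y => - (h y * phi y)) \_ `]0%R, 1%R[) y)%:E)%E.
  rewrite restrict_ooE; case: ifPn => [y01|yI]; last first.
    under eq_integral => x _.
      rewrite /k/= (HO _ yI) mul0r if_same; over.
    exact: integral0.
  have /andP[y0 y1] := y01.
  have my : measurable (`]y, 1[%classic : set R) by exact: measurable_itv.
  have iD : mu.-integrable `]y, 1[ (EFin \o derive1 phi).
    apply: (@integrable_itvS _ _ `[y, 1]); first exact: subset_itv_oo_cc.
    apply: continuous_compact_integrable; first exact: segment_compact.
    exact: continuous_subspaceT.
  transitivity (\int[mu]_x ((h y)%:E * ((derive1 phi \_ `]y, 1%R[) x)%:E))%E.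
    apply: eq_integral => x _; rewrite -EFinM /k/= (HI _ y01).
    congr EFin; rewrite restrict_ooE; have [yx|xy] := ltP y x; last first.
      by rewrite mulr0.
    rewrite andTb; case: ifPn => z1.
      have x01 : 0 < x < 1 by rewrite z1 (lt_trans y0 yx).
      by rewrite (DI _ x01).
    have x01 : ~~ (0 < x < 1) by rewrite negb_and z1 orbT.
    by rewrite (DO _ x01).
  rewrite (integralZl measurableT (integrable_restrict_itv iD)).
  rewrite -restrict_EFin -integral_mkcond.
  rewrite (integral_test_derivative tphi y01).
  by rewrite -EFinM mulrN.
transitivity (\int[mu]_(y in `]0, 1[) (- (h y * phi y))).
  rewrite Rintegral_mkcond [RHS]Rintegral_mkcond /Rintegral; congr fine.
  under eq_integral do rewrite -L.
  under [RHS]eq_integral do rewrite -RR.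
  exact: fub.
have cp : continuous phi.
  by move=> x; apply: differentiable_continuous; exact/derivable1_diffP.
exact: Rintegral_itvN (integrable_mul_continuous ih cp).
Qed.

(** The additive constant contributes nothing because a test function has a
    derivative of integral zero. *)
Lemma primitive_weak_derivative (C : R) h u :
  mu.-integrable `]0, 1[ (EFin \o h) ->
  (forall x, 0 < x < 1 -> u x = C + \int[mu]_(t in `]0, x[) h t) ->
  is_weak_derivative u h.
Proof.
move=> ih Hu.
have oI : open (`]0, 1[%classic : set R) by exact: interval_open.
have mI : measurable (`]0, 1[%classic : set R) by exact: measurable_itv.
pose F x := \int[mu]_(t in `]0, x[) h t.
have cF := Rintegral_oo_continuous ltr01 ih.
have iF : mu.-integrable `[0, 1] (EFin \o F).
  apply: continuous_compact_integrable => //; exact: segment_compact.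
have iu : mu.-integrable `]0, 1[ (EFin \o u).
  apply: (@eq_integrable _ _ _ mu _ mI (EFin \o (fun x => C + F x))).
    by move=> x; rewrite inE/= in_itv/= => x01; rewrite (Hu x x01).
  apply: integrable_itvD; first exact: integrable_itv_cst.
  by apply: (integrable_itvS _ iF); exact: subset_itv_oo_cc.
have iFo : mu.-integrable `]0, 1[ (EFin \o F).
  by apply: (integrable_itvS _ iF); exact: subset_itv_oo_cc.
split.
- exact: open_integrable_locally.
- exact: open_integrable_locally.
move=> phi tphi; rewrite -primitive_test_fubini//.
have [dphi cphi _] := tphi.
have iD : mu.-integrable `]0, 1[ (EFin \o derive1 phi).
  apply: (@integrable_itvS _ _ `[0, 1]); first exact: subset_itv_oo_cc.
  apply: continuous_compact_integrable; first exact: segment_compact.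
  exact: continuous_subspaceT.
have E : \int[mu]_(x in `]0, 1[) (C * derive1 phi x) = 0.
  by rewrite RintegralZl// (integral_test_derivative01 tphi) mulr0.
rewrite -[RHS]add0r -[X in X + _]E -RintegralD//; last 2 first.
- exact: integrable_itvZ.
- exact: integrable_mul_continuous.
apply: eq_Rintegral => x; rewrite inE/= in_itv/= => x01.
by rewrite (Hu x x01) mulrDl.
Qed.

End weak_derivative_of_primitive.

(** * Integrals under translation and reflection *)

Section affine_integrals.
Context {R : realType}.
Local Notation mu := (@lebesgue_measure R).
Implicit Types (a b c d x y t : R) (f g h : R -> R).

Lemma integrable_affine_oo e c a b h :
  mu.-integrable `]a, b[ (EFin \o h) ->
  mu.-integrable (affine e c @^-1` `]a, b[) (EFin \o (fun x => h (affine e c x))).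
Proof.
move=> /integrableP[/measurable_EFinP mh hoo]; apply/integrableP; split.
  by apply/measurable_EFinP; apply: measurable_fun_affine.
rewrite (@ge0_integral_affine R e c _ (fun x => `|(h x)%:E|%E))//.
by apply: measurableT_comp => //; exact/measurable_EFinP.
Qed.

Lemma Rintegral_affine_oo e c a b h :
  mu.-integrable `]a, b[ (EFin \o h) ->
  \int[mu]_(x in affine e c @^-1` `]a, b[) h (affine e c x) =
  \int[mu]_(x in `]a, b[) h x.
Proof.
move=> /integrableP[mh hoo]; rewrite /Rintegral; congr fine.
rewrite integralE [RHS]integralE; congr (_ - _)%E.
  rewrite -(@ge0_integral_affine R e c _ (EFin \o h)^\+%E)//; last first.
    exact: measurable_funepos.
  by apply: eq_integral => x _; rewrite !funeposE.
rewrite -(@ge0_integral_affine R e c _ (EFin \o h)^\-%E)//; last first.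
  exact: measurable_funeneg.
by apply: eq_integral => x _; rewrite !funenegE.
Qed.

Lemma affineF c x : affine false c x = c + x.
Proof. by rewrite /affine expr0 mul1r. Qed.

Lemma affineT c x : affine true c x = c - x.
Proof. by rewrite /affine expr1 mulN1r. Qed.

Lemma integrable_shift c a b h : mu.-integrable `]c + a, c + b[ (EFin \o h) ->
  mu.-integrable `]a, b[ (EFin \o (fun x => h (c + x))).
Proof.
move=> /(@integrable_affine_oo false c); rewrite affine_preimage_oo.
rewrite !(addrC c) !addrK; have -> : (fun x => h (affine false c x)) = (fun x => h (c + x)).
  by apply/funext => x; rewrite affineF.
by [].
Qed.

Lemma integrable_flip c a b h : mu.-integrable `]c - b, c - a[ (EFin \o h) ->
  mu.-integrable `]a, b[ (EFin \o (fun x => h (c - x))).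
Proof.
move=> /(@integrable_affine_oo true c); rewrite affine_preimage_oo.
rewrite !subKr; have -> : (fun x => h (affine true c x)) = (fun x => h (c - x)).
  by apply/funext => x; rewrite affineT.
by [].
Qed.

Lemma Rintegral_shift c a b h : mu.-integrable `]c + a, c + b[ (EFin \o h) ->
  \int[mu]_(x in `]a, b[) h (c + x) = \int[mu]_(x in `]c + a, c + b[) h x.
Proof.
move=> /(@Rintegral_affine_oo false c) <-; rewrite affine_preimage_oo.
rewrite !(addrC c) !addrK.
by apply: eq_Rintegral => x _; rewrite affineF.
Qed.

Lemma Rintegral_flip c a b h : mu.-integrable `]c - b, c - a[ (EFin \o h) ->
  \int[mu]_(x in `]a, b[) h (c - x) = \int[mu]_(x in `]c - b, c - a[) h x.
Proof.
move=> /(@Rintegral_affine_oo true c) <-; rewrite affine_preimage_oo.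
rewrite !subKr.
by apply: eq_Rintegral => x _; rewrite affineT.
Qed.

Lemma integrable_subset_oo a b c d h : a <= c -> d <= b ->
  mu.-integrable `]a, b[ (EFin \o h) -> mu.-integrable `]c, d[ (EFin \o h).
Proof.
by move=> ac db; apply: integrable_itvS; apply: subset_itv; rewrite bnd_simp.
Qed.

Lemma Rintegral_oo_split a b c h : a <= b -> b <= c ->
  mu.-integrable `]a, c[ (EFin \o h) ->
  \int[mu]_(x in `]a, c[) h x =
  \int[mu]_(x in `]a, b[) h x + \int[mu]_(x in `]b, c[) h x.
Proof.
move=> ab bc ih.
have iab : mu.-integrable `]a, b[ (EFin \o h) by exact: integrable_subset_oo ih.
have ibc : mu.-integrable `]b, c[ (EFin \o h) by exact: integrable_subset_oo ih.
have mh : measurable_fun `]a, c[ (EFin \o h) by move/integrableP : ih => [].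
apply: EFin_inj; rewrite EFinD -!EFin_Rintegral_itv//.
have [->|altb] := eqVneq a b.
  rewrite [X in (X + _)%E](_ : _ = 0%E) ?add0e//.
  by rewrite (_ : `]b, b[%classic = set0 :> set R) ?integral_set0// set_itv_ge// bnd_simp ltxx.
have {}altb : a < b by rewrite lt_neqAle altb.
have [->|bltc] := eqVneq b c.
  rewrite [X in (_ + X)%E](_ : _ = 0%E) ?adde0//.
  by rewrite (_ : `]c, c[%classic = set0 :> set R) ?integral_set0// set_itv_ge// bnd_simp ltxx.
have {}bltc : b < c by rewrite lt_neqAle bltc.
have mb : measurable_fun `]b, c[ (EFin \o h) by move/integrableP : ibc => [].
rewrite -[in RHS](@integral_itv_bndoo _ b c _ true true) => //.
rewrite (@itv_bndbnd_setU _ _ (BRight a) (BLeft b) (BLeft c)); last 2 first.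
- by rewrite bnd_simp.
- by rewrite bnd_simp ltW.
rewrite integral_setU//=.
- by rewrite -itv_bndbnd_setU// ?bnd_simp// ltW.
- apply/disj_setPRL => x /=; rewrite !in_itv/= => /andP[bx _].
  by move=> /andP[_]; rewrite ltNge bx.
Qed.

Lemma Rintegral_oo_nil a h : \int[mu]_(x in `]a, a[) h x = 0.
Proof.
rewrite (_ : `]a, a[%classic = set0 :> set R) ?Rintegral_set0//.
by rewrite set_itv_ge// bnd_simp ltxx.
Qed.

Lemma oriented_int_split a b c d h : a <= 0 -> a <= c -> c <= d -> d <= b -> 0 <= b ->
  mu.-integrable `]a, b[ (EFin \o h) ->
  oriented_int 0 d h = oriented_int 0 c h + \int[mu]_(x in `]c, d[) h x.
Proof.
move=> a0 ac cd db b0 ih; rewrite /oriented_int.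
have S (u v w : R) : a <= u -> u <= v -> v <= w -> w <= b ->
    \int[mu]_(x in `]u, w[) h x =
    \int[mu]_(x in `]u, v[) h x + \int[mu]_(x in `]v, w[) h x.
  by move=> *; apply: Rintegral_oo_split => //; exact: integrable_subset_oo ih.
have [c0|c0] := leP 0 c; have [d0|d0] := leP 0 d.
- by apply: S.
- by have := le_lt_trans (le_trans c0 cd) d0; rewrite ltxx.
- by have c0' := ltW c0; rewrite (S c 0 d)//; ring.
- by have d0' := ltW d0; rewrite (S c d 0)//; ring.
Qed.

(** The primitive of h is continuous, so it vanishes everywhere as soon as it
    vanishes almost everywhere. *)
Lemma vanishing_integral_ae a b h : a < b ->
  mu.-integrable `]a, b[ (EFin \o h) ->
  {ae mu, forall x, a < x < b -> \int[mu]_(t in `]a, x[) h t = 0} ->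
  {ae mu, forall x, a < x < b -> h x = 0}.
Proof.
move=> ab ih H; apply: vanishing_integral_ae0 => // x /andP[ax xb].
pose F y := \int[mu]_(t in `]a, y[) h t.
have cF := Rintegral_oo_continuous ab ih.
have {}cF : F y @[y --> x] --> F x.
  have /(continuous_within_itvP _ ab) [+ _ _] := cF; apply.
  by rewrite in_itv/= ax.
apply/eqP; rewrite -[_ == 0]negbK; apply/negP => Fx.
have Fx0 : 0 < `|F x| by rewrite normr_gt0.
have /cvgrPdist_lt /(_ _ Fx0) [e /= e0 He] := cF.
have ex : x < Num.min b (x + e) by rewrite lt_min xb ltrDl.
have [y /andP[xy]] := ae_exists_in_itv ex H.
rewrite lt_min => /andP[yb ye] /(_ _); rewrite (lt_trans ax xy) yb => /(_ isT) Fy0.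
have Fy : F y = 0 by exact: Fy0.
have hb : ball_ Num.norm x e y by rewrite /= ltr0_norm ?subr_lt0//; lra.
by have := He y hb; rewrite Fy subr0 ltxx.
Qed.

End affine_integrals.

(** * From solutions to profiles *)

Section profiles.
Context {R : realType}.
Local Notation mu := (@lebesgue_measure R).
Implicit Types (a b c d x y t : R) (f g h : R -> R).
Implicit Types (p : \bar R) (Sigma : set (R * R)) (z : R -> R -> R).

(** The two boundary conditions once f is eliminated: the condition at x = 0
    makes f the opposite of g on positive times, and the condition at x = 1 then
    relates g at times s and s + 2 through the rotated set. A solution thus
    amounts to an orbit s, s + 2, s + 4, ... of values of g for almost every s in
    ]-1, 1[. *)
Definition profile Sigma g :=
  measurable_fun profile_domain g /\
  {ae mu, forall s, -1 < s -> (rotation @` Sigma) (g s, g (s + 2))}.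

Lemma sqrt2_gt0 : 0 < Num.sqrt 2 :> R.
Proof. by rewrite sqrtr_gt0. Qed.

Lemma sqrt2_sqr : Num.sqrt 2 * Num.sqrt 2 = 2 :> R.
Proof. by rewrite -expr2 sqr_sqrtr. Qed.

Lemma sqrt2_neq0 : Num.sqrt 2 != 0 :> R.
Proof. by rewrite gt_eqF// sqrt2_gt0. Qed.

(** The rotated boundary data at time t + 1, when f(t + 2) = - v and g(t) = u. *)
Lemma rotation_boundary (u v : R) :
  rotation ((- v + u) / Num.sqrt 2, - ((- v - u) / Num.sqrt 2)) = (u, v).
Proof.
have k : (Num.sqrt 2)^-1 * (Num.sqrt 2)^-1 = 2^-1 :> R.
  by rewrite -invfM sqrt2_sqr.
rewrite /rotation/=; congr pair.
  transitivity (2 * u * ((Num.sqrt 2)^-1 * (Num.sqrt 2)^-1)); first by ring.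
  by rewrite k; field.
transitivity (2 * v * ((Num.sqrt 2)^-1 * (Num.sqrt 2)^-1)); first by ring.
by rewrite k; field.
Qed.

(** On a bounded interval, |f| <= 1 + |f|^r. *)
Lemma Lp_on_integrable a b p f : (1 <= p)%E -> Lp_on `]a, b[ p f ->
  mu.-integrable `]a, b[ (EFin \o f).
Proof.
move=> p1 [mf nf]; have mI : measurable (`]a, b[%classic : set R).
  exact: measurable_itv.
have muI : (mu `]a, b[%classic < +oo)%E.
  by rewrite lebesgue_measure_itv/=; case: ifP => _; rewrite -?EFinB ltry.
apply/integrableP; split; first exact/measurable_EFinP.
case: p p1 nf => [r|_ nf|//].
  rewrite lee_fin => r1; have r0 : 0 < r by exact: lt_le_trans r1.
  rewrite (norm_on_real _ _ r0) => nf.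
  have nf' : (\int[mu]_(x in `]a, b[) (`|f x| `^ r)%:E < +oo)%E.
    apply: lty_poweRy nf; by rewrite invr_neq0// gt_eqF.
  apply: (@le_lt_trans _ _ (\int[mu]_(x in `]a, b[) ((cst 1 x)%:E + (`|f x| `^ r)%:E))%E).
    apply: ge0_le_integral => //.
    - by apply: measurableT_comp => //; exact/measurable_EFinP.
    - apply: emeasurable_funD; last exact: measurable_normpow.
      by apply/measurable_EFinP; exact: measurable_cst.
    - move=> x _; rewrite -EFinD lee_fin /=.
      have [f1|f1] := leP 1 `|f x|.
        by apply: (le_trans (le1r_powR f1 r1)); rewrite lerDr.
      by apply: (le_trans (ltW f1)); rewrite lerDl powR_ge0.
  rewrite ge0_integralD//; last first.
  - exact: measurable_normpow.
  - by apply/measurable_EFinP; exact: measurable_cst.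
  by rewrite [X in (X + _)%E](integral_cst mu mI 1%:E) mul1e lte_add_pinfty.
have := norm_on_ge0 (`]a, b[%classic) +oo f.
case E : (norm_on `]a, b[%classic +oo f) nf => [K| |//] // _; rewrite lee_fin => K0.
have /(norm_on_ooP _ _ K0) H : (norm_on `]a, b[%classic +oo f <= K%:E)%E by rewrite E.
apply: (@le_lt_trans _ _ (\int[mu]_(x in `]a, b[) cst K%:E x)%E).
  apply: ge0_ae_le_integral => //.
  - by apply: measurableT_comp => //; exact/measurable_EFinP.
rewrite integral_cst//.
by rewrite lte_mul_pinfty.
Qed.

Lemma integrable_empty_itv a b f : b <= a -> mu.-integrable `]a, b[ (EFin \o f).
Proof.
move=> ba; rewrite set_itv_ge ?bnd_simp -?leNgt//; exact: integrable_set0.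
Qed.

Section solution.
Variables (Sigma : set (R * R)) (p : \bar R) (z0 z1 : R -> R) (z : R -> R -> R).
Variables (f g : R -> R).
Hypothesis p1 : (1 <= p)%E.
Hypothesis sol : weak_solution Sigma p z0 z1 z f g.

Lemma solution_integrable_f T : mu.-integrable `]0, T[ (EFin \o f).
Proof.
have [T0|T0] := leP T 0; first exact: integrable_empty_itv.
by case: sol => _ [[_ /(_ T T0) H] _ _ _ _]; exact: Lp_on_integrable H.
Qed.

Lemma solution_integrable_g T : mu.-integrable `]-1, T[ (EFin \o g).
Proof.
have [T0|T0] := leP T (-1); first exact: integrable_empty_itv.
by case: sol => _ [_ [_ /(_ T T0) H] _ _ _]; exact: Lp_on_integrable H.
Qed.

Lemma solution_measurable_g : measurable_fun profile_domain g.
Proof. by case: sol => _ [_ [H _] _ _ _]. Qed.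

(** The condition z(t, 0) = 0 says that the primitive of f + g vanishes at
    almost every t > 0. *)
Lemma solution_opposite : {ae mu, forall s, 0 < s -> f s = - g s}.
Proof.
have H (n : nat) : {ae mu, forall s, 0 < s < n.+1%:R -> f s + g s = 0}.
  have ig := @integrable_subset_oo R _ _ 0 n.+1%:R _ (lerN10 R) (lexx _)
    (solution_integrable_g n.+1%:R).
  have i_f := solution_integrable_f n.+1%:R.
  apply: vanishing_integral_ae; [by rewrite ltr0n|exact: integrable_itvD|].
  have [_ [_ _ zE bd _]] := sol.
  move: bd; apply: ae_mono => t bd /andP[t0 tn].
  have [zt0 _] := bd (ltW t0).
  have i0 : (0 : R) \in `[0, 1] by rewrite in_itv/= lexx ler01.
  move: (zE t 0 (ltW t0) i0); rewrite zt0 addr0 subr0 -mulrDr.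
  move=> /esym/eqP; rewrite mulf_eq0 invr_eq0 (negbTE sqrt2_neq0)/=.
  rewrite /oriented_int (ltW t0) => /eqP E.
  have j1 := integrable_subset_oo (lexx 0) (ltW tn) i_f.
  have j2 := integrable_subset_oo (lexx 0) (ltW tn) ig.
  by rewrite RintegralD.
have := ae_foralln H; apply: ae_mono => s Hs s0.
apply/eqP; rewrite -subr_eq0 opprK; apply/eqP; apply: (Hs (Num.truncn s)).
by rewrite s0 truncnS_gt.
Qed.

Lemma solution_profile : profile Sigma g.
Proof.
split; first exact: solution_measurable_g.
have [_ [_ _ _ bd _]] := sol.
have := ae_shift 2 solution_opposite; have := ae_shift 1 bd.
apply: ae_mono2 => s Hb Ho s1.
have s0 : 0 <= 1 + s by lra.
have [_ Hs] := Hb s0.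
exists (time_deriv f g (1 + s) 1, - space_deriv f g (1 + s) 1) => //.
rewrite /time_deriv /space_deriv.
have -> : 1 + s - 1 = s by lra.
have -> : 1 + s + 1 = 2 + s by lra.
rewrite Ho; last lra.
by rewrite rotation_boundary (addrC 2 s).
Qed.

(** By d'Alembert's formula, z(t, x) - z(t, 0) is the integral of the function
    space_deriv f g t on ]0, x[; the weak derivative z_x is thus known for each t. *)
Lemma solution_space_deriv t : 0 <= t ->
  is_weak_derivative (z t) (space_deriv f g t).
Proof.
move=> t0; have [_ [_ _ zE _ _]] := sol.
have i1 : mu.-integrable `]t + 0, t + 1[ (EFin \o f).
  by apply: integrable_subset_oo (solution_integrable_f (t + 1)); lra.
have i2 : mu.-integrable `]t - 1, t - 0[ (EFin \o g).
  by apply: integrable_subset_oo (solution_integrable_g (t + 1)); lra.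
have j1 := integrable_shift i1; have j2 := integrable_flip i2.
pose s : R := (Num.sqrt 2)^-1.
have E : space_deriv f g t = (fun x => s * f (t + x) + (- s) * g (t - x)).
  by apply/funext => x; rewrite /space_deriv mulrBl mulNr !(mulrC s).
rewrite E; apply: (@primitive_weak_derivative R (z t 0)).
  by apply: integrable_itvD; apply: integrable_itvZ.
move=> x /andP[x0 x1].
have ix : x \in `[0, 1] by rewrite in_itv/= !ltW.
have i0 : (0 : R) \in `[0, 1] by rewrite in_itv/= lexx ler01.
have sub h : mu.-integrable `]0, 1[ (EFin \o h) -> mu.-integrable `]0, x[ (EFin \o h).
  by apply: integrable_subset_oo => //; exact: ltW.
rewrite RintegralD//; try by apply: integrable_itvZ; exact: sub.
rewrite RintegralZl//; last exact: sub.
rewrite RintegralZl//; last exact: sub.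
rewrite Rintegral_shift; last by apply: integrable_subset_oo i1; lra.
rewrite Rintegral_flip; last by apply: integrable_subset_oo i2; lra.
rewrite (zE t x t0 ix) (zE t 0 t0 i0) !addr0 !subr0 -/s.
have a1 : 0 <= t + x by lra.
rewrite (@oriented_int_split R 0 (t + x) t (t + x) f) ?lerDl//; last 2 first.
- exact: ltW.
- exact: solution_integrable_f.
rewrite (@oriented_int_split R (-1) t (t - x) t g)//; last 4 first.
- lra.
- lra.
- lra.
- exact: solution_integrable_g.
Qed.

End solution.

End profiles.

(** * The energy of a solution in terms of its profile *)

Section folding.
Context {R : realType}.
Local Notation mu := (@lebesgue_measure R).

Lemma ge0_integral_flip (c a b : R) (G : R -> \bar R) :
  measurable_fun `]c - b, c - a[ G -> (forall x, 0 <= G x)%E ->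
  (\int[mu]_(x in `]a, b[) G (c - x)%R = \int[mu]_(x in `](c - b)%R, (c - a)%R[) G x)%E.
Proof.
move=> mG G0.
have := @ge0_integral_affine R true c _ G (measurable_itv _) mG (fun x _ => G0 x).
rewrite affine_preimage_oo !subKr => <-.
by apply: eq_integral => x _; rewrite affineT.
Qed.

Lemma ge0_integral_shift (c a b : R) (G : R -> \bar R) :
  measurable_fun `]c + a, c + b[ G -> (forall x, 0 <= G x)%E ->
  (\int[mu]_(x in `]a, b[) G (c + x)%R = \int[mu]_(x in `](c + a)%R, (c + b)%R[) G x)%E.
Proof.
move=> mG G0.
have := @ge0_integral_affine R false c _ G (measurable_itv _) mG (fun x _ => G0 x).
rewrite affine_preimage_oo !(addrC c) !addrK => <-.
by apply: eq_integral => x _; rewrite affineF.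
Qed.

(** Cutting the window at its centre t and folding its left half back. *)
Lemma integral_window_fold (G : R -> \bar R) t : 0 <= t ->
  measurable_fun profile_domain G -> (forall x, 0 <= G x)%E ->
  (\int[mu]_(x in window t) G x =
   \int[mu]_(x in `]0%R, 1%R[) (G (t + x)%R + G (t - x)%R))%E.
Proof.
move=> t0 mG G0.
have mGw : measurable_fun (window t) G.
  exact: (measurable_funS measurable_profile_domain (window_sub t0) mG).
have e1 : t - 1 <= t by lra.
have e2 : t <= t + 1 by lra.
have m1 : measurable_fun (`](t - 1)%R, (t - 0)%R[%classic : set R) G.
  apply: measurable_funS mGw; first exact: measurable_window.
  by rewrite /window subr0; apply: subset_itvl; rewrite bnd_simp.
have m2 : measurable_fun (`](t + 0)%R, (t + 1)%R[%classic : set R) G.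
  apply: measurable_funS mGw; first exact: measurable_window.
  by rewrite /window addr0; apply: subset_itvr; rewrite bnd_simp.
rewrite (@ge0_integral_split _ _ _ _ G e1 e2 mGw G0).
have K1 := ge0_integral_flip m1 G0.
have K2 := ge0_integral_shift m2 G0.
have n1 : measurable_fun (`]0, 1[%classic : set R) (fun x => G (t - x)).
  have := measurable_itv `]t - 1, t - 0[ => mI.
  have : measurable_fun (affine true t @^-1` `]t - 1, t - 0[) (G \o affine true t).
    apply: (measurable_comp mI) => //; first by move=> _ [x Dx <-].
    by apply: measurable_funTS; exact: measurable_affine.
  rewrite affine_preimage_oo !subKr; congr measurable_fun.
  by apply/funext => x /=; rewrite affineT.
have n2 : measurable_fun (`]0, 1[%classic : set R) (fun x => G (t + x)).
  have := measurable_itv `]t + 0, t + 1[ => mI.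
  have : measurable_fun (affine false t @^-1` `]t + 0, t + 1[) (G \o affine false t).
    apply: (measurable_comp mI) => //; first by move=> _ [x Dx <-].
    by apply: measurable_funTS; exact: measurable_affine.
  rewrite affine_preimage_oo !(addrC t) !addrK; congr measurable_fun.
  by apply/funext => x /=; rewrite affineF.
rewrite subr0 in K1; rewrite addr0 in K2.
rewrite -K1 -K2 addeC.
have mI : measurable (`]0, 1[%classic : set (measurableTypeR R)).
  exact: measurable_itv.
by rewrite (ge0_integralD mu mI (fun x _ => G0 _) n2 (fun x _ => G0 _) n1).
Qed.

Lemma scaled_ae_eq_integral (k l : R) (F H : R -> R) : 0 <= k -> 0 <= l ->
  k * l = 1 ->
  measurable_fun (`]0, 1[%classic : set R) (EFin \o F) ->
  measurable_fun (`]0, 1[%classic : set R) (EFin \o H) ->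
  (forall x, 0 <= F x) -> (forall x, 0 <= H x) ->
  {ae mu, forall x, 0 < x < 1 -> F x = l * H x} ->
  (k%:E * \int[mu]_(x in `]0%R, 1%R[) (F x)%:E =
   \int[mu]_(x in `]0%R, 1%R[) (H x)%:E)%E.
Proof.
move=> k0 l0 kl mF mH F0 H0 FH.
have mI : measurable (`]0, 1[%classic : set (measurableTypeR R)).
  exact: measurable_itv.
have -> : (\int[mu]_(x in `]0%R, 1%R[) (F x)%:E =
    \int[mu]_(x in `]0%R, 1%R[) (l%:E * (H x)%:E))%E.
  apply: ge0_ae_eq_integral => //.
  - by apply/measurable_EFinP; apply: measurable_funM => //; apply/measurable_EFinP.
  - by move=> x _; rewrite lee_fin.
  - by move=> x _; rewrite mule_ge0 ?lee_fin.
  - move: FH; apply: ae_mono => x FH; rewrite /= in_itv/= => x01.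
    by rewrite (FH x01) EFinM.
rewrite ge0_integralZl//; last by move=> x _; rewrite lee_fin.
by rewrite muleA -EFinM kl mul1e.
Qed.

End folding.

Section energies.
Context {R : realType}.
Local Notation mu := (@lebesgue_measure R).
Variables (Sigma : set (R * R)) (p : \bar R) (z0 z1 : R -> R) (z : R -> R -> R).
Variables (f g : R -> R).
Hypothesis p1 : (1 <= p)%E.
Hypothesis sol : weak_solution Sigma p z0 z1 z f g.

Lemma weak_derivative_ae (u w : R -> R) : is_weak_derivative u w ->
  {ae mu, forall x, 0 < x < 1 -> weak_derivative u x = w x}.
Proof.
move=> uw; apply: (@weak_derivative_unique R u) => //.
by rewrite /weak_derivative; apply: xgetPex; exists w.
Qed.

Lemma measurable_weak_derivative (u w : R -> R) : is_weak_derivative u w ->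
  measurable_fun (`]0, 1[%classic : set R) (weak_derivative u).
Proof.
move=> uw; have [_ [+ _ _] _] : is_weak_derivative u (weak_derivative u).
  by rewrite /weak_derivative; apply: xgetPex; exists w.
by [].
Qed.

(** The Riemann invariants: since f = - g on positive times, z_x + z_t and
    z_x - z_t are, up to the factor - sqrt 2, the values of g at t + x and t - x. *)
Lemma solution_riemann_ae t : 0 <= t ->
  {ae mu, forall x, 0 < x < 1 ->
    weak_derivative (z t) x + time_deriv f g t x = Num.sqrt 2 * - g (t + x) /\
    weak_derivative (z t) x - time_deriv f g t x = Num.sqrt 2 * - g (t - x)}.
Proof.
move=> t0; have H1 := weak_derivative_ae (solution_space_deriv p1 sol t0).
have H2 := ae_shift t (solution_opposite p1 sol).
move: H1 H2; apply: ae_mono2 => x H1 H2 /[dup] x01 /andP[x0 x1].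
rewrite (H1 x01) /time_deriv /space_deriv H2; last lra.
have s2 := @sqrt2_sqr R; have s0 := @sqrt2_neq0 R.
split; apply: (mulfI s0); rewrite mulrA s2; field; exact: s0.
Qed.

Lemma measurable_flip_g t : 0 <= t ->
  measurable_fun (`]0, 1[%classic : set R) (fun x => g (t - x)).
Proof.
move=> t0; have i2 : mu.-integrable `]t - 1, t - 0[ (EFin \o g).
  by apply: integrable_subset_oo (solution_integrable_g p1 sol (t + 1)); lra.
by have /integrableP[/measurable_EFinP] := integrable_flip i2.
Qed.

Lemma measurable_shift_g t : 0 <= t ->
  measurable_fun (`]0, 1[%classic : set R) (fun x => g (t + x)).
Proof.
move=> t0; have i2 : mu.-integrable `]t + 0, t + 1[ (EFin \o g).
  by apply: integrable_subset_oo (solution_integrable_g p1 sol (t + 1)); lra.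
by have /integrableP[/measurable_EFinP] := integrable_shift i2.
Qed.

Lemma measurable_time_deriv t : 0 <= t ->
  measurable_fun (`]0, 1[%classic : set R) (time_deriv f g t).
Proof.
move=> t0; have i1 : mu.-integrable `]t + 0, t + 1[ (EFin \o f).
  by apply: integrable_subset_oo (solution_integrable_f p1 sol (t + 1)); lra.
have /integrableP[/measurable_EFinP m1 _] := integrable_shift i1.
apply: measurable_funM => //; apply: measurable_funD => //.
exact: measurable_flip_g.
Qed.

(** The two sides have the same nonnegative real upper bounds. *)
Lemma energy_infty t : 0 <= t ->
  energy +oo z f g t = norm_on (window t) +oo g.
Proof.
move=> t0; rewrite /energy /Xnorm.
set U := norm_on _ +oo (fun x => _ + _); set V := norm_on _ +oo (fun x => _ - _).
have s2 := @sqrt2_gt0 R; have s0 := @sqrt2_neq0 R.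
have H := solution_riemann_ae t0.
have key (K : R) : 0 <= K ->
    ((Num.sqrt 2)^-1%:E * maxe U V <= K%:E)%E <-> (norm_on (window t) +oo g <= K%:E)%E.
  move=> K0; rewrite lee_pdivrMl// ge_max; have K2 : 0 <= Num.sqrt 2 * K by rewrite mulr_ge0// ltW.
  rewrite -EFinM; split.
    move=> /andP[/(norm_on_ooP _ _ K2) HU /(norm_on_ooP _ _ K2) HV].
    apply/norm_on_ooP => //.
    have HU' : {ae mu, forall x, 0 < x < 1 -> `|g (t + x)| <= K}.
      move: H HU; apply: ae_mono2 => x H HU x01.
      have [E _] := H x01; have := HU; rewrite /= in_itv/= x01 => /(_ isT).
      by rewrite E normrM normrN (gtr0_norm s2) ler_pM2l.
    have HV' : {ae mu, forall x, 0 < x < 1 -> `|g (t - x)| <= K}.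
      move: H HV; apply: ae_mono2 => x H HV x01.
      have [_ E] := H x01; have := HV; rewrite /= in_itv/= x01 => /(_ isT).
      by rewrite E normrM normrN (gtr0_norm s2) ler_pM2l.
    have := ae_neq t.
    have := ae_shift (- t) HU'; have := ae_flip t HV'.
    apply: ae_mono3 => y A B yt; rewrite /window/= in_itv/= => /andP[y1 y2].
    move: yt; rewrite neq_lt => /orP[yt|yt].
      by have := A _; rewrite subKr; apply; apply/andP; split; lra.
    have := B _; rewrite addrA subrr add0r; apply; apply/andP; split; lra.
  move=> /(norm_on_ooP _ _ K0) G.
  apply/andP; split; apply/norm_on_ooP => //.
    have := ae_shift t G; move: H; apply: ae_mono2 => x H A /=; rewrite in_itv/= => x01.
    have [E _] := H x01; rewrite E normrM normrN (gtr0_norm s2) ler_pM2l//.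
    by apply: A; rewrite /window/= in_itv/=; case/andP: x01 => *; apply/andP; split; lra.
  have := ae_flip t G; move: H; apply: ae_mono2 => x H A /=; rewrite in_itv/= => x01.
  have [_ E] := H x01; rewrite E normrM normrN (gtr0_norm s2) ler_pM2l//.
  by apply: A; rewrite /window/= in_itv/=; case/andP: x01 => *; apply/andP; split; lra.
have n1 : (0 <= (Num.sqrt 2)^-1%:E * maxe U V)%E.
  apply: mule_ge0; first by rewrite lee_fin invr_ge0 ltW.
  by rewrite le_max norm_on_ge0.
have n2 := norm_on_ge0 (window t) +oo g.
apply/eqP; rewrite eq_le; apply/andP; split.
  case E : (norm_on (window t) +oo g) n2 => [K| |//]; last by move=> _; rewrite leey.
  by rewrite lee_fin => K0; apply/key => //; rewrite E.
case E : ((Num.sqrt 2)^-1%:E * maxe U V)%E n1 => [K| |//]; last by move=> _; rewrite leey.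
by rewrite lee_fin => K0; apply/key => //; rewrite E.
Qed.

Lemma energy_real (r t : R) : 1 <= r -> 0 <= t ->
  energy r%:E z f g t = norm_on (window t) r%:E g.
Proof.
move=> r1 t0; have r0 : 0 < r by exact: lt_le_trans r1.
have s2 := @sqrt2_gt0 R; have s0 := @sqrt2_neq0 R.
rewrite (norm_on_real _ _ r0) /energy /Xnorm.
apply: (f_equal (fun x => x `^ r^-1)%E).
pose G x := (`|g x| `^ r)%:E.
have G0 x : (0 <= G x)%E by rewrite lee_fin powR_ge0.
have mG : measurable_fun profile_domain G.
  exact: measurable_normpow (solution_measurable_g sol).
rewrite (@integral_window_fold R G t t0 mG G0).
pose w := weak_derivative (z t); pose v := time_deriv f g t.
have mw : measurable_fun (`]0, 1[%classic : set R) w.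
  exact: measurable_weak_derivative (solution_space_deriv p1 sol t0).
have mt : measurable_fun (`]0, 1[%classic : set R) v.
  exact: measurable_time_deriv t0.
have mwv := measurable_normpow r (measurable_funD mw mt).
have mwv' := measurable_normpow r (measurable_funB mw mt).
have mG1 := measurable_normpow r (measurable_flip_g t0).
have mG2 := measurable_normpow r (measurable_shift_g t0).
(* The normalisation of the norm of X_p compensates the factor sqrt 2 of the
   Riemann invariants. *)
have E : 2 `^ (- (r / 2)) * Num.sqrt 2 `^ r = 1 :> R.
  rewrite -powR12_sqrt// -powRrM -powRD; last by apply/implyP.
  by rewrite (_ : - (r / 2) + 2^-1 * r = 0) ?powRr0//; field.
apply: (@scaled_ae_eq_integral R (2 `^ (- (r / 2))) (Num.sqrt 2 `^ r)
  (fun x => `|w x + v x| `^ r + `|w x - v x| `^ r)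
  (fun x => `|g (t + x)| `^ r + `|g (t - x)| `^ r)) => //.
- by apply/measurable_EFinP; apply: measurable_funD; apply/measurable_EFinP.
- by apply/measurable_EFinP; apply: measurable_funD; apply/measurable_EFinP.
have := solution_riemann_ae t0; apply: ae_mono => x H x01.
have [E1 E2] := H x01; rewrite /w /v E1 E2.
by rewrite !normrM !normrN (gtr0_norm s2) !powRM// ?ltW// mulrDr.
Qed.

(** The energy in any X_q, possibly different from the space in which the
    solution is defined, is the L^q norm of the profile over a window. *)
Lemma energyE (q : \bar R) t : (1 <= q)%E -> 0 <= t ->
  energy q z f g t = norm_on (window t) q g.
Proof.
by case: q => [r|_|//]; [rewrite lee_fin; exact: energy_real|exact: energy_infty].
Qed.

End energies.

(** * Orbits and initial values of a profile *)

Section traces.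
Context {R : realType}.
Local Notation mu := (@lebesgue_measure R).

(** After rotation, x^2 - y^2 is twice the product of the coordinates. *)
Lemma rotation_damping (Sigma : set (R * R)) x y : damping_set Sigma ->
  (rotation @` Sigma) (x, y) -> `|y| <= `|x|.
Proof.
move=> [_ ds _] [[a b] ab [<- <-]].
have ab0 := ds _ _ ab; have s2 := @sqrt2_gt0 R.
rewrite !normrM ler_pM2r ?normr_gt0 ?invr_neq0 ?gt_eqF//.
by rewrite -ler_sqr ?nnegrE// !real_normK ?num_real//=; nra.
Qed.

Lemma profile_decay (Sigma : set (R * R)) g : damping_set Sigma ->
  profile Sigma g -> {ae mu, forall s, -1 < s -> `|g (s + 2)| <= `|g s|}.
Proof.
move=> ds [_ H]; move: H; apply: ae_mono => s H s1.
exact: rotation_damping ds (H s1).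
Qed.

(** A countable union of translates of a negligible set is negligible, so a
    relation between consecutive values holds along the whole orbit. *)
Lemma orbit_ae (P : R -> R -> Prop) (g : R -> R) :
  {ae mu, forall s, -1 < s -> P (g s) (g (s + 2))} ->
  {ae mu, forall s, -1 < s -> forall n : nat,
    P (g (s + 2 * n%:R)) (g (s + 2 * n.+1%:R))}.
Proof.
move=> H.
have : {ae mu, forall s, forall n : nat, -1 < s -> P (g (s + 2 * n%:R)) (g (s + 2 * n.+1%:R))}.
  apply: ae_foralln => n; have := ae_shift (2 * n%:R) H.
  apply: ae_mono => s Hs s1; have n0 := ler0n R n.
  have s1' : -1 < 2 * n%:R + s by lra.
  have e1 : 2 * n%:R + s = s + 2 * n%:R by ring.
  have e2 : 2 * n%:R + s + 2 = s + 2 * n.+1%:R.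
    by rewrite -[n.+1%:R]natr1; ring.
  by have := Hs s1'; rewrite e2 e1.
by apply: ae_mono => s Hs s1 n; exact: Hs.
Qed.

Lemma ae0_Rintegral (a b : R) (h : R -> R) :
  {ae mu, forall x, a < x < b -> h x = 0} ->
  measurable_fun `]a, b[ h ->
  \int[mu]_(x in `]a, b[) h x = 0.
Proof.
move=> H mh; rewrite /Rintegral.
have mI : measurable (`]a, b[%classic : set (measurableTypeR R)).
  exact: measurable_itv.
rewrite (@ae_eq_integral _ _ _ mu _ (cst 0%E) _ mI)//.
- by rewrite integral0.
- exact/measurable_EFinP.
- by move: H; apply: ae_mono => x H; rewrite /= in_itv/= => /H ->.
Qed.

(** If g vanished on ]-1, 1[, it would vanish along all orbits because |g|
    decreases along them, and then so would f = - g. *)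
Lemma solution_nontrivial (Sigma : set (R * R)) (p : \bar R) (z0 z1 : R -> R)
    (z : R -> R -> R) (f g : R -> R) : damping_set Sigma -> (1 <= p)%E ->
  weak_solution Sigma p z0 z1 z f g ->
  (exists t x : R, [/\ 0 <= t, 0 <= x <= 1 & z t x <> 0]) ->
  ~ {ae mu, forall s, -1 < s < 1 -> g s = 0}.
Proof.
move=> ds p1 sol [t [x [t0 /andP[x0 x1] ztx]]] H; apply: ztx.
have pr := solution_profile p1 sol.
have [mg _] := pr; have dg := profile_decay ds pr.
have gall : {ae mu, forall s, -1 < s -> g s = 0}.
  have O := @orbit_ae (fun u v => `|v| <= `|u|) g dg.
  have Hn (n : nat) : {ae mu, forall s, -1 < s - 2 * n%:R < 1 -> g s = 0}.
    have := ae_shift (- (2 * n%:R)) H; have := ae_shift (- (2 * n%:R)) O.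
    apply: ae_mono2 => s Os Hs; rewrite addrC => /andP[s1 s2].
    have Z k : g (- (2 * n%:R) + s + 2 * k%:R) = 0.
      elim: k => [|k IH]; first by rewrite mulr0 addr0; apply: Hs; rewrite s1.
      by have := Os s1 k; rewrite IH normr0 normr_le0 => /eqP.
    by rewrite -(Z n); congr g; lra.
  (* The translates of ]-1, 1[ by even integers miss the odd integers. *)
  have Hodd : {ae mu, forall s, forall n : nat, s != 2 * n%:R + 1}.
    by apply: ae_foralln => n; exact: ae_neq.
  move: (ae_foralln Hn) Hodd; apply: ae_mono2 => s Hs sn s1.
  pose n := Num.truncn ((s + 1) / 2).
  have s0 : 0 <= (s + 1) / 2 by lra.
  have := truncn_itv s0; rewrite -/n -[n.+1%:R]natr1 => /andP[n1 n2].
  apply: (Hs n); have := Hs n.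
  have : -1 <= s - 2 * n%:R by lra.
  rewrite le_eqVlt => /orP[/eqP e|->]; last by move=> _; lra.
  case: n e {n1 n2 Hs} => [|n] e; first by move: e; rewrite mulr0 subr0 => e; lra.
  by have := sn n; rewrite -[n.+1%:R]natr1 in e; rewrite (_ : s = 2 * n%:R + 1) ?eqxx//; lra.
have fall : {ae mu, forall s, 0 < s -> f s = 0}.
  move: gall (solution_opposite p1 sol); apply: ae_mono2 => s G F s0.
  by rewrite F// G ?oppr0//; lra.
have mf : measurable_fun (`]0, (t + x)%R[ : set R) f.
  by have /integrableP[/measurable_EFinP] := solution_integrable_f p1 sol (t + x).
have ix : x \in `[0, 1] by rewrite in_itv/= x0.
have [_ [_ _ zE _ _]] := sol.
rewrite (zE t x t0 ix) /oriented_int.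
have tx : 0 <= t + x by lra.
rewrite tx ae0_Rintegral//; last first.
  by move: fall; apply: ae_mono => s F /andP[s0 _]; exact: F.
have gi a b : -1 <= a -> \int[mu]_(s in `]a, b[) g s = 0.
  move=> a1; apply: ae0_Rintegral.
    by move: gall; apply: ae_mono => s G /andP[sa _]; apply: G; lra.
  apply: measurable_funS mg; first exact: measurable_profile_domain.
  by move=> s; rewrite /profile_domain /= !in_itv/= => /andP[sa _]; rewrite andbT; lra.
case: ifP => _; rewrite gi ?oppr0 ?mulr0 ?addr0//; lra.
Qed.

Lemma is_weak_derivative_ae (u v w : R -> R) :
  {ae mu, forall x, 0 < x < 1 -> u x = v x} ->
  mu.-integrable `]0, 1[ (EFin \o v) ->
  is_weak_derivative u w -> is_weak_derivative v w.
Proof.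
move=> uv iv [[mu_ _ _] lw H]; split => //.
  by apply: open_integrable_locally => //; exact: interval_open.
move=> phi tphi; rewrite -(H _ tphi) /Rintegral; congr fine.
have [_ cphi _] := tphi.
have mD : measurable_fun (`]0, 1[%classic : set R) (derive1 phi).
  by apply: measurable_funTS; exact: continuous_measurable_fun.
have mv : measurable_fun (`]0, 1[%classic : set R) v.
  by have /integrableP[/measurable_EFinP] := iv.
have mI : measurable (`]0, 1[%classic : set (measurableTypeR R)).
  exact: measurable_itv.
apply: (@ae_eq_integral _ _ _ mu _ _ _ mI).
- by apply/measurable_EFinP; exact: measurable_funM.
- by apply/measurable_EFinP; exact: measurable_funM.
- by move: uv; apply: ae_mono => x H'; rewrite /= in_itv/= => /H' ->.
Qed.

(** z(0, .) equals z0 almost everywhere, so that z0' and z_x(0, .) are equal by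
    uniqueness of weak derivatives; the rotation that defines g0 then returns g. *)
Lemma frakI_trace (Sigma : set (R * R)) (p r : \bar R) (z0 z1 g0 : R -> R)
    (z : R -> R -> R) (f g : R -> R) : (1 <= p)%E -> (1 <= r)%E ->
  weak_solution Sigma p z0 z1 z f g -> frakI r z0 z1 g0 ->
  {ae mu, forall s, -1 < s < 1 -> g0 s = g s}.
Proof.
move=> p1 r1 sol [[[L _ _] _] _ fI].
have [_ [_ _ _ _ ini]] := sol.
have wz0 : is_weak_derivative z0 (space_deriv f g 0).
  apply: (@is_weak_derivative_ae (z 0)).
  - move: ini; apply: ae_mono => x H /andP[x0 x1].
    by have [] := H _; first by rewrite in_itv/= !ltW.
  - exact: Lp_on_integrable L.
  - exact: (solution_space_deriv p1 sol (lexx 0)).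
have W := weak_derivative_ae wz0.
have O := solution_opposite p1 sol.
have key : {ae mu, forall s, 0 < s < 1 -> (g0 (- s), g0 s) = (g (- s), g s)}.
  have OI : {ae mu, forall x,
      (x \in `[0, 1] -> z 0 x = z0 x /\ time_deriv f g 0 x = z1 x) /\
      (0 < x -> f x = - g x)}.
    by move: ini O; apply: ae_mono2.
  move: fI W OI; apply: ae_mono3 => s F Ws [I Os] /[dup] s01 /andP[s0 s1].
  have i01 : s \in `[0, 1] by rewrite in_itv/= !ltW.
  rewrite (F i01) (Ws s01) -(I i01).2 /time_deriv /space_deriv add0r sub0r Os//.
  exact: rotation_boundary.
have key' := ae_flip 0 key; have := @ae_neq R 0; move: key key'.
apply: ae_mono3 => s K K' sN0 /andP[s1 s2].
move: sN0; rewrite neq_lt => /orP[sn|sp].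
  have := K' _; rewrite sub0r opprK => H.
  have h : 0 < - s < 1 by apply/andP; split; lra.
  by have [] := H h.
have h : 0 < s < 1 by apply/andP; split; lra.
by have [] := K h.
Qed.

End traces.

(** * The solution with a given bounded profile *)

Section construction.
Context {R : realType}.
Local Notation mu := (@lebesgue_measure R).

Lemma rotation_inv (xi : R * R) :
  ((- (rotation xi).2 + (rotation xi).1) / Num.sqrt 2,
   - ((- (rotation xi).2 - (rotation xi).1) / Num.sqrt 2)) = xi.
Proof.
case: xi => a b; rewrite /rotation/=.
have k : (Num.sqrt 2)^-1 * (Num.sqrt 2)^-1 = 2^-1 :> R.
  by rewrite -invfM sqrt2_sqr.
congr pair.
  transitivity (2 * a * ((Num.sqrt 2)^-1 * (Num.sqrt 2)^-1)); first by ring.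
  by rewrite k; field.
transitivity (2 * b * ((Num.sqrt 2)^-1 * (Num.sqrt 2)^-1)); first by ring.
by rewrite k; field.
Qed.

Lemma profile_bounded (Sigma : set (R * R)) (g : R -> R) (K : R) : 0 <= K ->
  damping_set Sigma -> profile Sigma g ->
  {ae mu, forall s, -1 < s < 1 -> `|g s| <= K} ->
  {ae mu, forall s, -1 < s -> `|g s| <= K}.
Proof.
move=> K0 ds pr HK; have dg := profile_decay ds pr; have [mg _] := pr.
have w0 : (norm_on (window 0) +oo g <= K%:E)%E.
  apply/norm_on_ooP => //; move: HK; apply: ae_mono => s H.
  by rewrite /window/= in_itv/= sub0r add0r.
have Hn (n : nat) : {ae mu, forall s, window n%:R s -> `|g s| <= K}.
  apply/norm_on_ooP => //; apply: le_trans w0.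
  by apply: norm_on_window_le => //; exact: leey.
have := ae_foralln Hn; apply: ae_mono => s Hs s1.
have [s0|s0] := leP 0 s; last first.
  by apply: (Hs 0%N); rewrite /window/= in_itv/=; apply/andP; split; lra.
apply: (Hs (Num.truncn s)); rewrite /window/= in_itv/=.
have /andP[h1 h2] := truncn_itv s0.
by rewrite -[X in _ < X]natr1 in h2; apply/andP; split; lra.
Qed.

Lemma Lp_on_infty (D : set R) (h : R -> R) (K : R) : 0 <= K ->
  measurable_fun D h -> {ae mu, forall x, D x -> `|h x| <= K} ->
  Lp_on D +oo h.
Proof.
move=> K0 mh H; split=> //; apply: (@le_lt_trans _ _ K%:E); last exact: ltry.
exact/norm_on_ooP.
Qed.

(** d'Alembert's formula with f = - g. This is how uniform stability, a
    property of solutions, is applied to profiles made by hand. *)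
Lemma profile_solution (Sigma : set (R * R)) (g : R -> R) (K : R) : 0 <= K ->
  damping_set Sigma -> profile Sigma g ->
  {ae mu, forall s, -1 < s < 1 -> `|g s| <= K} ->
  exists (z0 z1 : R -> R) (z : R -> R -> R) (f : R -> R),
    weak_solution Sigma +oo z0 z1 z f g.
Proof.
move=> K0 ds pr /(profile_bounded K0 ds pr) gK; have [mg rel] := pr.
pose f s := - g s.
pose z t x : R := (Num.sqrt 2)^-1 * oriented_int 0 (t + x) f
              + (Num.sqrt 2)^-1 * oriented_int 0 (t - x) g.
have mgS (a b : R) : -1 <= a -> measurable_fun (`]a, b[%classic : set R) g.
  move=> a1; apply: measurable_funS mg; first exact: measurable_profile_domain.
  by move=> s; rewrite /profile_domain /= !in_itv/= => /andP[sa _]; rewrite andbT; lra.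
have Lg (a b : R) : -1 <= a -> Lp_on `]a, b[ +oo g.
  move=> a1; apply: (Lp_on_infty K0); first exact: mgS.
  by move: gK; apply: ae_mono => s H; rewrite /= in_itv/= => /andP[sa _]; apply: H; lra.
have Lf (a b : R) : -1 <= a -> Lp_on `]a, b[ +oo f.
  move=> a1; apply: (Lp_on_infty K0); first by apply: measurable_funN; exact: mgS.
  move: gK; apply: ae_mono => s H; rewrite /= in_itv/= => /andP[sa _].
  by rewrite normrN; apply: H; lra.
have ig (a b : R) : -1 <= a -> mu.-integrable `]a, b[ (EFin \o g).
  by move=> a1; apply: (Lp_on_integrable _ (Lg a b a1)); exact: leey.
have if_ (a b : R) : -1 <= a -> mu.-integrable `]a, b[ (EFin \o f).
  by move=> a1; apply: (Lp_on_integrable _ (Lf a b a1)); exact: leey.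
have s2 := @sqrt2_gt0 R.
pose h := space_deriv f g 0.
have ifl : mu.-integrable `]0, 1[ (EFin \o (fun x => g (0 - x))).
  by apply: integrable_flip; apply: ig; lra.
have ish : mu.-integrable `]0, 1[ (EFin \o (fun x => f (0 + x))).
  by apply: integrable_shift; apply: if_; lra.
have hE : h = (fun x => (Num.sqrt 2)^-1 * f (0 + x) + - (Num.sqrt 2)^-1 * g (0 - x)).
  by apply/funext => x; rewrite /h /space_deriv; ring.
have ih : mu.-integrable `]0, 1[ (EFin \o h).
  by rewrite hE; apply: integrable_itvD; apply: integrable_itvZ.
have zh x : 0 <= x <= 1 -> z 0 x = \int[mu]_(y in `]0, x[) h y.
  move=> /andP[x0 x1].
  have sub k : mu.-integrable `]0, 1[ (EFin \o k) -> mu.-integrable `]0, x[ (EFin \o k).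
    exact: integrable_subset_oo.
  rewrite hE RintegralD//; try by apply: integrable_itvZ; exact: sub.
  rewrite RintegralZl//; last exact: sub.
  rewrite RintegralZl//; last exact: sub.
  rewrite Rintegral_shift; last by apply: if_; lra.
  rewrite Rintegral_flip; last by apply: ig; lra.
  rewrite /z /oriented_int !add0r oppr0 x0.
  have [x0'|x0'] := leP 0 (- x); last by ring.
  by rewrite (_ : x = 0) ?oppr0 ?Rintegral_oo_nil ?mulr0//; lra.
have bnd (t : R) : 0 <= t -> {ae mu, forall x, 0 < x < 1 ->
    `|f (t + x)| <= K /\ `|g (t - x)| <= K}.
  move=> t0; have := ae_shift t gK; have := ae_flip t gK.
  apply: ae_mono2 => x A B /andP[x0 x1]; rewrite normrN.
  by split; [apply: B|apply: A]; lra.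
have mf0 : measurable_fun (`]0, 1[%classic : set R) (fun x => f (0 + x)).
  by have /integrableP[/measurable_EFinP] := ish.
have mg0 : measurable_fun (`]0, 1[%classic : set R) (fun x => g (0 - x)).
  by have /integrableP[/measurable_EFinP] := ifl.
pose K' := (K + K) / Num.sqrt 2.
have K'0 : 0 <= K' by rewrite divr_ge0 ?addr_ge0// ltW.
have sum_bound (u v : R) : `|u| <= K -> `|v| <= K ->
    `|(u + v) / Num.sqrt 2| <= K'.
  move=> uK vK; have i0 : 0 < (Num.sqrt 2)^-1 :> R by rewrite invr_gt0.
  rewrite normrM (gtr0_norm i0) /K' ler_pM2r//.
  by apply: (le_trans (ler_normD _ _)); exact: lerD.
pose U x := \int[mu]_(y in `]0, x[) h y.
have cU : {within `[0, 1], continuous U} := Rintegral_oo_continuous ltr01 ih.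
have zU x : x \in `]0, 1[ -> z 0 x = U x.
  by rewrite in_itv/= => /andP[x0 x1]; rewrite zh// !ltW.
have [B B0 HB] := within_continuous_bounded_itv cU.
have mz : measurable_fun (`]0, 1[%classic : set R) (z 0).
  apply: (eq_measurable_fun U); first by move=> x /set_mem xI; rewrite zU.
  have mU : measurable_fun (`[0, 1]%classic : set R) U.
    by apply: subspace_continuous_measurable_fun.
  by apply: measurable_funS mU => //; exact: subset_itv_oo_cc.
exists (z 0), (time_deriv f g 0), z, f; split; last split.
- split; first split.
  + apply: (Lp_on_infty B0) => //; apply: aeW => x xI.
    rewrite (zU x xI); apply: HB; move: xI; rewrite /= in_itv/= => /andP[? ?].
    by rewrite !ltW.
  + exists h.
      apply: (@primitive_weak_derivative R 0) => // x /andP[x0 x1].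
      by rewrite add0r zh// !ltW.
    apply: (Lp_on_infty K'0).
      by have /integrableP[/measurable_EFinP] := ih.
    move: (bnd 0 (lexx 0)); apply: ae_mono => x H; rewrite /= in_itv/= => x01.
    have [? ?] := H x01; apply: sum_bound => //; by rewrite normrN.
  + exists U; split => //; first by apply: aeW => x; exact: zU.
    exact: Rintegral_oo_nil.
  apply: (Lp_on_infty K'0).
    by apply: measurable_funM => //; exact: measurable_funD.
  move: (bnd 0 (lexx 0)); apply: ae_mono => x H; rewrite /= in_itv/= => x01.
  by have [? ?] := H x01; apply: sum_bound.
- split; last by move=> T T0; apply: Lf; lra.
  apply: measurable_funN; apply: measurable_funS mg.
    exact: measurable_profile_domain.
  by move=> s; rewrite /profile_domain/= !in_itv/= !andbT => s0; lra.
- split => //; by move=> T T0; apply: Lg.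
- by [].
- move: (ae_shift (-1) rel) (@ae_neq R 0); apply: ae_mono2 => t rel_t tN0 t0.
  split.
    rewrite /z addr0 subr0 /oriented_int t0 /f Rintegral_itvN; last by apply: ig; lra.
    by ring.
  have t1 : -1 < -1 + t by move: tN0; rewrite neq_lt => /orP[]; lra.
  have [xi Sxi E] := rel_t t1.
  rewrite /time_deriv /space_deriv /f.
  have e1 : t - 1 = -1 + t by ring.
  have e2 : t + 1 = -1 + t + 2 by ring.
  by rewrite e1 e2; have := rotation_inv xi; rewrite E/= => ->.
- by apply: aeW.
Qed.

End construction.

(** * Decay functions and their iterates *)

Section decay_functions.
Context {R : realType}.
Implicit Types (Q dQ : R -> R) (x y : R).

Lemma C1_halfline_quotient Q dQ x : C1_halfline Q dQ -> 0 <= x ->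
  forall e, 0 < e -> exists2 d, 0 < d & forall y, 0 <= y -> y != x ->
    `|x - y| < d -> `|dQ x - (Q y - Q x) / (y - x)| <= e.
Proof.
move=> [H _] x0 e e0; have /cvgrPdist_le /(_ _ e0) := H _ x0.
rewrite /within/= => -[d /= d0 Hd]; exists d => // y y0 yx xyd.
by apply: Hd => //=; rewrite /ball_/=.
Qed.

Lemma C1_halfline_derive Q dQ x : C1_halfline Q dQ -> 0 < x ->
  is_derive x 1 Q (dQ x).
Proof.
move=> C1 x0.
have H : (h^-1 *: (Q (h + x) - Q x)) @[h --> 0^'] --> dQ x.
  apply/cvgrPdist_le => e e0.
  have [d d0 Hd] := C1_halfline_quotient C1 (ltW x0) e0.
  near=> h.
  have h0 : h != 0 by near: h; exact: nbhs_dnbhs_neq.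
  have hd : `|h| < d by near: h; apply: dnbhs0_lt.
  have hx : `|h| < x by near: h; apply: dnbhs0_lt.
  have := Hd (h + x); rewrite addrK mulrC; apply.
  - by move: hx; rewrite ltr_norml => /andP[]; lra.
  - by rewrite -subr_eq0 addrK.
  - by rewrite opprD addrCA subrr addr0 normrN.
have E : (fun h : R => h^-1 *: ((Q \o shift x) (h *: 1) - Q x)) =
    (fun h => h^-1 *: (Q (h + x) - Q x)).
  by apply/funext => h /=; rewrite [_%:A]mulr1.
apply: DeriveDef.
  by apply/cvg_ex; exists (dQ x); rewrite E.
by rewrite /derive E; apply/cvg_lim; first exact: Rhausdorff.
Unshelve. all: by end_near. Qed.

Section iterates.
Variable Q : R -> R.
Hypothesis decQ : decay_function Q.

Lemma decay_ge0 x : 0 <= x -> 0 <= Q x.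
Proof. by case: decQ => + _ _ _; exact. Qed.

Lemma decay_le x : 0 <= x -> Q x <= x.
Proof.
have [_ Q0 H _] := decQ; rewrite le_eqVlt => /predU1P[<-|x0].
  by rewrite Q0.
by case/andP: (H _ x0) => _ /ltW.
Qed.

Lemma decay_homo x y : 0 <= x -> x <= y -> Q x <= Q y.
Proof.
have [Qge0 Q0 H [dQ C1 dQ0]] := decQ.
rewrite le_eqVlt => /predU1P[<- y0|x0 xy]; first by rewrite Q0 Qge0.
have D (z : R) : 0 < z -> is_derive z 1 Q (dQ z) by exact: C1_halfline_derive.
apply: (@ger0_derive1_le_cc R Q x y) => //.
- move=> z; rewrite in_itv/= => /andP[xz _].
  by have [] := D _ (lt_trans x0 xz).
- move=> z; rewrite in_itv/= => /andP[xz _].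
  have z0 := lt_trans x0 xz.
  by rewrite derive1E; have [_ ->] := D _ z0; exact/ltW/dQ0.
- apply: derivable_within_continuous => z; rewrite in_itv/= => /andP[xz _].
  by have [] := D _ (lt_le_trans x0 xz).
- by rewrite in_itv/= lexx xy.
- by rewrite in_itv/= lexx xy.
Qed.

Lemma iter_decay_ge0 n x : 0 <= x -> 0 <= iter n Q x.
Proof. by move=> x0; elim: n => //= n IH; exact: decay_ge0. Qed.

Lemma iter_decay_nincr n k x : 0 <= x -> (k <= n)%N -> iter n Q x <= iter k Q x.
Proof.
move=> x0 /subnKC <-; elim: (n - k)%N => [|j IH]; first by rewrite addn0.
rewrite addnS/=; apply: le_trans IH; apply: decay_le; exact: iter_decay_ge0.
Qed.

(** The infimum l of the iterates would be positive otherwise; iterates close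
    to l are then mapped below l, because Q(l) < l and Q is continuous at l. *)
Lemma iter_decay_small x d : 0 <= x -> 0 < d ->
  exists N, forall n, (N <= n)%N -> iter n Q x <= d.
Proof.
move=> x0 d0; have [_ _ H [dQ C1 _]] := decQ.
suff [N HN] : exists N, iter N Q x <= d.
  by exists N => n Nn; apply: le_trans HN; exact: iter_decay_nincr.
apply: contrapT => nE.
have big n : d < iter n Q x by rewrite ltNge; apply/negP => h; apply: nE; exists n.
pose S := [set iter n Q x | n in [set: nat]].
have hS : has_inf S.
  split; first by exists x; exists 0%N.
  by exists d => _ [n _ <-]; exact: ltW.
pose l := inf S.
have lb n : l <= iter n Q x by apply: ge_inf; [case: hS|exists n].
have l0 : 0 < l.
  apply: (lt_le_trans d0); apply: lb_le_inf; first by case: hS.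
  by move=> _ [n _ <-]; exact: ltW.
have /andP[_ Ql] := H _ l0.
have [e e0 He] := C1_halfline_quotient C1 (ltW l0) (@ltr01 R).
pose C := `|dQ l| + 1.
have C0 : 0 < C by rewrite ltr_pwDr.
(* Within distance r of l, the difference quotient is at most C, so that Q
   stays below Q l + C r <= l. *)
pose r := Num.min e ((l - Q l) / C).
have r0 : 0 < r by rewrite lt_min e0 divr_gt0// subr_gt0.
have [_ [n _ <-] nr] := inf_adherent r0 hS.
have ln := lb n.
have : iter n.+1 Q x < l.
  rewrite /=; set y := iter n Q x in nr ln *.
  have [->//|yl] := eqVneq y l.
  have yl0 : 0 < y - l by rewrite subr_gt0 lt_neqAle eq_sym yl.
  have yr : y - l < r by rewrite ltrBlDl.
  have := He y (le_trans (ltW l0) ln) yl.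
  rewrite distrC gtr0_norm// => /(_ _) h.
  have {}h : `|dQ l - (Q y - Q l) / (y - l)| <= 1.
    by apply: h; apply: lt_le_trans yr _; rewrite ge_min lexx.
  have q : (Q y - Q l) / (y - l) <= C.
    have := ler_norm (dQ l); move: h; rewrite ler_norml /C => /andP[]; lra.
  rewrite ler_pdivrMr// in q.
  have : C * (y - l) < l - Q l.
    rewrite -ltr_pdivlMl// mulrC; apply: lt_le_trans yr _.
    by rewrite ge_min lexx orbT.
  by lra.
by rewrite ltNge lb.
Qed.

(** Q(y)/y has a limit at 0, which cannot be close to both a and b. *)
Lemma decay_linear_dichotomy a b : a < b -> exists mu d, [/\ a < mu < b, 0 < d &
  (forall y, 0 <= y <= d -> Q y <= mu * y) \/
  (forall y, 0 <= y <= d -> mu * y <= Q y)].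
Proof.
move=> ab; have [_ Q0 H [dQ C1 _]] := decQ.
pose e := (b - a) / 8.
have e0 : 0 < e by rewrite /e; lra.
have [d d0 Hd] := C1_halfline_quotient C1 (lexx 0) e0.
have {}Hd y : 0 <= y <= d / 2 -> (dQ 0 - e) * y <= Q y <= (dQ 0 + e) * y.
  move=> /andP[]; rewrite le_eqVlt => /predU1P[<- _|y0 yd].
    by rewrite !mulr0 Q0 lexx.
  have := Hd y (ltW y0); rewrite gt_eqF// sub0r normrN gtr0_norm// Q0 !subr0.
  move=> /(_ isT) h; have {}h : `|dQ 0 - Q y / y| <= e by apply: h; lra.
  have := h; rewrite ler_norml => /andP[h1 h2].
  by rewrite -ler_pdivlMr// -[Q y <= _]ler_pdivrMr//; apply/andP; split; lra.
have [l|l] := leP (dQ 0) ((a + b) / 2).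
  exists ((a + b) / 2 + e), (d / 2); split; [by rewrite /e; lra|lra|left].
  move=> y /[dup] yd /andP[y0 _]; have /andP[_ h] := Hd _ yd.
  by apply: (le_trans h); rewrite ler_wpM2r//; lra.
exists ((a + b) / 2 - e), (d / 2); split; [by rewrite /e; lra|lra|right].
move=> y /[dup] yd /andP[y0 _]; have /andP[h _] := Hd _ yd.
by apply: le_trans h; rewrite ler_wpM2r//; lra.
Qed.

End iterates.
End decay_functions.

(** * Sequences controlled by a decay function *)

Section sequences.
Context {R : realType}.
Variable Q : R -> R.
Hypothesis decQ : decay_function Q.
Implicit Types (x : nat -> R) (m : R).

Lemma nincr_seq_le x n k : (forall i, x i.+1 <= x i) -> (k <= n)%N ->
  x n <= x k.
Proof.
move=> dx /subnKC <-; elim: (n - k)%N => [|j IH]; first by rewrite addn0.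
by rewrite addnS; exact: le_trans (dx _) IH.
Qed.

Lemma seq_le_iter x (B c : R) k i : (forall n, 0 <= x n) ->
  (forall n, x n.+1 <= x n) -> (forall n, x n <= B -> x n.+1 <= Q (x n)) ->
  x k <= B -> x k <= c -> x (k + i)%N <= iter i Q c.
Proof.
move=> x0 dx Qx kB kc; elim: i => [|i IH]; first by rewrite addn0.
have iB : x (k + i)%N <= B.
  by apply: le_trans kB; apply: nincr_seq_le => //; exact: leq_addr.
rewrite addnS/=; apply: (le_trans (Qx _ iB)); exact: decay_homo.
Qed.

Lemma seq_ge_iter x (B c : R) k i : (forall n, 0 <= x n) ->
  (forall n, x n.+1 <= x n) -> (forall n, x n <= B -> Q (x n) <= x n.+1) ->
  x k <= B -> 0 <= c -> c <= x k -> iter i Q c <= x (k + i)%N.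
Proof.
move=> x0 dx Qx kB c0 kc; elim: i => [|i IH]; first by rewrite addn0.
have iB : x (k + i)%N <= B.
  by apply: le_trans kB; apply: nincr_seq_le => //; exact: leq_addr.
rewrite addnS/=; apply: le_trans (Qx _ iB); apply: decay_homo => //.
exact: iter_decay_ge0.
Qed.

Lemma geometric_seq_le x m (Z : R) k : 0 <= m ->
  (forall n, Z < x n -> x n.+1 <= m * x n) ->
  (forall j, (j < k)%N -> Z < x j) -> x k <= m ^+ k * x 0%N.
Proof.
move=> m0 H; elim: k => [|k IH] Hk; first by rewrite expr0 mul1r.
rewrite exprS -mulrA; apply: (le_trans (H _ (Hk k (ltnSn k)))).
by rewrite ler_wpM2l// IH// => j jk; apply: Hk; exact: ltnW.
Qed.

Lemma iter_decay_le_geometric mu d N i c : 0 <= mu ->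
  (forall y, 0 <= y <= d -> Q y <= mu * y) -> 0 <= c ->
  (forall n, (N <= n)%N -> iter n Q c <= d) ->
  iter (N + i) Q c <= mu ^+ i * d.
Proof.
move=> mu0 H c0 small; elim: i => [|i IH].
  by rewrite addn0 expr0 mul1r; exact: small.
rewrite addnS/= exprS -mulrA; apply: (@le_trans _ _ (mu * iter (N + i) Q c)).
  by apply: H; rewrite iter_decay_ge0//= small// leq_addr.
by rewrite ler_wpM2l.
Qed.

Lemma iter_decay_ge_geometric mu d N n i c : 0 <= mu ->
  (forall y, 0 <= y <= d -> mu * y <= Q y) -> 0 <= c ->
  (forall n, (N <= n)%N -> iter n Q c <= d) -> (N <= n)%N ->
  mu ^+ i * iter n Q c <= iter (n + i) Q c.
Proof.
move=> mu0 H c0 small Nn; elim: i => [|i IH].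
  by rewrite addn0 expr0 mul1r.
rewrite addnS/= exprS -mulrA; apply: (@le_trans _ _ (mu * iter (n + i) Q c)).
  by rewrite ler_wpM2l.
by apply: H; rewrite iter_decay_ge0//= small// (leq_trans Nn)// leq_addr.
Qed.

Lemma expr_small (q e : R) : 0 <= q < 1 -> 0 < e ->
  exists N, forall k, (N <= k)%N -> q ^+ k <= e.
Proof.
move=> /andP[q0 q1] e0.
have /cvgrPdist_le /(_ _ e0) [N _ HN] : q ^+ k @[k --> \oo] --> (0 : R).
  by apply: cvg_expr; rewrite ger0_norm.
exists N => k Nk; have := HN k Nk.
by rewrite sub0r normrN ger0_norm// exprn_ge0.
Qed.

Lemma uphalf_bounds n : (n <= (uphalf n).*2 <= n.+1)%N.
Proof.
rewrite uphalf_half -[X in (X <= _ <= _)%N]odd_double_half.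
rewrite -[X in (_ <= _ <= X.+1)%N]odd_double_half doubleD.
by case: (odd n); rewrite /= ?add1n ?add0n !leqnn ?leqnSn.
Qed.

(** An orbit that starts from x_0 > A contracts geometrically, by the factor m,
    as long as it is above Z; once below Z it follows the iterates of Q from Z
    after a delay n2. If it is still above Z at time k, about n/2, this gives
    m^k x_0. Otherwise let J <= k be the first time at which it is below Z, so
    that x_n is at most the iterate of order n - n2 - J while x_0 > Z m^(1 - J).
    To compare, take mu with m < mu < sqrt m such that near 0 either
    Q(y) <= mu y or Q(y) >= mu y. In the first case the iterates decay at least
    as fast as mu^n, which is smaller than m^(n/2). In the second one, having
    lost J steps multiplies the iterates by at most mu^(1 - J) <= m^(1 - J),
    which is at most x_0/Z <= x_0/A. *)
Lemma large_data_decay m (Z A : R) (n2 : nat) : 0 < m < 1 -> 0 < A <= Z ->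
  exists N, forall n, (N <= n)%N -> forall x, (forall n, 0 <= x n) ->
    (forall n, x n.+1 <= x n) ->
    (forall j, Z < x j -> x j.+1 <= m * x j) ->
    (forall j i, x j <= Z -> x (j + n2 + i)%N <= iter i Q Z) ->
    A < x 0%N ->
    x n <= x 0%N / A * iter (n - n2.+1) Q Z \/ x n <= m ^+ (uphalf n) * x 0%N.
Proof.
move=> /andP[m0 m1] /andP[A0 AZ]; have Z0 : 0 < Z by exact: lt_le_trans AZ.
have ms : m < Num.sqrt m.
  rewrite -[X in X < _]ger0_norm ?ltW// -sqrtr_sqr ltr_sqrt//.
  by rewrite expr2 gtr_pMr.
have [mu [d [/andP[mmu mus] d0 dich]]] := decay_linear_dichotomy decQ ms.
have mu0 : 0 < mu by exact: lt_trans mmu.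
have mu2 : mu ^+ 2 < m.
  by rewrite -(sqr_sqrtr (ltW m0)) ltr_pXn2r// ?nnegrE ?sqrtr_ge0// ltW.
have [N0 HN0] := iter_decay_small decQ (ltW Z0) d0.
have [K0 HK0] : exists K0, forall k, (K0 <= k)%N ->
    (mu ^+ 2 / m) ^+ k <= mu ^+ (n2 + N0 + 2) * (Z / d).
  apply: expr_small; first by rewrite divr_ge0 ?exprn_ge0 ?ltW//= ltr_pdivrMr// mul1r.
  by rewrite mulr_gt0 ?exprn_gt0// divr_gt0.
exists (2 * (K0 + n2 + N0 + 2))%N => n Nn x x0 dx geo fast Ax.
have := uphalf_bounds n; set k := uphalf n => kn.
have kn' : (k <= n)%N by clear -kn Nn; lia.
have x00 : 0 < x 0%N by exact: lt_trans Ax.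
have [[j jk xj]|no] := pselect (exists2 j, (j <= k)%N & x j <= Z); last first.
  right; apply: (@le_trans _ _ (x k)); first exact: nincr_seq_le.
  apply: (@geometric_seq_le x m Z) => //; first exact: ltW.
  move=> j jk; rewrite ltNge; apply/negP => xj; apply: no; exists j => //.
  exact: ltnW.
have exJ : exists j, (j <= k)%N && (x j <= Z) by exists j; rewrite jk.
case: (ex_minnP exJ) => J /andP[Jk xJ] Jmin {j jk xj exJ}.
have before i : (i < J)%N -> Z < x i.
  move=> iJ; rewrite ltNge; apply/negP => xi.
  have := Jmin i; rewrite xi (ltnW (leq_trans iJ Jk)) => /(_ isT).
  by rewrite leqNgt iJ.
have xn : x n <= iter (n - n2 - J) Q Z.
  have := fast J (n - n2 - J)%N xJ.
  by rewrite (_ : (J + n2 + (n - n2 - J))%N = n)//; clear -kn Nn Jk; lia.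
have an0 i : 0 <= iter i Q Z by apply: iter_decay_ge0 => //; exact: ltW.
have xA1 : 1 <= x 0%N / A by rewrite ler_pdivlMr// mul1r ltW.
(* For J <= 1 the delay n2.+1 covers the lost steps, and x_0 / A >= 1. *)
have [J1|J1] := leqP J 1.
  left; apply: (le_trans xn).
  apply: (@le_trans _ _ (iter (n - n2.+1) Q Z)).
    by apply: iter_decay_nincr => //; [exact: ltW|clear -kn Nn J1; lia].
  by rewrite ler_peMl.
have Zx : Z < m ^+ J.-1 * x 0%N.
  apply: (@lt_le_trans _ _ (x J.-1)); first by apply: before; clear -J1; lia.
  apply: (@geometric_seq_le x m Z) => //; first exact: ltW.
  by move=> i iJ; apply: before; clear -iJ; lia.
have ZxV : 1 <= m ^+ J.-1 * (x 0%N / Z).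
  by rewrite mulrA ler_pdivlMr// mul1r ltW.
(* First the case Q y <= mu * y near 0. *)
case: dich => dich.
  right.
  have Na : (n - n2 - J = N0 + (n - n2 - J - N0))%N by clear -kn Nn Jk; lia.
  have ai : iter (n - n2 - J) Q Z <= mu ^+ (n - n2 - J - N0) * d.
    rewrite {1}Na; apply: (@iter_decay_le_geometric mu d N0) => //; exact: ltW.
  apply: (le_trans xn); apply: (le_trans ai).
  apply: (@le_trans _ _ (m ^+ J.-1 * (x 0%N / Z) * (mu ^+ (n - n2 - J - N0) * d))).
    by rewrite ler_peMl// mulr_ge0 ?exprn_ge0 ?ltW.
  apply: (@le_trans _ _ (mu ^+ J.-1 * (x 0%N / Z) * (mu ^+ (n - n2 - J - N0) * d))).
    rewrite ler_wpM2r//; first by rewrite mulr_ge0 ?exprn_ge0 ?ltW.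
    rewrite ler_wpM2r//; first by rewrite divr_ge0 ?ltW.
    by apply: lerXn2r; rewrite ?nnegrE ?ltW.
  have -> : mu ^+ J.-1 * (x 0%N / Z) * (mu ^+ (n - n2 - J - N0) * d) =
      mu ^+ (n - n2 - N0 - 1) * (d / Z) * x 0%N.
    have -> : (n - n2 - N0 - 1 = J.-1 + (n - n2 - J - N0))%N by clear -kn Nn Jk J1; lia.
    by rewrite exprD; field; exact: lt0r_neq0.
  rewrite ler_wpM2r//.
  have mu1 : mu <= 1.
    apply/ltW/(lt_trans mus); rewrite -[X in _ < X]sqrtr1 ltr_sqrt//.
  have kE : (n - n2 - N0 - 1 >= k.*2 - (n2 + N0 + 2))%N by clear -kn Nn; lia.
  apply: (@le_trans _ _ (mu ^+ (k.*2 - (n2 + N0 + 2)) * (d / Z))).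
    rewrite ler_wpM2r//; first by rewrite divr_ge0 ?ltW.
    by apply: ler_wiXn2l => //; exact: ltW.
  have Kk : (K0 <= k)%N by clear -kn Nn; lia.
  have := HK0 k Kk; rewrite expr_div_n -exprM mul2n ler_pdivrMr ?exprn_gt0//.
  have {1}-> : (k.*2 = (n2 + N0 + 2) + (k.*2 - (n2 + N0 + 2)))%N by clear -kn Nn; lia.
  rewrite exprD -!mulrA ler_pM2l ?exprn_gt0// => h.
  apply: (@le_trans _ _ (Z / d * m ^+ k * (d / Z))).
    rewrite ler_wpM2r//; first by rewrite divr_ge0 ?ltW.
    by rewrite -mulrA.
  by rewrite le_eqVlt; apply/orP; left; apply/eqP; field; rewrite !lt0r_neq0.
(* Now the case mu * y <= Q y near 0. *)
left; apply: (le_trans xn).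
apply: (@le_trans _ _ (m ^+ J.-1 * (x 0%N / Z) * iter (n - n2 - J) Q Z)).
  by rewrite ler_peMl.
apply: (@le_trans _ _ ((x 0%N / Z) * (mu ^+ J.-1 * iter (n - n2 - J) Q Z))).
  rewrite mulrAC mulrC ler_wpM2l//; first by rewrite divr_ge0 ?ltW.
  by rewrite ler_wpM2r//; apply: lerXn2r; rewrite ?nnegrE ?ltW.
have h : mu ^+ J.-1 * iter (n - n2 - J) Q Z <= iter (n - n2.+1) Q Z.
  have -> : (n - n2.+1 = n - n2 - J + J.-1)%N by clear -kn Nn Jk J1; lia.
  apply: (@iter_decay_ge_geometric mu d N0) => //; [exact: ltW|exact: ltW|clear -kn Nn Jk; lia].
apply: ler_pM => //.
- by rewrite divr_ge0 ?ltW.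
- by rewrite mulr_ge0// exprn_ge0// ltW.
- by rewrite ler_pM2l// lef_pV2 ?posrE.
Qed.

End sequences.

(** * From orbits to windows, and class KL functions *)

Section dynamics.
Context {R : realType}.
Local Notation mu := (@lebesgue_measure R).
Implicit Types (Sigma : set (R * R)) (g Q : R -> R) (q : \bar R).

Lemma in_window0 (s : R) : window 0 s <-> -1 < s < 1.
Proof. by rewrite /window/= in_itv/= sub0r add0r. Qed.

Lemma truncn_window (t : R) : 0 <= t ->
  2 * (Num.truncn (t / 2))%:R <= t /\ t <= 2 * (Num.truncn (t / 2)).+1%:R.
Proof.
move=> t0; have h : 0 <= t / 2 by lra.
have /andP[h1 h2] := truncn_itv h.
by split; lra.
Qed.

Lemma profile_shift Sigma g (c : R) : 0 <= c -> profile Sigma g ->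
  profile Sigma (fun s => g (c + s)).
Proof.
move=> c0 [mg H]; split.
  have := measurable_fun_affine (b := false) (c := c) measurable_profile_domain mg.
  have -> : (fun x => g (affine false c x)) = (fun s => g (c + s)).
    by apply/funext => x; rewrite affineF.
  move=> mgc; apply: measurable_funS mgc.
    rewrite -[X in measurable X]setTI; apply: measurable_affine => //.
    exact: measurable_profile_domain.
  move=> s; rewrite /= affineF /profile_domain /= !in_itv/= !andbT => s1; lra.
have := ae_shift c H; apply: ae_mono => s Hs s1.
have s1' : -1 < c + s by lra.
by have := Hs s1'; rewrite -addrA.
Qed.

(** The largest even integer 2n below t brings the window at t back to the
    initial one, by monotonicity of the energy and a translation. *)
Lemma window_bound Sigma g q (t c1 c2 : R) (n : nat) :
  damping_set Sigma -> profile Sigma g -> (1 <= q)%E ->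
  2 * n%:R <= t -> 0 <= c1 -> 0 <= c2 ->
  {ae mu, forall s, -1 < s < 1 -> `|g (s + 2 * n%:R)| <= c1 + c2 * `|g s|} ->
  (norm_on (window t) q g <=
     c1%:E * norm_on (window 0) q (cst 1%R) + c2%:E * norm_on (window 0) q g)%E.
Proof.
move=> ds pr q1 nt c10 c20 H; have dg := profile_decay ds pr; have [mg _] := pr.
have n0 : 0 <= 2 * n%:R :> R by rewrite mulr_ge0.
apply: le_trans (norm_on_window_le q1 mg dg n0 nt) _.
have mw (u : R) : 0 <= u -> measurable_fun (window u) g.
  by move=> u0; exact: (measurable_funS measurable_profile_domain (window_sub u0) mg).
have e : 2 * n%:R = 2 * n%:R + 0 :> R by rewrite addr0.
rewrite {1}e window_shift//; last by rewrite -e; exact: mw.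
have [mgn _] := profile_shift n0 pr.
apply: norm_on_affine_bound => //.
- exact: measurable_window.
- exact: (measurable_funS measurable_profile_domain (window_sub (lexx 0)) mgn).
- exact: mw.
- by move: H; apply: ae_mono => s H /in_window0 s1; rewrite addrC; exact: H.
Qed.

(** Here 2n is above t, again by monotonicity of the energy. *)
Lemma window_lower Sigma g q (t c : R) (n : nat) (E : set R) :
  damping_set Sigma -> profile Sigma g -> (1 <= q)%E ->
  0 <= t -> t <= 2 * n%:R -> 0 <= c -> measurable E -> E `<=` window 0 ->
  {ae mu, forall s, E s -> c <= `|g (s + 2 * n%:R)|} ->
  ((c * Num.min 1 (fine (mu E)))%:E <= norm_on (window t) q g)%E.
Proof.
move=> ds pr q1 t0 tn c0 mE EW H.
have dg := profile_decay ds pr; have [mg _] := pr.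
have n0 : 0 <= 2 * n%:R :> R by rewrite mulr_ge0.
apply: le_trans (norm_on_window_le q1 mg dg t0 tn).
have e : 2 * n%:R = 2 * n%:R + 0 :> R by rewrite addr0.
have mw (u : R) : 0 <= u -> measurable_fun (window u) g.
  by move=> u0; exact: (measurable_funS measurable_profile_domain (window_sub u0) mg).
rewrite {1}e window_shift//; last by rewrite -e; exact: mw.
have [mgn _] := profile_shift n0 pr.
apply: norm_on_ge_mass => //.
- exact: measurable_window.
- exact: (measurable_funS measurable_profile_domain (window_sub (lexx 0)) mgn).
- have : (mu E <= mu (window (0 : R)))%E.
    by apply: le_measure; rewrite ?inE//; exact: measurable_window.
  rewrite measure_window => h.
  by rewrite ge0_fin_numE//; apply: (le_lt_trans h); exact: ltry.
- by move: H; apply: ae_mono => s H Es; rewrite addrC; exact: H.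
Qed.

(** This is where the bound M / sqrt 2 on the initial data comes from. *)
Lemma euclidean_ball_small (M x y : R) : 0 < M -> `|y| <= `|x| ->
  `|x| <= M / Num.sqrt 2 -> euclidean_ball M (x, y).
Proof.
move=> M0 yx xM; rewrite /euclidean_ball/=.
have e : M = Num.sqrt (M ^+ 2) by rewrite sqrtr_sqr gtr0_norm.
rewrite [leRHS]e ler_sqrt ?sqr_ge0//.
have s2 := @sqrt2_gt0 R.
have h : (M / Num.sqrt 2) * (M / Num.sqrt 2) = M ^+ 2 / 2.
  by rewrite mulrACA -invfM sqrt2_sqr expr2.
have h1 : x ^+ 2 <= M ^+ 2 / 2.
  by rewrite -h -real_normK ?num_real// expr2 ler_pM.
have h2 : y ^+ 2 <= x ^+ 2.
  by rewrite -(real_normK (num_real x)) -(real_normK (num_real y)) !expr2 ler_pM.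
lra.
Qed.

Lemma not_euclidean_ball (M x y : R) : 0 < M -> M < `|x| ->
  ~ euclidean_ball M (x, y).
Proof.
move=> M0 Mx; rewrite /euclidean_ball/= => h.
have : `|x| <= Num.sqrt (x ^+ 2 + y ^+ 2).
  by rewrite -sqrtr_sqr ler_sqrt ?lerDl ?addr_ge0 ?sqr_ge0.
by move=> /le_trans/(_ h); rewrite leNgt Mx.
Qed.

Section local_decay.
Variables (Sigma : set (R * R)) (M0 : R) (Q g : R -> R).
Hypotheses (ds : damping_set Sigma) (M00 : 0 < M0) (decQ : decay_function Q).
Hypothesis near0 : forall x y : R,
  (rotation @` Sigma `&` euclidean_ball M0) (x, y) -> `|y| <= Q `|x|.
Hypothesis pr : profile Sigma g.

Lemma orbit_facts : {ae mu, forall s, -1 < s -> forall n : nat,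
  `|g (s + 2 * n.+1%:R)| <= `|g (s + 2 * n%:R)| /\
  (`|g (s + 2 * n%:R)| <= M0 / Num.sqrt 2 ->
   `|g (s + 2 * n.+1%:R)| <= Q `|g (s + 2 * n%:R)|)}.
Proof.
have [_ rel] := pr; have := orbit_ae (P := fun x y => (rotation @` Sigma) (x, y)) rel.
apply: ae_mono => s H s1 n; have Hn := H s1 n.
have d := rotation_damping ds Hn; split => // small.
by apply: near0; split => //; exact: euclidean_ball_small.
Qed.

Lemma infty_decay (c t : R) : 0 <= t -> c <= M0 / Num.sqrt 2 ->
  (norm_on (window 0) +oo g <= c%:E)%E ->
  (norm_on (window t) +oo g <= (iter (Num.truncn (t / 2)) Q c)%:E)%E.
Proof.
move=> t0 cM gc.
have c0 : 0 <= c by rewrite -lee_fin; exact: le_trans (norm_on_ge0 _ _ _) gc.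
have /norm_on_ooP gc' := gc.
set n := Num.truncn (t / 2).
have n0 : 0 <= iter n Q c by exact: iter_decay_ge0.
have [nt _] := truncn_window t0; rewrite -/n in nt.
have B : {ae mu, forall s, -1 < s < 1 ->
    `|g (s + 2 * n%:R)| <= iter n Q c + 0 * `|g s|}.
  move: orbit_facts (gc' c0); apply: ae_mono2 => s O G /[dup] s11 /andP[s1 _].
  have F := O s1; have Gs := G ((in_window0 s).2 s11).
  rewrite mul0r addr0.
  apply: (@seq_le_iter R Q decQ (fun n => `|g (s + 2 * n%:R)|) (M0 / Num.sqrt 2) c 0 n) => //.
  - by move=> k; have [] := F k.
  - by move=> k; have [] := F k.
  - by rewrite mulr0 addr0; apply: le_trans cM; exact: Gs.
  - by rewrite mulr0 addr0; exact: Gs.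
have := window_bound ds pr (leey _) nt n0 (lexx 0) B.
rewrite mul0e adde0 => /le_trans; apply.
rewrite -[leRHS]mule1; apply: lee_pmul => //.
- exact: norm_on_ge0.
- by apply/norm_on_ooP => //; apply: aeW => s _; rewrite normr1.
Qed.

End local_decay.

Section kl.
Variable beta : R -> R -> R.
Hypothesis kl : class_KL beta.

Lemma KL_homo (x y t : R) : 0 <= t -> 0 <= x -> x <= y -> beta x t <= beta y t.
Proof.
have [_ _ H _] := kl => t0 x0; rewrite le_eqVlt => /predU1P[->//|xy].
by apply/ltW; have [_] := H t t0; apply.
Qed.

Lemma KL_small (x e : R) : 0 <= x -> 0 < e ->
  exists n : nat, beta x (2 * n%:R) <= e.
Proof.
move=> + e0; have [_ _ H0 H] := kl.
rewrite le_eqVlt => /predU1P[<-|x0].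
  by exists 0%N; rewrite mulr0 (H0 0 (lexx 0)).1 ltW.
have [_ /cvgrPdist_le /(_ _ e0) [T [_ HT]]] := H _ x0.
exists (Num.truncn (Num.max T 0)).+1.
have Tn : T < 2 * (Num.truncn (Num.max T 0)).+1%:R.
  apply: (@le_lt_trans _ _ (Num.max T 0)); first by rewrite le_max lexx.
  have := truncnS_gt (Num.max T 0).
  have : 0 <= Num.max T 0 by rewrite le_max lexx orbT.
  lra.
by have := HT _ Tn; rewrite sub0r normrN; apply: le_trans (ler_norm _).
Qed.

Lemma KL_continuous_time (x T : R) : 0 <= x ->
  {within `[0, T], continuous (beta x)}.
Proof.
have [C _ _ _] := kl => x0; apply/subspace_continuousP => t.
rewrite /= in_itv/= => /andP[t0 tT].
move/subspace_continuousP : C => /(_ (x, t) (conj x0 t0)) C.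
apply: (@cvg_comp _ _ _ (fun u : R => (x, u)) (fun xt : R * R => beta xt.1 xt.2)
  _ _ _ _ C).
move=> A [[U V] /= [nU nV] UV].
change (nbhs t [set u | `[0, T]%classic u -> A (x, u)]).
apply: filterS nV => u Vu; rewrite /= in_itv/= => /andP[u0 _].
by apply: UV => /=; [split => //=; exact: nbhs_singleton|split].
Qed.

(** For x > 0, beta decreases strictly in time, so that a time at which it
    equals c is the first one; there is one by the intermediate value theorem,
    since beta tends to 0. For x = 0 the time is 0. *)
Lemma KL_first_time (x c : R) : 0 <= x -> 0 <= c -> (0 < x -> 0 < c) ->
  c <= x -> x <= beta x 0 -> exists tz, first_time (beta x) c tz.
Proof.
move=> x0 c0 cpos cx xb; have [_ bge0 H0 H] := kl.
have [xe|xN] := eqVneq x 0.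
  exists 0; split => //; last by move=> s s0 /lt_le_trans/(_ s0); rewrite ltxx.
  rewrite xe (H0 0 (lexx 0)).1; apply/eqP; rewrite eq_le c0/=.
  by rewrite -xe.
have {x0} x0 : 0 < x by rewrite lt_neqAle eq_sym xN.
have c1 := cpos x0.
have [n hn] := @KL_small x (c / 2) (ltW x0) (divr_gt0 c1 (ltr0n R 2)).
have n0 : 0 <= 2 * n%:R :> R by rewrite mulr_ge0.
have cont := @KL_continuous_time x (2 * n%:R) (ltW x0).
have ge : beta x (2 * n%:R) <= beta x 0.
  by apply: (le_trans hn); apply: le_trans (le_trans cx xb); lra.
have bnds : Num.min (beta x 0) (beta x (2 * n%:R)) <= c <=
    Num.max (beta x 0) (beta x (2 * n%:R)).
  rewrite min_r// max_l//; apply/andP; split; last exact: le_trans xb.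
  by apply: (le_trans hn); lra.
have [tz] := IVT n0 cont bnds.
rewrite in_itv/= => /andP[tz0 _] E; exists tz; split => // s s0 st.
by have [dec _] := H _ x0; have := dec s tz s0 st; rewrite E => /gt_eqF/eqP.
Qed.

End kl.

End dynamics.

(** * From uniform stability to decay along each orbit *)

Section truncation.
Context {R : realType}.
Local Notation mu := (@lebesgue_measure R).
Implicit Types (Sigma : set (R * R)) (g : R -> R).

(** The times that belong to an orbit starting in ]-1, 1[ from a value at most
    K in modulus; affine false (- (2 n)) sends a time to the one that precedes it
    by n steps. *)
Definition small_orbits g (K : R) : set R :=
  \bigcup_(n : nat) (affine false (- (2 * n%:R)) @^-1`
    (`]-1, 1[ `&` g @^-1` [set y | `|y| <= K])).

Lemma small_orbitsP g K s : small_orbits g K s <->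
  exists n : nat, -1 < s - 2 * n%:R < 1 /\ `|g (s - 2 * n%:R)| <= K.
Proof.
split => [[n _ /=]|[n [h1 h2]]].
  by rewrite affineF in_itv/= addrC => -[? ?]; exists n.
by exists n => //=; rewrite affineF in_itv/= addrC.
Qed.

Lemma measurable_small_orbits g K : measurable_fun profile_domain g ->
  measurable (small_orbits g K).
Proof.
move=> mg; apply: bigcupT_measurable => n.
rewrite -[X in measurable X]setTI; apply: measurable_affine => //.
have mI : measurable (`]-1, 1[%classic : set R) by exact: measurable_itv.
have mg1 : measurable_fun (`]-1, 1[%classic : set R) g.
  apply: (measurable_funS measurable_profile_domain _ mg).
  by move=> s; rewrite /profile_domain/= !in_itv/= andbT => /andP[].
apply: mg1 => //.
have -> : [set y : R | `|y| <= K] = `[- K, K]%classic.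
  by apply/seteqP; split => y /=; rewrite in_itv/= ler_norml.
exact: measurable_itv.
Qed.

Lemma small_orbits_shift g K s : -1 < s ->
  small_orbits g K (s + 2) <-> small_orbits g K s.
Proof.
move=> s1; split => /small_orbitsP [n [h1 h2]]; apply/small_orbitsP.
  case: n h1 h2 => [|n]; first by rewrite mulr0 subr0 => /andP[]; lra.
  rewrite -[n.+1%:R]natr1 => h1 h2; exists n.
  have e : s + 2 - 2 * (n%:R + 1) = s - 2 * n%:R by ring.
  by rewrite e in h1 h2.
exists n.+1; rewrite -[n.+1%:R]natr1.
by have -> : s + 2 - 2 * (n%:R + 1) = s - 2 * n%:R by ring.
Qed.

(** The set of times is a union of whole orbits, and (0, 0) belongs to the
    rotated set: replacing some orbits by zero gives a profile. *)
Lemma profile_truncation Sigma g K : damping_set Sigma -> profile Sigma g ->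
  profile Sigma (g \_ (small_orbits g K)).
Proof.
move=> [S0 _ _] [mg rel]; have mA := measurable_small_orbits K mg.
split.
  apply/(measurable_restrict _ mA measurable_profile_domain).
  apply: (measurable_funS measurable_profile_domain _ mg); exact: subIsetl.
move: rel; apply: ae_mono => s H s1; rewrite !patchE.
have [sA|sA] := pselect (small_orbits g K s).
  rewrite !mem_set//; first exact: H.
  exact/small_orbits_shift.
rewrite !memNset//; last by move=> /(small_orbits_shift _ _ s1).
by exists (0, 0) => //; rewrite /rotation/= oppr0 addr0 mul0r.
Qed.

(** Uniform stability only bounds a supremum over all orbits. Applied to the
    profile in which the orbits starting above K are replaced by zero, whose
    initial norm is at most K, it bounds each of the remaining orbits. *)
Lemma ugas_pointwise Sigma (beta : R -> R -> R) g (K : R) (n : nat) :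
  damping_set Sigma -> UGAS_with_rate Sigma +oo beta -> profile Sigma g ->
  0 <= K ->
  {ae mu, forall s, -1 < s < 1 -> `|g s| <= K ->
    `|g (s + 2 * n%:R)| <= beta K (2 * n%:R)}.
Proof.
move=> ds [kl ug] pr K0; have prT := profile_truncation K ds pr.
set gT := g \_ _ in prT.
have TK : {ae mu, forall s, -1 < s < 1 -> `|gT s| <= K}.
  apply: aeW => s /andP[s1 s2]; rewrite /gT patchE.
  case: ifPn => [/set_mem /small_orbitsP [[|k] [h1 h2]]|_].
  - by move: h2; rewrite mulr0 subr0.
  - by move: h1; rewrite -[k.+1%:R]natr1 => /andP[h _]; have := ler0n R k; lra.
  - by rewrite normr0.
have [z0 [z1 [z [f sol]]]] := profile_solution K0 ds prT TK.
have n0 : 0 <= 2 * n%:R :> R by rewrite mulr_ge0.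
have := ug _ _ _ _ _ sol _ n0.
rewrite (energyE (leey _) sol (leey _) n0) (energyE (leey _) sol (leey _) (lexx 0)).
have w0 : (norm_on (window 0) +oo gT <= K%:E)%E.
  apply/norm_on_ooP => //; move: TK; apply: ae_mono => s H /in_window0; exact: H.
have w0' := norm_on_ge0 (window 0) +oo gT.
set e := norm_on (window 0) +oo gT in w0 w0' *.
have fe : e \is a fin_num by rewrite ge0_fin_numE// (le_lt_trans w0)// ltry.
have eK : fine e <= K by rewrite -lee_fin fineK.
have bK : beta (fine e) (2 * n%:R) <= beta K (2 * n%:R).
  by apply: KL_homo => //; exact: fine_ge0.
move=> h; have {}h : (norm_on (window (2 * n%:R)) +oo gT <= (beta K (2 * n%:R))%:E)%E.
  by apply: (le_trans h); rewrite lee_fin.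
have b0 : 0 <= beta K (2 * n%:R) by have [_ H _ _] := kl; exact: H.
have H := (norm_on_ooP _ _ b0).1 h.
have := ae_shift (2 * n%:R) H; apply: ae_mono => s Hs /[dup] s11 /andP[s1 s2] gs.
have := Hs _; rewrite /gT patchE mem_set; last first.
  apply/small_orbitsP; exists n.
  by have -> : 2 * n%:R + s - 2 * n%:R = s by ring.
rewrite (addrC _ s); apply.
by rewrite /window/= in_itv/=; apply/andP; split; lra.
Qed.

(** The equation is autonomous: the previous bound applies from any time j. *)
Lemma ugas_orbit Sigma (beta : R -> R -> R) g (K : R) (n : nat) :
  damping_set Sigma -> UGAS_with_rate Sigma +oo beta -> profile Sigma g ->
  0 <= K ->
  {ae mu, forall s, -1 < s < 1 -> forall j : nat, `|g (s + 2 * j%:R)| <= K ->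
    `|g (s + 2 * (j + n)%:R)| <= beta K (2 * n%:R)}.
Proof.
move=> ds ug pr K0.
have : {ae mu, forall s, forall j : nat, -1 < s < 1 -> `|g (s + 2 * j%:R)| <= K ->
    `|g (s + 2 * (j + n)%:R)| <= beta K (2 * n%:R)}.
  apply: ae_foralln => j; have j0 : 0 <= 2 * j%:R :> R by rewrite mulr_ge0.
  have := ugas_pointwise n ds ug (profile_shift j0 pr) K0.
  apply: ae_mono => s H s1; have := H s1.
  have -> : 2 * j%:R + (s + 2 * n%:R) = s + 2 * (j + n)%:R by rewrite natrD; ring.
  by rewrite (addrC _ s).
by apply: ae_mono => s H s1 j; exact: H.
Qed.

(** The set where 0 < |h| <= B is the increasing union of the sets where
    1/(k + 1) <= |h| <= B. *)
Lemma positive_mass (h : R -> R) (B : R) :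
  measurable_fun (`]-1, 1[%classic : set R) h ->
  ~ {ae mu, forall s, -1 < s < 1 -> ~ (0 < `|h s| <= B)} ->
  exists2 c, 0 < c &
    let E := [set s | -1 < s < 1 /\ c <= `|h s| <= B] in
    measurable E /\ 0 < fine (mu E).
Proof.
move=> mh H.
pose c (k : nat) : R := k.+1%:R^-1.
pose E k := [set s | -1 < s < 1 /\ c k <= `|h s| <= B].
have mE k : measurable (E k).
  have -> : E k = `]-1, 1[%classic `&` (fun s => `|h s|) @^-1` `[c k, B]%classic.
    by apply/seteqP; split => s /=; rewrite !in_itv.
  have mI : measurable (`]-1, 1[%classic : set R) by exact: measurable_itv.
  have mn : measurable_fun (`]-1, 1[%classic : set R) (fun s => `|h s|).
    exact: measurableT_comp.
  by apply: mn => //; exact: measurable_itv.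
have [k Ek] : exists k, mu (E k) != 0%E.
  apply: contrapT => nk; apply: H.
  have : {ae mu, forall s, forall k, ~ E k s}.
    apply: ae_foralln => k; apply: measure0_ae_not => //.
    by apply/eqP/negPn/negP => Ek; apply: nk; exists k.
  apply: ae_mono => s Hs s1 /andP[h0 hB].
  (* An index k with 1/(k + 1) <= |h s|. *)
  apply: (Hs (Num.truncn (`|h s|^-1))); split => //; rewrite hB andbT /c.
  rewrite -[leRHS]invrK lef_pV2 ?posrE ?ltr0n ?invr_gt0//.
  exact/ltW/truncnS_gt.
exists (c k); first by rewrite invr_gt0 ltr0n.
split; first exact: mE.
have le : (mu (E k) <= mu (window (0 : R)))%E.
  apply: le_measure; rewrite ?inE; [exact: mE|exact: measurable_window|].
  by move=> s [s1 _]; apply/in_window0.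
rewrite measure_window in le.
rewrite fine_gt0// (le_lt_trans le) ?ltry// andbT.
by rewrite lt0e Ek measure_ge0.
Qed.

End truncation.

(** * Upper bounds for profiles *)

Section upper_bounds.
Context {R : realType}.
Local Notation mu := (@lebesgue_measure R).
Variables (Sigma : set (R * R)) (M0 : R) (Q g : R -> R).
Hypotheses (ds : damping_set Sigma) (M00 : 0 < M0) (decQ : decay_function Q).
Hypothesis near0 : forall x y : R,
  (rotation @` Sigma `&` euclidean_ball M0) (x, y) -> `|y| <= Q `|x|.
Hypothesis pr : profile Sigma g.

Lemma norm_window_trivial (q : \bar R) (t : R) : (1 <= q)%E -> 0 <= t ->
  (norm_on (window t) q g <= norm_on (window 0) q g)%E.
Proof.
move=> q1 t0; have [mg _] := pr.
by apply: norm_on_window_le => //; exact: profile_decay ds pr.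
Qed.

Lemma bounded_norm_fin (K r : R) : 0 <= K -> 1 <= r ->
  {ae mu, forall s, -1 < s < 1 -> `|g s| <= K} ->
  norm_on (window 0) r%:E g \is a fin_num.
Proof.
move=> K0 r1 H; rewrite ge0_fin_numE ?norm_on_ge0//.
have H' : {ae mu, forall s, -1 < s < 1 -> `|g (s + 2 * 0%:R)| <= K + 0 * `|cst 0%R s : R|}.
  by move: H; apply: ae_mono => s H s1; rewrite mulr0 addr0 mul0r addr0; exact: H.
have mg0 : measurable_fun (window 0) g.
  by have [mg _] := pr; exact: (measurable_funS measurable_profile_domain (window_sub (lexx 0)) mg).
have := @norm_on_affine_bound R (window 0) r%:E K 0 g (cst 0) r1
  (measurable_window _) mg0 (measurable_cst _) K0 (lexx 0).
rewrite mul0e adde0 => h.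
apply: (@le_lt_trans _ _ (K%:E * norm_on (window 0) r%:E (cst 1%R))%E).
  apply: h; move: H; apply: ae_mono => s H /in_window0 s1.
  by rewrite mul0r addr0; exact: H.
by rewrite norm_on_cst1_window ?(lt_le_trans _ r1)// -EFinM ltry.
Qed.

(** Let A be the square root of the initial energy Z_p. Orbits starting below A
    are bounded by the iterates from A; the others are bounded by the iterates
    from the maximum B, times |g|/A, which is at least 1 on them. The L^p norm of
    |g|/A is Z_p/A = A. *)
Lemma finite_decay (r t : R) : 1 <= r -> 0 <= t ->
  (norm_on (window 0) +oo g <= (M0 / Num.sqrt 2)%:E)%E ->
  let Z q := fine (norm_on (window 0) q g) in
  is_true (norm_on (window t) r%:E g <=
    (2 `^ r^-1 * iter (Num.truncn (t / 2)) Q (Num.sqrt (Z r%:E)) +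
     Num.sqrt (Z r%:E) * iter (Num.truncn (t / 2)) Q
       (Num.max (Z +oo%E) (Num.sqrt (Z r%:E))))%:E)%E.
Proof.
move=> r1 t0 gM Z.
have r0 : 0 < r by exact: lt_le_trans r1.
have MM : 0 <= M0 / Num.sqrt 2 by rewrite divr_ge0 ?ltW.
have finf : norm_on (window 0) +oo g \is a fin_num.
  by rewrite ge0_fin_numE ?norm_on_ge0// (le_lt_trans gM)// ltry.
have Z0 : 0 <= Z +oo%E by rewrite fine_ge0// norm_on_ge0.
have ZM : Z +oo%E <= M0 / Num.sqrt 2 by rewrite -lee_fin fineK.
have gZ : {ae mu, forall s, window 0 s -> `|g s| <= Z +oo%E}.
  by apply/norm_on_ooP => //; rewrite fineK.
have gZ' : {ae mu, forall s, -1 < s < 1 -> `|g s| <= Z +oo%E}.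
  by move: gZ; apply: ae_mono => s H /in_window0; exact: H.
have fr := bounded_norm_fin Z0 r1 gZ'.
set A := Num.sqrt _; set B := Num.max _ _; set n := Num.truncn _.
have A0 : 0 <= A by exact: sqrtr_ge0.
have B0 : 0 <= B by rewrite le_max Z0.
have i1 : 0 <= iter n Q A by exact: iter_decay_ge0.
have i2 : 0 <= iter n Q B by exact: iter_decay_ge0.
have ZA : Z r%:E = A * A.
  by rewrite -expr2 sqr_sqrtr// fine_ge0// norm_on_ge0.
have [A00|AN0] := eqVneq A 0.
  apply: (le_trans (norm_window_trivial _ t0)) => //.
  rewrite -(fineK fr) -/(Z _) ZA A00 mulr0 lee_fin mul0r addr0.
  by apply: mulr_ge0; [exact: powR_ge0|exact: iter_decay_ge0].
have {AN0} A1 : 0 < A by rewrite lt_neqAle eq_sym AN0.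
have [nt _] := truncn_window t0; rewrite -/n in nt.
have c20 : 0 <= iter n Q B / A by rewrite divr_ge0.
have H : {ae mu, forall s, -1 < s < 1 ->
    `|g (s + 2 * n%:R)| <= iter n Q A + (iter n Q B / A) * `|g s|}.
  move: (orbit_facts ds M00 near0 pr) gZ'; apply: ae_mono2 => s O G.
  move=> /[dup] s11 /andP[s1 _]; have F := O s1; have Gs := G s11.
  pose x (k : nat) := `|g (s + 2 * k%:R)|.
  have x0 : x 0%N = `|g s| by rewrite /x mulr0 addr0.
  have step c : `|g s| <= c -> x n <= iter n Q c.
    move=> gc; apply: (@seq_le_iter R Q decQ x (M0 / Num.sqrt 2) c 0 n) => //.
    - by move=> k; exact: normr_ge0.
    - by move=> k; exact: (F k).1.
    - by move=> k; exact: (F k).2.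
    - by rewrite x0; exact: le_trans ZM.
    - by rewrite x0.
  have [gA|Ag] := leP `|g s| A.
    apply: (le_trans (step _ gA)); rewrite lerDl.
    by rewrite mulr_ge0.
  have gB : `|g s| <= B by rewrite le_max Gs.
  apply: (le_trans (step _ gB)); apply: (@le_trans _ _ (iter n Q B / A * `|g s|)).
    by rewrite mulrAC ler_pdivlMr// ler_wpM2l// ltW.
  by rewrite lerDr.
have := window_bound ds pr (r1 : (1 <= r%:E)%E) nt i1 c20 H.
rewrite norm_on_cst1_window// -(fineK fr) -/(Z _) ZA -!EFinM -EFinD.
move=> h; apply: (le_trans h); rewrite lee_fin mulrC lerD2l.
by rewrite mulrA mulfVK ?gt_eqF// mulrC.
Qed.

Section global.
Variables (M m : R) (beta : R -> R -> R) (tau : R -> nat).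
Hypotheses (M_gt0 : 0 < M) (m01 : 0 < m < 1).
Hypothesis far : forall x y : R,
  (rotation @` Sigma `\` euclidean_ball M) (x, y) -> `|y| <= m * `|x|.
Hypothesis ug : UGAS_with_rate Sigma +oo beta.
Hypothesis tauP : forall K, 0 <= K -> beta K (2 * (tau K)%:R) <= M0 / Num.sqrt 2.

Lemma orbit_far : {ae mu, forall s, -1 < s -> forall n : nat,
  M < `|g (s + 2 * n%:R)| ->
  `|g (s + 2 * n.+1%:R)| <= m * `|g (s + 2 * n%:R)|}.
Proof.
have [_ rel] := pr; have := orbit_ae (P := fun x y => (rotation @` Sigma) (x, y)) rel.
apply: ae_mono => s H s1 n Mx; apply: far; split; first exact: H.
exact: not_euclidean_ball.
Qed.

(** Uniform stability brings the orbit below M0 / sqrt 2 after tau K steps,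
    where Q takes over. *)
Lemma orbit_fast (K : R) : 0 <= K -> {ae mu, forall s, -1 < s < 1 ->
  forall j i : nat, `|g (s + 2 * j%:R)| <= K ->
    `|g (s + 2 * (j + tau K + i)%:R)| <= iter i Q K}.
Proof.
move=> K0; move: (ugas_orbit (tau K) ds ug pr K0) (orbit_facts ds M00 near0 pr).
apply: ae_mono2 => s U O /[dup] s11 /andP[s1 _] j i xj; have F := O s1.
pose x (k : nat) := `|g (s + 2 * k%:R)|.
apply: (@seq_le_iter R Q decQ x (M0 / Num.sqrt 2) K (j + tau K) i) => //.
- by move=> k; exact: normr_ge0.
- by move=> k; exact: (F k).1.
- by move=> k; exact: (F k).2.
- by apply: le_trans (tauP K0); exact: U.
- apply: le_trans xj; apply: (@nincr_seq_le R x); last exact: leq_addr.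
  by move=> k; exact: (F k).1.
Qed.

(** n = truncn (t/2) exceeds t/2 - 1, and uphalf n is at least n/2. *)
Lemma powR_uphalf (t : R) : 0 <= t ->
  m ^+ uphalf (Num.truncn (t / 2)) <= m `^ (t / 4 - 2^-1).
Proof.
move=> t0; have /andP[m0 m1] := m01.
have [_ tn] := truncn_window t0.
set n := Num.truncn _ in tn *.
rewrite -powR_mulrn ?(ltW m0)//; apply: ger_powR; first by rewrite m0 ltW.
have /andP[nk _] := uphalf_bounds n.
have : (n%:R <= (uphalf n).*2%:R :> R) by rewrite ler_nat.
rewrite -mul2n natrM -[n.+1%:R]natr1 in tn *; lra.
Qed.

(** The orbits starting below A = sqrt Z_p are bounded by the iterates from A
    after a delay. On the others, |g|/A >= 1 and the estimate of sequences that
    start above A applies, with a bound proportional to |g|: the L^p norm turns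
    |g|/A into A and |g| into Z_p. *)
Lemma global_decay (q : \bar R) : (1 <= q)%E ->
  norm_on (window 0) q g \is a fin_num ->
  let Zp := fine (norm_on (window 0) q g) in
  let A := Num.sqrt Zp in
  let Z := Num.max M A in
  exists T : R, forall t : R, T <= t ->
   (norm_on (window t) q g <=
    (2 * iter (Num.truncn ((t - 2 * (tau A)%:R) / 2)) Q A +
     2 * A * iter (Num.truncn (t / 2) - (tau Z).+1)%N Q Z +
     Zp * m `^ (t / 4 - 2^-1))%:E)%E.
Proof.
move=> q1 fq Zp A Z; have /andP[m0 m1] := m01.
have A0 : 0 <= A by exact: sqrtr_ge0.
have AZ : A <= Z by rewrite le_max lexx orbT.
have MZ : M <= Z by rewrite le_max lexx.
have Z0 : 0 < Z by rewrite lt_max M_gt0.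
have Zp0 : 0 <= Zp by rewrite fine_ge0// norm_on_ge0.
have ZA : Zp = A * A by rewrite -expr2 sqr_sqrtr.
have [A00|AN0] := eqVneq A 0.
  exists 0 => t t0; apply: (le_trans (norm_window_trivial q1 t0)).
  rewrite -(fineK fq) -/Zp [X in (X%:E <= _)%E]ZA A00 mulr0 lee_fin.
  rewrite mulr0 mul0r addr0; apply: addr_ge0; apply: mulr_ge0 => //.
  - exact: iter_decay_ge0.
  - exact: powR_ge0.
have {AN0} A1 : 0 < A by rewrite lt_neqAle eq_sym AN0.
have [N HN] := @large_data_decay R Q decQ m Z A (tau Z) m01
  (introT andP (conj A1 AZ)).
exists (2 * (N + tau A + 1)%:R) => t tT.
have t0 : 0 <= t by apply: le_trans tT; rewrite mulr_ge0.
have [nt tn] := truncn_window t0; set n := Num.truncn _ in nt tn *.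
have nN : (N + tau A < n.+1)%N.
  by rewrite -(ltr_nat R) -addn1 natrD in tT *; lra.
have nN1 : (N <= n)%N by clear -nN; lia.
have nA : (tau A <= n)%N by clear -nN; lia.
pose a := iter (n - (tau Z).+1) Q Z.
have a0 : 0 <= a by apply: iter_decay_ge0 => //; exact: ltW.
pose c1 := iter (n - tau A) Q A.
have c10 : 0 <= c1 by exact: iter_decay_ge0.
pose c2 := a / A + m ^+ uphalf n.
have c20 : 0 <= c2 by rewrite addr_ge0 ?divr_ge0 ?exprn_ge0// ltW.
have H : {ae mu, forall s, -1 < s < 1 ->
    `|g (s + 2 * n%:R)| <= c1 + c2 * `|g s|}.
  have OO : {ae mu, forall s, -1 < s ->
      (forall k : nat, `|g (s + 2 * k.+1%:R)| <= `|g (s + 2 * k%:R)|) /\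
      forall k : nat, M < `|g (s + 2 * k%:R)| ->
        `|g (s + 2 * k.+1%:R)| <= m * `|g (s + 2 * k%:R)|}.
    move: (orbit_facts ds M00 near0 pr) orbit_far; apply: ae_mono2 => s O F s1.
    by split; [move=> k; exact: (O s1 k).1|exact: F].
  move: OO (orbit_fast A0) (orbit_fast (ltW Z0)).
  apply: ae_mono3 => s OO FA FZ /[dup] s11 /andP[s1 _].
  have [dx geo] := OO s1.
  pose x (k : nat) := `|g (s + 2 * k%:R)|.
  have x0 : x 0%N = `|g s| by rewrite /x mulr0 addr0.
  have [gA|Ag] := leP `|g s| A.
    apply: (@le_trans _ _ c1); last by rewrite lerDl mulr_ge0.
    have := FA s11 0%N (n - tau A)%N; rewrite mulr0 addr0 add0n subnKC//.
    by apply.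
  apply: (@le_trans _ _ (c2 * `|g s|)); last by rewrite lerDr.
  rewrite -x0 in Ag *; rewrite [leRHS]mulrDl.
  have [h|h] := HN n nN1 x (fun k => normr_ge0 _) dx
    (fun j Zx => geo j (le_lt_trans MZ Zx)) (FZ s11) Ag.
  - apply: (le_trans h); rewrite -/a.
    have -> : x 0%N / A * a = a / A * x 0%N by ring.
    rewrite lerDl; apply: mulr_ge0; last exact: normr_ge0.
    by rewrite exprn_ge0// ltW.
  - apply: (le_trans h); rewrite lerDr; apply: mulr_ge0; last exact: normr_ge0.
    by rewrite divr_ge0.
have := window_bound ds pr q1 nt c10 c20 H.
rewrite -(fineK fq) -/Zp => h; apply: (le_trans h).
apply: (@le_trans _ _ ((c1 * 2)%:E + (c2 * Zp)%:E)%E).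
  rewrite EFinM -EFinM; apply: leeD => //.
  by rewrite EFinM lee_wpmul2l ?lee_fin//; exact: norm_on_cst1_le2.
rewrite -EFinD lee_fin mulrDl addrA; apply: lerD; last first.
  by rewrite mulrC ler_wpM2l// /n; exact: powR_uphalf.
apply: lerD.
  rewrite mulrC ler_wpM2l//; apply: iter_decay_nincr => //.
  have y0 : 0 <= (t - 2 * (tau A)%:R) / 2.
    rewrite -addn1 !natrD in tT; have := ler0n R N; lra.
  have /andP[y1 _] := truncn_itv y0.
  rewrite -ltnS -(ltr_nat R); apply: (le_lt_trans y1).
  rewrite -[(n - tau A).+1%:R]natr1 natrB//.
  have tn' := truncnS_gt (t / 2); rewrite -/n -[n.+1%:R]natr1 in tn'.
  lra.
rewrite {1}ZA mulrA divfK ?gt_eqF// mulrC -/a.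
by rewrite ler_wpM2r// ler_peMl// ler1n.
Qed.

End global.
End upper_bounds.

(** * Lower bounds for profiles *)

Section lower_bounds.
Context {R : realType}.
Local Notation mu := (@lebesgue_measure R).
Variables (Sigma : set (R * R)) (M : R) (Q : R -> R).
Hypotheses (ds : damping_set Sigma) (M_gt0 : 0 < M) (decQ : decay_function Q).
Hypothesis near0 : forall x y : R,
  (rotation @` Sigma `&` euclidean_ball M) (x, y) -> Q `|x| <= `|y|.

Lemma orbit_facts_below (g : R -> R) : profile Sigma g ->
  {ae mu, forall s, -1 < s -> forall n : nat,
    `|g (s + 2 * n.+1%:R)| <= `|g (s + 2 * n%:R)| /\
    (`|g (s + 2 * n%:R)| <= M / Num.sqrt 2 ->
     Q `|g (s + 2 * n%:R)| <= `|g (s + 2 * n.+1%:R)|)}.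
Proof.
move=> [_ rel]; have := orbit_ae (P := fun x y => (rotation @` Sigma) (x, y)) rel.
apply: ae_mono => s H s1 n; have Hn := H s1 n.
have d := rotation_damping ds Hn; split => // small.
by apply: near0; split => //; exact: euclidean_ball_small.
Qed.

(** From step k on, each orbit through E stays above the iterates of Q from c.
    The shift from c to Q c accounts for the window at time t being compared
    with the one at the next even time. *)
Lemma small_mass_lower_bound (g : R -> R) (q : \bar R) (t c : R) (k : nat)
    (E : set R) : profile Sigma g -> (1 <= q)%E -> 0 <= t -> 0 < c ->
  measurable E -> E `<=` window 0 ->
  {ae mu, forall s, E s -> c <= `|g (s + 2 * k%:R)| <= M / Num.sqrt 2} ->
  ((Num.min 1 (fine (mu E)) * iter (Num.truncn (t / 2)) Q (Q c))%:E <=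
    norm_on (window t) q g)%E.
Proof.
move=> pr q1 t0 c0 mE EW H.
have [_ tn] := truncn_window t0; set n := Num.truncn _ in tn *.
(* A step that is after both time t and step k; N - k <= n.+1 in any case. *)
pose N := maxn n.+1 k.
have tN : t <= 2 * N%:R.
  by apply: (le_trans tn); rewrite ler_pM2l// ler_nat leq_maxl.
have kN : (k <= N)%N by exact: leq_maxr.
have iN : 0 <= iter (N - k) Q c by apply: iter_decay_ge0 => //; exact: ltW.
apply: le_trans; last first.
  apply: (window_lower ds pr q1 t0 tN iN mE EW).
  move: (orbit_facts_below pr) H; apply: ae_mono2 => s O H Es.
  have /in_window0/andP[s1 _] := EW s Es; have F := O s1.
  have /andP[cg gM] := H Es.
  pose x (j : nat) := `|g (s + 2 * j%:R)|.
  rewrite -{2}(subnKC kN).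
  apply: (@seq_ge_iter R Q decQ x (M / Num.sqrt 2) c k (N - k)) => //.
  - by move=> j; exact: normr_ge0.
  - by move=> j; exact: (F j).1.
  - by move=> j; exact: (F j).2.
  - exact: ltW.
rewrite -iterSr lee_fin mulrC ler_wpM2r//.
  by rewrite le_min ler01 fine_ge0.
apply: iter_decay_nincr => //; first exact: ltW.
by rewrite leq_subLR geq_max leq_addr addnC -ltnS ltnS leq_addr.
Qed.

(** Orbits that never become small: the energy is bounded below by a constant. *)
Lemma large_mass_lower_bound (g : R -> R) (q : \bar R) (t : R) (E : set R) :
  profile Sigma g -> (1 <= q)%E -> 0 <= t ->
  measurable E -> E `<=` window 0 ->
  {ae mu, forall s, E s -> forall k : nat,
    M / Num.sqrt 2 <= `|g (s + 2 * k%:R)|} ->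
  ((Num.min 1 (fine (mu E)) *
    iter (Num.truncn (t / 2)) Q (M / Num.sqrt 2))%:E <=
    norm_on (window t) q g)%E.
Proof.
move=> pr q1 t0 mE EW H.
have [_ tn] := truncn_window t0; set n := Num.truncn _ in tn *.
have c0 : 0 <= M / Num.sqrt 2 by rewrite divr_ge0 ?ltW.
apply: le_trans; last first.
  apply: (window_lower ds pr q1 t0 tn c0 mE EW).
  by move: H; apply: ae_mono => s H Es; exact: H.
rewrite lee_fin mulrC ler_wpM2r//; first by rewrite le_min ler01 fine_ge0.
exact: (@iter_decay_nincr _ Q decQ n 0%N).
Qed.

(** If (x, 0) belongs to the rotated set, it comes from a point of the set on
    the diagonal, so x = 0: an orbit cannot reach zero in finite time. *)
Lemma diagonal_orbit_neq0 (g : R -> R) : profile Sigma g ->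
  Sigma `&` plane_diagonal = [set (0, 0)] ->
  {ae mu, forall s, -1 < s -> g s != 0 -> forall n : nat,
    g (s + 2 * n%:R) != 0}.
Proof.
move=> [_ rel] diag.
have := orbit_ae (P := fun x y => (rotation @` Sigma) (x, y)) rel.
apply: ae_mono => s H s1 gs; elim => [|n IH]; first by rewrite mulr0 addr0.
apply: contra IH => /eqP gn; have [[a b] Sab e] := H s1 n.
have ab : (Sigma `&` plane_diagonal) (a, b).
  split => //; rewrite /plane_diagonal/=.
  have : (- a + b) / Num.sqrt 2 = 0 by case: e => _ ->.
  move/eqP; rewrite mulf_eq0 invr_eq0 (gt_eqF (@sqrt2_gt0 R)) orbF.
  by rewrite addrC subr_eq0 => /eqP ->.
move: ab; rewrite diag => -[a0 b0].
by case: e => <- _; rewrite a0 b0 /= addr0 mul0r.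
Qed.

Lemma min1_gt0 (x : R) : 0 < x -> 0 < Num.min 1 x.
Proof. by move=> x0; rewrite lt_min ltr01. Qed.

(** Either, at some step, a set of orbits of positive measure has nonzero values
    below M / sqrt 2, or almost all the orbits that start from a nonzero value
    stay above M / sqrt 2 forever. The solution is nontrivial, so these orbits
    have positive measure. *)
Lemma diagonal_lower_bound (g : R -> R) : profile Sigma g ->
  Sigma `&` plane_diagonal = [set (0, 0)] ->
  ~ {ae mu, forall s, -1 < s < 1 -> g s = 0} ->
  exists C1 C2 : R, [/\ 0 < C1, 0 < C2 &
    forall (q : \bar R) (t : R), (1 <= q)%E -> 0 <= t ->
      ((C1 * iter (Num.truncn (t / 2)) Q C2)%:E <= norm_on (window t) q g)%E].
Proof.
move=> pr diag nz.
have [_ _ Qpos _] := decQ; have [mg _] := pr.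
have mw : measurable_fun (`]-1, 1[%classic : set R) g.
  apply: (measurable_funS measurable_profile_domain _ mg).
  by move=> s; rewrite /profile_domain/= !in_itv/= andbT => /andP[].
have [[k Hk]|no] := pselect (exists k : nat, ~ {ae mu, forall s, -1 < s < 1 ->
    ~ (0 < `|g (s + 2 * k%:R)| <= M / Num.sqrt 2)}).
  have k0 : 0 <= 2 * k%:R :> R by rewrite mulr_ge0.
  have [mgk _] := profile_shift k0 pr.
  have mh : measurable_fun (`]-1, 1[%classic : set R) (fun s => g (s + 2 * k%:R)).
    have -> : (fun s => g (s + 2 * k%:R)) = (fun s => g (2 * k%:R + s)).
      by apply/funext => s; rewrite addrC.
    apply: (measurable_funS measurable_profile_domain _ mgk).
    by move=> s; rewrite /profile_domain/= !in_itv/= andbT => /andP[].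
  have [c c0 [mE E0]] := positive_mass mh Hk.
  exists (Num.min 1 (fine (mu [set s | -1 < s < 1 /\
    c <= `|g (s + 2 * k%:R)| <= M / Num.sqrt 2]))), (Q c).
  split; first exact: min1_gt0.
    by have /andP[] := Qpos c c0.
  move=> q t q1 t0; apply: (small_mass_lower_bound pr q1 t0 c0 mE) => //.
  - by move=> s [s1 _]; apply/in_window0.
  - by apply: aeW => s [_ h]; exact: h.
pose E := `]-1, 1[%classic `&` g @^-1` [set~ 0].
have mE : measurable (E : set (measurableTypeR R)).
  apply: mw; first exact: measurable_itv.
  by apply: measurableC; exact: measurable_set1.
have EW : E `<=` window 0 by move=> s [s1 _]; apply/in_window0; move: s1; rewrite /= in_itv.
have le : (mu E <= mu (window (0 : R)))%E.
  by apply: le_measure; rewrite ?inE; [exact: mE|exact: measurable_window|].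
rewrite measure_window in le.
have E0 : 0 < fine (mu E).
  rewrite fine_gt0// (le_lt_trans le) ?ltry// andbT lt0e measure_ge0 andbT.
  apply/eqP => /(measure0_ae_not mE) H; apply: nz.
  move: H; apply: ae_mono => s H s1; apply: contrapT => gs; apply: H.
  by split; rewrite /= ?in_itv.
exists (Num.min 1 (fine (mu E))), (M / Num.sqrt 2); split.
- exact: min1_gt0.
- by rewrite divr_gt0// sqrt2_gt0.
move=> q t q1 t0; apply: (large_mass_lower_bound pr q1 t0 mE EW).
have big : {ae mu, forall s, forall k : nat, -1 < s < 1 ->
    ~ (0 < `|g (s + 2 * k%:R)| <= M / Num.sqrt 2)}.
  by apply: ae_foralln => k; apply: contrapT => Hk; apply: no; exists k.
move: big (diagonal_orbit_neq0 pr diag); apply: ae_mono2 => s B O Es k.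
have /in_window0 s11 := EW s Es; have /andP[s1 _] := s11.
have /eqP gs : g s <> 0 by have [] := Es.
rewrite leNgt; apply/negP => gk; apply: (B k s11).
by rewrite normr_gt0 O//= ltW.
Qed.

End lower_bounds.

(** * Bounds for solutions *)

Section solutions.
Context {R : realType}.
Local Notation mu := (@lebesgue_measure R).
Variable Sigma : set (R * R).
Hypothesis ds : damping_set Sigma.

(** At time 0 the window is ]-1, 1[, which is one of the intervals on which g
    is assumed to be L^p. *)
Lemma initial_norm_fin (p : \bar R) (z0 z1 : R -> R) (z : R -> R -> R)
    (f g : R -> R) :
  weak_solution Sigma p z0 z1 z f g -> norm_on (window 0) p g \is a fin_num.
Proof.
move=> [_ [_ [_ H] _ _ _]].
have lt1 : -1 < 1 :> R by lra.
have [_ fin] := H 1 lt1.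
by rewrite ge0_fin_numE ?norm_on_ge0// /window sub0r add0r.
Qed.

Section upper.
Variables (M0 : R) (Q : R -> R).
Hypotheses (M00 : 0 < M0) (decQ : decay_function Q).
Hypothesis near0 : forall x y : R,
  (rotation @` Sigma `&` euclidean_ball M0) (x, y) -> `|y| <= Q `|x|.

Lemma small_data_decay (g0 z0 z1 : R -> R) (q : \bar R) (z : R -> R -> R)
    (f g : R -> R) : (1 <= q)%E ->
  (Ynorm +oo g0 <= (M0 / Num.sqrt 2)%:E)%E -> frakI +oo z0 z1 g0 ->
  weak_solution Sigma q z0 z1 z f g ->
  let Z p := fine (energy p z f g 0) in
  (forall t : R, 0 <= t ->
    (energy +oo z f g t <= (iter (Num.truncn (t / 2)) Q (Z +oo%E))%:E)%E) /\
  (forall p : R, 1 <= p -> forall t : R, 0 <= t ->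
    (energy p%:E z f g t <=
      (2 `^ p^-1 * iter (Num.truncn (t / 2)) Q (Num.sqrt (Z p%:E)) +
       Num.sqrt (Z p%:E) *
         iter (Num.truncn (t / 2)) Q
           (Num.max (Z +oo%E) (Num.sqrt (Z p%:E))))%:E)%E).
Proof.
move=> q1 g0M fI sol Z.
have pr := solution_profile q1 sol.
have tr := frakI_trace q1 (leey _) sol fI.
have MM : 0 <= M0 / Num.sqrt 2 by rewrite divr_ge0 ?ltW.
have gM : (norm_on (window 0) +oo g <= (M0 / Num.sqrt 2)%:E)%E.
  apply/norm_on_ooP => //; move/norm_on_ooP : g0M => /(_ MM).
  move: tr; apply: ae_mono2 => s e H /in_window0 s1; rewrite -e//; apply: H.
  by rewrite /= in_itv.
have finf : norm_on (window 0) +oo g \is a fin_num.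
  by rewrite ge0_fin_numE ?norm_on_ge0// (le_lt_trans gM)// ltry.
have ZE p : (1 <= p)%E -> Z p = fine (norm_on (window 0) p g).
  by move=> p1; rewrite /Z (energyE q1 sol p1 (lexx 0)).
split => [t t0|p p1 t t0].
  rewrite (energyE q1 sol (leey _) t0) (ZE _ (leey _)).
  apply: (infty_decay ds M00 decQ near0 pr t0); last by rewrite fineK.
  by rewrite -lee_fin fineK.
have p1' : (1 <= p%:E)%E by rewrite lee_fin.
rewrite (energyE q1 sol p1' t0) (ZE _ (leey _)) (ZE _ p1').
exact: (finite_decay ds M00 decQ near0 pr p1 t0 gM).
Qed.

(** The solution is restarted at time tz, where its energy is at most c. *)
Lemma ugas_local_decay (beta : R -> R -> R) (z0 z1 : R -> R)
    (z : R -> R -> R) (f g : R -> R) : UGAS_with_rate Sigma +oo beta ->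
  weak_solution Sigma +oo z0 z1 z f g ->
  let e0 := fine (energy +oo z f g 0) in
  let c := Num.min e0 (M0 / Num.sqrt 2) in
  exists2 tz : R, first_time (beta e0) c tz &
    forall t : R, tz <= t ->
      (energy +oo z f g t <= (iter (Num.truncn ((t - tz) / 2)) Q c)%:E)%E.
Proof.
move=> [kl ug] sol e0 c.
have pr := solution_profile (leey _) sol; have [mg _] := pr.
have EE t (t0 : 0 <= t) := energyE (leey _) sol (leey _) t0.
have MM : 0 < M0 / Num.sqrt 2 by rewrite divr_gt0// sqrt2_gt0.
have e00 : 0 <= e0 by rewrite fine_ge0// EE// norm_on_ge0.
have fin0 : energy +oo z f g 0 \is a fin_num by rewrite EE// (initial_norm_fin sol).
have e0b : e0 <= beta e0 0.
  by rewrite -lee_fin fineK//; exact: ug sol _ (lexx 0).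
have c0 : 0 <= c by rewrite le_min e00 ltW.
have cpos : 0 < e0 -> 0 < c by move=> e01; rewrite lt_min e01.
have ce : c <= e0 by rewrite ge_min lexx.
have [tz ft] := KL_first_time kl e00 c0 cpos ce e0b.
exists tz => // t tzt; have [tz0 bc _] := ft.
have t0 : 0 <= t by exact: le_trans tzt.
have gc : (norm_on (window tz) +oo g <= c%:E)%E.
  by rewrite -bc -EE//; exact: ug sol _ tz0.
have pr' := profile_shift tz0 pr.
have mw (u : R) : 0 <= u -> measurable_fun (window u) g.
  by move=> u0; exact: (measurable_funS measurable_profile_domain (window_sub u0) mg).
have sh (u : R) : 0 <= u -> norm_on (window (tz + u)) +oo g =
    norm_on (window u) +oo (fun s => g (tz + s)).
  by move=> u0; apply: (window_shift (leey _)); apply: mw; exact: addr_ge0.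
have u0 : 0 <= t - tz by rewrite subr_ge0.
rewrite EE// -[in X in (X <= _)%E](subrKC tz t) sh//.
apply: (infty_decay ds M00 decQ near0 pr' u0).
  by rewrite ge_min lexx orbT.
by rewrite -sh// addr0.
Qed.

(** A delay tau K is chosen for each bound K on the initial data: the two times
    of the statement are the delays for sqrt Z_p and for Z. *)
Lemma ugas_global_decay (M m : R) : 0 < M -> 0 < m < 1 ->
  (forall x y : R, (rotation @` Sigma `\` euclidean_ball M) (x, y) ->
    `|y| <= m * `|x|) ->
  UGAS Sigma +oo ->
  exists (t1 : R -> R -> R) (t2 : R -> R -> nat),
    forall (p : \bar R) (z0 z1 : R -> R) (z : R -> R -> R) (f g : R -> R),
    (1 <= p)%E ->
    weak_solution Sigma p z0 z1 z f g ->
    let Zp := fine (energy p z f g 0) in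
    let Z := Num.max M (Num.sqrt Zp) in
    \forall t \near +oo,
      (energy p z f g t <=
        (2 * iter (Num.truncn ((t - t1 Zp Z) / 2)) Q (Num.sqrt Zp) +
         2 * Num.sqrt Zp * iter (Num.truncn (t / 2) - t2 Zp Z)%N Q Z +
         Zp * m `^ (t / 4 - 2^-1))%:E)%E.
Proof.
move=> M_gt0 m01 far [beta ug]; have [kl _] := ug.
have MM : 0 < M0 / Num.sqrt 2 by rewrite divr_gt0// sqrt2_gt0.
have small K : exists n : nat, 0 <= K -> beta K (2 * n%:R) <= M0 / Num.sqrt 2.
  have [K0|K0] := leP 0 K; last by exists 0%N.
  by have [n hn] := KL_small kl K0 MM; exists n.
have [tau tauP] := choice small.
exists (fun Zp _ => 2 * (tau (Num.sqrt Zp))%:R), (fun _ Z => (tau Z).+1).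
move=> p z0 z1 z f g p1 sol Zp Z.
have pr := solution_profile p1 sol.
have ZE : Zp = fine (norm_on (window 0) p g).
  by rewrite /Zp (energyE p1 sol p1 (lexx 0)).
have [T HT] := global_decay ds M00 decQ near0 pr M_gt0 m01 far ug tauP p1
  (initial_norm_fin sol).
exists (Num.max T 0); split; first exact: num_real.
move=> t; rewrite gt_max => /andP[Tt t0].
rewrite (energyE p1 sol p1 (ltW t0)) /Z ZE.
exact: HT (ltW Tt).
Qed.

End upper.

Section lower.
Variables (M : R) (Q : R -> R).
Hypotheses (M_gt0 : 0 < M) (decQ : decay_function Q).
Hypothesis near0 : forall x y : R,
  (rotation @` Sigma `&` euclidean_ball M) (x, y) -> Q `|x| <= `|y|.

(** If g0 is not measurable on ]-1, 1[, it is the initial profile of no solution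
    and the bound holds vacuously. *)
Lemma small_data_lower_bound (g0 : R -> R) :
  (0 < mu [set s : R | -1 <= s <= 1 /\ 0 < `|g0 s| <= M / Num.sqrt 2]%R)%E ->
  exists C1 C2 : R, [/\ 0 < C1, 0 < C2 &
    forall (p : \bar R) (z0 z1 : R -> R) (z : R -> R -> R) (f g : R -> R),
    (1 <= p)%E ->
    frakI p z0 z1 g0 ->
    weak_solution Sigma p z0 z1 z f g ->
    forall t : R, 0 <= t ->
      ((C1 * iter (Num.truncn (t / 2)) Q C2)%:E <= energy p z f g t)%E].
Proof.
move=> S0; have [_ _ Qpos _] := decQ.
have [mg0|nmg0] := pselect (measurable_fun (`]-1, 1[%classic : set R) g0); last first.
  exists 1, 1; split => // p z0 z1 z f g _ [_ [mg0 _] _].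
  by case: (nmg0 mg0).
set S := (X in mu X) in S0.
have mS : measurable (S : set (measurableTypeR R)).
  have -> : S = `[-1, 1]%classic `&` (fun s => `|g0 s|) @^-1` `]0, M / Num.sqrt 2]%classic.
    by apply/seteqP; split => s /=; rewrite !in_itv.
  have mn : measurable_fun (`[-1, 1]%classic : set R) (fun s => `|g0 s|).
    by apply: measurableT_comp => //; exact: measurable_fun_itv_cc mg0.
  by apply: mn; exact: measurable_itv.
have Hk : ~ {ae mu, forall s, -1 < s < 1 -> ~ (0 < `|g0 s| <= M / Num.sqrt 2)}.
  move=> H; move: S0; rewrite (_ : mu S = 0%E) ?ltxx//.
  apply: ae_not_measure0 => //.
  move: H (ae_neq (-1 : R)) (ae_neq (1 : R)); apply: ae_mono3.
  move=> s H sN1 sn1 [/andP[s1 s2] /H]; apply.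
  by rewrite !lt_neqAle s1 s2 sn1 eq_sym sN1.
have [c c0 [mE E0]] := positive_mass mg0 Hk.
exists (Num.min 1 (fine (mu [set s | -1 < s < 1 /\
  c <= `|g0 s| <= M / Num.sqrt 2]))), (Q c).
split; first exact: min1_gt0.
  by have /andP[] := Qpos c c0.
move=> p z0 z1 z f g p1 fI sol t t0.
have pr := solution_profile p1 sol.
rewrite (energyE p1 sol p1 t0).
apply: (small_mass_lower_bound (k := 0%N) ds M_gt0 decQ near0 pr p1 t0 c0 mE).
  by move=> s [s1 _]; apply/in_window0.
have := frakI_trace p1 p1 sol fI; apply: ae_mono => s e [s1 h].
by rewrite mulr0 addr0 -e.
Qed.

Lemma diagonal_solution_lower_bound (p : \bar R) (z0 z1 : R -> R)
    (z : R -> R -> R) (f g : R -> R) :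
  Sigma `&` plane_diagonal = [set (0, 0)] -> (1 <= p)%E ->
  weak_solution Sigma p z0 z1 z f g ->
  (exists t x : R, [/\ 0 <= t, 0 <= x <= 1 & z t x <> 0]) ->
  exists C1 C2 : R, [/\ 0 < C1, 0 < C2 &
    forall t : R, 0 <= t ->
      ((C1 * iter (Num.truncn (t / 2)) Q C2)%:E <= energy p z f g t)%E].
Proof.
move=> diag p1 sol nontriv; have pr := solution_profile p1 sol.
have [C1 [C2 [C10 C20 H]]] := diagonal_lower_bound ds M_gt0 decQ near0 pr diag
  (solution_nontrivial ds p1 sol nontriv).
exists C1, C2; split => // t t0.
by rewrite (energyE p1 sol p1 t0); exact: H.
Qed.

End lower.
End solutions.

Theorem theorem51 (R : realType) (Sigma : set (R * R)) :
  damping_set Sigma ->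
  (* (a) *)
  (forall (M0 : R) (Q : R -> R),
    0 < M0 -> decay_function Q ->
    (forall x y : R, (rotation @` Sigma `&` euclidean_ball M0) (x, y) ->
      `|y| <= Q `|x|) ->
    (* (a-i) *)
    (forall (g0 z0 z1 : R -> R) (q : \bar R) (z : R -> R -> R) (f g : R -> R),
      (1 <= q)%E ->
      (Ynorm +oo g0 <= (M0 / Num.sqrt 2)%:E)%E ->
      frakI +oo z0 z1 g0 ->
      weak_solution Sigma q z0 z1 z f g ->
      let Z p := fine (energy p z f g 0) in
      (forall t : R, 0 <= t ->
        (energy +oo z f g t <= (iter (Num.truncn (t / 2)) Q (Z +oo%E))%:E)%E) /\
      (forall p : R, 1 <= p -> forall t : R, 0 <= t ->
        (energy p%:E z f g t <=
          (2 `^ p^-1 * iter (Num.truncn (t / 2)) Q (Num.sqrt (Z p%:E)) +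
           Num.sqrt (Z p%:E) *
             iter (Num.truncn (t / 2)) Q
               (Num.max (Z +oo%E) (Num.sqrt (Z p%:E))))%:E)%E)) /\
    (* (a-ii) *)
    (forall beta : R -> R -> R, UGAS_with_rate Sigma +oo beta ->
      forall (z0 z1 : R -> R) (z : R -> R -> R) (f g : R -> R),
      weak_solution Sigma +oo z0 z1 z f g ->
      let e0 := fine (energy +oo z f g 0) in
      let c := Num.min e0 (M0 / Num.sqrt 2) in
      exists2 tz : R, first_time (beta e0) c tz &
        forall t : R, tz <= t ->
          (energy +oo z f g t <= (iter (Num.truncn ((t - tz) / 2)) Q c)%:E)%E) /\
    (* (a-iii) *)
    (forall M m : R, 0 < M -> 0 < m < 1 ->
      (forall x y : R, (rotation @` Sigma `\` euclidean_ball M) (x, y) ->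
        `|y| <= m * `|x|) ->
      UGAS Sigma +oo ->
      exists (t1 : R -> R -> R) (t2 : R -> R -> nat),
        forall (p : \bar R) (z0 z1 : R -> R) (z : R -> R -> R) (f g : R -> R),
        (1 <= p)%E ->
        weak_solution Sigma p z0 z1 z f g ->
        let Zp := fine (energy p z f g 0) in
        let Z := Num.max M (Num.sqrt Zp) in
        \forall t \near +oo,
          (energy p z f g t <=
            (2 * iter (Num.truncn ((t - t1 Zp Z) / 2)) Q (Num.sqrt Zp) +
             2 * Num.sqrt Zp * iter (Num.truncn (t / 2) - t2 Zp Z)%N Q Z +
             Zp * m `^ (t / 4 - 2^-1))%:E)%E)) /\
  (* (b) *)
  (forall (M : R) (Q : R -> R),
    0 < M -> decay_function Q ->
    (forall x y : R, (rotation @` Sigma `&` euclidean_ball M) (x, y) ->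
      Q `|x| <= `|y|) ->
    forall g0 : R -> R,
    (* first alternative *)
    ((0 < lebesgue_measure
           [set s : R | -1 <= s <= 1 /\ 0 < `|g0 s| <= M / Num.sqrt 2]%R)%E ->
      exists C1 C2 : R, [/\ 0 < C1, 0 < C2 &
        forall (p : \bar R) (z0 z1 : R -> R) (z : R -> R -> R) (f g : R -> R),
        (1 <= p)%E ->
        frakI p z0 z1 g0 ->
        weak_solution Sigma p z0 z1 z f g ->
        (exists t x : R, [/\ 0 <= t, 0 <= x <= 1 & z t x <> 0]) ->
        forall t : R, 0 <= t ->
          ((C1 * iter (Num.truncn (t / 2)) Q C2)%:E <= energy p z f g t)%E]) /\
    (* second alternative *)
    (Sigma `&` plane_diagonal = [set (0, 0)] ->
      forall (p : \bar R) (z0 z1 : R -> R) (z : R -> R -> R) (f g : R -> R),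
      (1 <= p)%E ->
      frakI p z0 z1 g0 ->
      weak_solution Sigma p z0 z1 z f g ->
      (exists t x : R, [/\ 0 <= t, 0 <= x <= 1 & z t x <> 0]) ->
      exists C1 C2 : R, [/\ 0 < C1, 0 < C2 &
        forall t : R, 0 <= t ->
          ((C1 * iter (Num.truncn (t / 2)) Q C2)%:E <= energy p z f g t)%E])).
Proof.
move=> ds; split => [M0 Q M00 decQ near0|M Q M_gt0 decQ near0 g0].
- split; [|split].
  + by move=> g0 z0 z1 q z f g; exact: small_data_decay.
  + by move=> beta ug z0 z1 z f g; exact: ugas_local_decay.
  + by move=> M m; exact: (ugas_global_decay ds M00 decQ near0).
- split => [S0|diag p z0 z1 z f g p1 _].
  + have [C1 [C2 [C10 C20 H]]] := small_data_lower_bound ds M_gt0 decQ near0 S0.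
    exists C1, C2; split => // p z0 z1 z f g p1 fI sol _; exact: H fI sol.
  + exact: (diagonal_solution_lower_bound ds M_gt0 decQ near0 diag p1).
Qed.
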